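(* Let $(M,g)$ be a strongly spin pseudo-Riemannian manifold of signature $(4,3)$, let $l\in\{-1,+1\}$ and let $\mathfrak{a}\in\Omega^1(\Lambda^<T^*M)$. Then $(M,g)$ admits a nowhere vanishing parallel spinor of type $(\Sigma,\gamma_l)$ relative to $\mathfrak{a}$ if and only if there exist $f\in C^\infty(M)$ and $\phi\in\Omega^3(M)$ such that $f+\phi$ is nowhere vanishing, $f+\phi\in\mathrm{Im}(\mathcal{E}^+_\Gamma)\subset\Gamma(\Lambda^<T^*M)$ for some irreducible paired spinor bundle $(S,\Gamma,\mathscr{B})$ on $(M,g)$ of type $(\Sigma,\gamma_l)$, and for every vector field $v\in\mathfrak{X}(M)$: $$\nabla_vf=2f\mathfrak{a}_v^{(0)}-2\langle\mathfrak{a}_v^{(3)},\phi\rangle,$$ $$\nabla_v\phi=2f\mathfrak{a}_v^{(3)}+2\mathfrak{a}_v^{(0)}\phi+2l*(\mathfrak{a}_v^{(1)}\wedge\phi)-2\mathfrak{a}_v^{(2)}\triangle_1\phi+2l*(\mathfrak{a}_v^{(3)}\triangle_1\phi).$$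
   Context: $(M,g)$ is connected and oriented, of signature $(4,3)$ (four positive, three negative directions); strongly spin means it is spin and every spin structure admits a reduction to the identity component of the spin group. $\nabla$ is the Levi-Civita connection (and its lift to spinor bundles), $\nu$ the volume form, $\langle\cdot,\cdot\rangle$ the metric induced on forms (determinant convention), $*$ the Hodge star ($\alpha\wedge*\beta=\langle\alpha,\beta\rangle\nu$), and $\alpha\triangle_1\beta=g^{ij}(\iota_{e_i}\alpha)\wedge(\iota_{e_j}\beta)$. $\Lambda^<T^*M=\bigoplus_{k=0}^3\Lambda^kT^*M$; superscript $(k)$ denotes the degree-$k$ component, and $\mathfrak{a}_v=\mathfrak{a}(v)$. $\mathrm{Cl}(M,g)$ is the Clifford bundle of $(T^*M,g^* )$ with $\theta^2=g^*(\theta,\theta)$, identified with $(\Lambda T^*M,\diamond)$, where $\theta\diamond\alpha=\theta\wedge\alpha+\iota_{\theta^\sharp}\alpha$ for one-forms $\theta$. On $a$-forms, $\pi=(-1)^a$, $\tau=(-1)^{\binom a2}$. $\gamma_l:\mathrm{Cl}(4,3)\to\mathrm{End}(\Sigma)$ is the irreducible real eight-dimensional representation in which the volume form acts as $l\,\mathrm{Id}$. An irreducible paired spinor bundle $(S,\Gamma,\mathscr{B})$ of type $(\Sigma,\gamma_l)$ is a real vector bundle $S$ with a unital morphism of bundles of algebras $\Gamma:\mathrm{Cl}(M,g)\to\mathrm{End}(S)$ fibrewise isomorphic to $(\Sigma,\gamma_l)$ and an admissible pairing $\mathscr{B}$ (non-degenerate symmetric, $\mathscr{B}(\Gamma(x)\varepsilon_1,\varepsilon_2)=\mathscr{B}(\varepsilon_1,\Gamma((\pi\circ\tau)(x))\varepsilon_2)$);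 it is associated to a spin structure. $\Psi^<_\Gamma:\Lambda^<T^*M\to\mathrm{End}(S)$, $\alpha\mapsto\Gamma\big(\frac12(\alpha+l\,\nu\diamond\alpha)\big)$, is a vector bundle isomorphism, and for $\mu\in\{\pm1\}$, $\mathcal{E}^\mu_\Gamma(\varepsilon)=(\Psi_\Gamma^<)^{-1}(\mu\,\varepsilon\otimes\mathscr{B}(-,\varepsilon))$, applied pointwise to sections of $S$. A section $\varepsilon\in\Gamma(S)$ is a parallel spinor of type $(\Sigma,\gamma_l)$ relative to $\mathfrak{a}$ if $\nabla_v\varepsilon=\Psi^<_\Gamma(\mathfrak{a}_v)\varepsilon$ for all $v\in\mathfrak{X}(M)$, for some such $(S,\Gamma,\mathscr{B})$. *)

(* Defs.v *)
From HB Require Import structures.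
From mathcomp Require Import all_boot all_order all_algebra.
From mathcomp Require Import all_classical all_reals all_analysis.
Import Order.TTheory GRing.Theory Num.Theory.
Import numFieldNormedType.Exports.

Set Implicit Arguments.
Unset Strict Implicit.
Unset Printing Implicit Defensive.

Local Open Scope classical_set_scope.
Local Open Scope ring_scope.

(** * Exterior and Clifford algebra of R^{4,3} *)

(* An exterior form on R^7 is given by its coefficients: [al I] is the
   coefficient of e^{i_1} /\ ... /\ e^{i_k} for I = {i_1 < ... < i_k}, where
   (e^i) is the basis dual to an oriented orthonormal basis (e_i).  Vectors and
   covectors are rows of components in (e_i) and (e^i) respectively. *)
Notation extform R := {ffun {set 'I_7} -> R^o}.

Section Algebra.
Variable R : realType.
Implicit Types (al be : extform R) (v th : 'rV[R]_7) (I J K : {set 'I_7}).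

Definition eta (i : 'I_7) : R := if (i < 4)%N then 1 else -1.
Definition eta_mx : 'M[R]_7 := diag_mx (\row_i eta i).

Definition ext_basis I : extform R := [ffun J => (J == I)%:R].
Definition ext_scalar (c : R) : extform R := c *: ext_basis finset.set0.
Definition ext_covec th : extform R :=
  \sum_(i < 7) th ord0 i *: ext_basis (finset.set1 i).
Definition ext_vol : extform R := ext_basis finset.setT.

Definition ext_part (k : nat) al : extform R :=
  [ffun I : {set 'I_7} => if #|I| == k then al I else 0].
Definition ext_homog (k : nat) al := forall I : {set 'I_7}, #|I| != k -> al I = 0.
Definition ext_low al := forall I : {set 'I_7}, (3 < #|I|)%N -> al I = 0.

(* The sign of the permutation sorting the concatenation of I and J is
   (-1) ^+ inversions I J. *)
Definition inversions I J : nat :=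
  #|[set p : 'I_7 * 'I_7 | [&& p.1 \in I, p.2 \in J & (p.2 < p.1)%N]]%SET|.

Definition wedge al be : extform R :=
  [ffun K : {set 'I_7} => \sum_(I : {set 'I_7} | I \subset K)
    (-1) ^+ inversions I (K :\: I)%SET * (al I * be (K :\: I)%SET)].

Definition int_prod v al : extform R :=
  [ffun K : {set 'I_7} => \sum_(i < 7 | i \notin K)
    v ord0 i * ((-1) ^+ #|[set k in K | (k < i)%N]%SET| * al (i |: K)%SET)].

(* al(w_1, ..., w_k), with the convention
   (e^1 /\ ... /\ e^k)(e_1, ..., e_k) = 1 *)
Definition ext_eval al (ws : seq 'rV[R]_7) : R :=
  foldl (fun b w => int_prod w b) al ws finset.set0.

Definition ext_inner al be : R := \sum_(I : {set 'I_7}) (\prod_(i in I) eta i) * (al I * be I).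

(* On basis elements, * e^J = (+/-) <e^J, e^J> e^{J^c}, the sign being such that
   e^J /\ * e^J = <e^J, e^J> vol. *)
Definition hodge al : extform R :=
  [ffun K : {set 'I_7} => (-1) ^+ inversions (~: K)%SET K *
    ((\prod_(i in (~: K)%SET) eta i) * al (~: K)%SET)].

Definition triangle1 al be : extform R :=
  \sum_(i < 7) eta i *: wedge (int_prod (delta_mx ord0 i) al)
                              (int_prod (delta_mx ord0 i) be).

(* th <> al = th /\ al + iota_{th^#} al *)
Definition cl_covec th al : extform R :=
  wedge (ext_covec th) al + int_prod (th *m eta_mx) al.

(* As the basis is orthonormal, e^{i_1} /\ ... /\ e^{i_k} is also the Clifford
   product of e^{i_1}, ..., e^{i_k} ([enum I] is increasing). *)
Definition cl_mul al be : extform R :=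
  \sum_(I : {set 'I_7}) al I *: foldr (fun i => cl_covec (delta_mx ord0 i)) be (enum I).

Definition pi_tau al : extform R :=
  [ffun I : {set 'I_7} => (-1) ^+ (#|I| + 'C(#|I|, 2)) * al I].

Definition cl_rep m (rho : extform R -> 'M[R]_m) :=
  [/\ linear rho, rho (ext_scalar 1) = 1%:M
    & forall al be, rho (cl_mul al be) = rho al *m rho be].

(* Endomorphisms act on columns; the row space of V is the candidate
   subspace. *)
Definition cl_irreducible m (rho : extform R -> 'M[R]_m) :=
  (0 < m)%N /\
  forall V : 'M[R]_m, (forall al, stablemx V (rho al)^T) ->
    V != 0 -> row_full V.

Definition is_gamma (l : R) (gam : extform R -> 'M[R]_8) :=
  [/\ cl_rep gam, cl_irreducible gam & gam ext_vol = l%:M].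

Definition unit_covec th :=
  let q := (th *m eta_mx *m th^T) ord0 ord0 in q = 1 \/ q = -1.

Definition Spin : set (extform R) :=
  [set s | exists ths : seq 'rV[R]_7,
    [/\ ~~ odd (size ths), forall th, th \in ths -> unit_covec th
      & s = foldr (fun th => cl_mul (ext_covec th)) (ext_scalar 1) ths]].

(* Spin is a Lie group, so its identity component is its path component at the
   identity. *)
Definition Spin0 : set (extform R) :=
  [set s | exists p : R -> extform R,
    [/\ forall I, continuous (fun t => p t I : R), forall t, Spin (p t),
        p 0 = ext_scalar 1 & p 1 = s]].

End Algebra.

Arguments eta_mx {R}.
Arguments ext_basis {R}.
Arguments ext_vol {R}.

(** * Smooth manifolds *)

(* C^k functions on an open set *)
Fixpoint Ck (R : realType) n (k : nat) (A : set 'rV[R]_n) (f : 'rV[R]_n -> R) :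
    Prop :=
  match k with
  | 0%N => forall x, A x -> {for x, continuous f}
  | k'.+1 => (forall x, A x -> {for x, continuous f}) /\
      forall i : 'I_n, (forall x, A x -> derivable f x (delta_mx ord0 i)) /\
        Ck k' A (fun x => 'D_(delta_mx ord0 i) f x)
  end.

Definition smooth_Rn (R : realType) n (A : set 'rV[R]_n) (f : 'rV[R]_n -> R) :=
  forall k, Ck k A f.

Record manifold (R : realType) (n : nat) := Manifold {
  mf_space :> topologicalType;
  mf_hausdorff : hausdorff_space mf_space;
  mf_second_countable : @second_countable mf_space;
  chart : Type;
  chart_dom : chart -> set mf_space;
  coord : chart -> mf_space -> 'rV[R]_n;
  coord_inv : chart -> 'rV[R]_n -> mf_space;
  chart_at : mf_space -> chart;
  chart_atP : forall x, chart_dom (chart_at x) x;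
  chart_dom_open : forall c, open (chart_dom c);
  chart_img_open : forall c, open (coord c @` chart_dom c);
  coordK : forall c x, chart_dom c x -> coord_inv c (coord c x) = x;
  coord_continuous : forall c, {within chart_dom c, continuous (coord c)};
  coord_inv_continuous : forall c,
    {within coord c @` chart_dom c, continuous (coord_inv c)};
  transition_smooth : forall c d (k : 'I_n),
    smooth_Rn (coord c @` (chart_dom c `&` chart_dom d))
      (fun y => coord d (coord_inv c y) ord0 k) }.

Section Manifold.
Variables (R : realType) (n : nat) (M : manifold R n).

Definition smooth_fun (U : set M) (f : M -> R) :=
  forall c : chart M,
    smooth_Rn (coord c @` (U `&` chart_dom c)) (fun y => f (coord_inv c y)).

Definition partial (c : chart M) (k : 'I_n) (f : M -> R) (x : M) : R :=
  'D_(delta_mx ord0 k) (fun y => f (coord_inv c y)) (coord c x).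

(* Row-vector convention: the components of a tangent vector satisfy
   v_d = v_c *m jacobian_mx c d x. *)
Definition jacobian_mx (c d : chart M) (x : M) : 'M[R]_n :=
  \matrix_(i, j) partial c i (fun y => coord d y ord0 j) x.

End Manifold.

(** * Oriented pseudo-Riemannian manifolds of signature (4,3) *)

Record pseudoRiemannian (R : realType) := PseudoRiemannian {
  pr_manifold :> manifold R 7;
  pr_oriented : forall (c d : chart pr_manifold) x,
    chart_dom c x -> chart_dom d x -> 0 < \det (jacobian_mx c d x);
  metric : chart pr_manifold -> pr_manifold -> 'M[R]_7;
  metric_smooth : forall c i j,
    smooth_fun (chart_dom c) (fun x => metric c x i j);
  metric_tensor : forall c d x, chart_dom c x -> chart_dom d x ->
    metric c x = jacobian_mx c d x *m metric d x *m (jacobian_mx c d x)^T;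
  metric_sym : forall c x, chart_dom c x -> (metric c x)^T = metric c x;
  metric_signature : forall c x, chart_dom c x ->
    exists2 P : 'M[R]_7, P \in unitmx & P *m metric c x *m P^T = eta_mx }.

Section Geometry.
Variables (R : realType) (M : pseudoRiemannian R).

(* An arbitrary (in general discontinuous) choice, at every point, of an
   oriented orthonormal basis of the tangent space; its vectors are the rows of
   [onb c x], in the coordinates of the chart c.  It is used to write tensors at
   x in components, so that T_x M = 'rV_7 and Lambda T*_x M = extform R for all
   x.  Smoothness never refers to this choice. *)
Definition onb (c : chart M) (x : M) : 'M[R]_7 :=
  xget 1%:M [set P : 'M[R]_7 |
      P *m metric (chart_at x) x *m P^T = eta_mx /\ 0 < \det P]
    *m jacobian_mx (chart_at x) c x.

Definition smooth_vfield (U : set M) (v : M -> 'rV[R]_7) :=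
  forall (c : chart M) (k : 'I_7),
    smooth_fun (U `&` chart_dom c) (fun y => (v y *m onb c y) ord0 k).

Definition smooth_form (U : set M) (al : M -> extform R) :=
  forall (V : set M) (ws : seq (M -> 'rV[R]_7)), open V -> V `<=` U ->
    (forall j, (j < size ws)%N -> smooth_vfield V (nth (fun=> 0) ws j)) ->
    smooth_fun V (fun x => ext_eval (al x) [seq w x | w <- ws]).

(* One-forms with values in Lambda^< T*M *)
Definition smooth_one_form_low (a : M -> 'rV[R]_7 -> extform R) :=
  [/\ forall x, linear (a x), forall x v, ext_low (a x v)
    & forall (U : set M) v, open U -> smooth_vfield U v ->
        smooth_form U (fun x => a x (v x))].

Definition dir (v : 'rV[R]_7) (f : M -> R) (x : M) : R :=
  \sum_(k < 7) (v *m onb (chart_at x) x) ord0 k * partial (chart_at x) k f x.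

Definition christoffel (c : chart M) (x : M) (k i j : 'I_7) : R :=
  2^-1 * \sum_(m < 7) invmx (metric c x) k m *
    (partial c i (fun y => metric c y j m) x
     + partial c j (fun y => metric c y i m) x
     - partial c m (fun y => metric c y i j) x).

(* The Levi-Civita connection on vector fields, at x *)
Definition nabla_vf (v : 'rV[R]_7) (w : M -> 'rV[R]_7) (x : M) : 'rV[R]_7 :=
  let c := chart_at x in
  let vc := v *m onb c x in
  let wc := w x *m onb c x in
  (\row_k (dir v (fun y => (w y *m onb c y) ord0 k) x
           + \sum_(i < 7) \sum_(j < 7)
               christoffel c x k i j * vc ord0 i * wc ord0 j))
    *m invmx (onb c x).

(* (nabla_v al)(w_1, ..., w_k)
   = v(al(w_1, ..., w_k)) - \sum_j al(w_1, ..., nabla_v w_j, ..., w_k) *)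
Definition nabla_form_eval (v : 'rV[R]_7) (al : M -> extform R)
    (ws : seq (M -> 'rV[R]_7)) (x : M) : R :=
  dir v (fun y => ext_eval (al y) [seq w y | w <- ws]) x
  - \sum_(j < size ws)
      ext_eval (al x)
        (set_nth 0 [seq w x | w <- ws] j (nabla_vf v (nth (fun=> 0) ws j) x)).

(* Extension of a tangent vector at x to the local vector field with constant
   components in the chart at x *)
Definition const_ext (x : M) (u : 'rV[R]_7) (y : M) : 'rV[R]_7 :=
  u *m onb (chart_at x) x *m invmx (onb (chart_at x) y).

(* The Levi-Civita connection on forms, at x *)
Definition nabla_form (v : 'rV[R]_7) (al : M -> extform R) (x : M) :
    extform R :=
  [ffun I : {set 'I_7} => nabla_form_eval v al
    [seq const_ext x (delta_mx ord0 i) | i <- enum I] x].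

(** * Spin structures *)

(* A spin structure, given by local sections over an open cover.  The section
   over [ss_dom i] projects to the smooth oriented orthonormal frame formed by
   the rows of [ss_frame i]; [th *m (ss_frame i x)^T] is the row of components of
   the covector th in the dual coframe.  The sections are related on overlaps by
   the Spin(4,3)-valued cocycle [ss_trans], which lifts the change of frame. *)
Record spin_structure := SpinStructure {
  ss_idx : Type;
  ss_dom : ss_idx -> set M;
  ss_dom_open : forall i, open (ss_dom i);
  ss_at : M -> ss_idx;
  ss_atP : forall x, ss_dom (ss_at x) x;
  ss_frame : ss_idx -> M -> 'M[R]_7;
  ss_frame_smooth : forall i a,
    smooth_vfield (ss_dom i) (fun x => row a (ss_frame i x));
  ss_frame_orthonormal : forall i x, ss_dom i x ->
    ss_frame i x *m eta_mx *m (ss_frame i x)^T = eta_mx;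
  ss_frame_oriented : forall i x, ss_dom i x -> \det (ss_frame i x) = 1;
  ss_trans : ss_idx -> ss_idx -> M -> extform R;
  ss_trans_smooth : forall i j I,
    smooth_fun (ss_dom i `&` ss_dom j) (fun x => ss_trans i j x I);
  ss_trans_spin : forall i j x, ss_dom i x -> ss_dom j x ->
    Spin (ss_trans i j x);
  ss_trans_cocycle : forall i j k x, ss_dom i x -> ss_dom j x -> ss_dom k x ->
    cl_mul (ss_trans i j x) (ss_trans j k x) = ss_trans i k x;
  ss_trans_lift : forall i j x, ss_dom i x -> ss_dom j x ->
    forall th : 'rV[R]_7,
    cl_mul (ext_covec (th *m (ss_frame i x)^T)) (ss_trans i j x) =
    cl_mul (ss_trans i j x) (ext_covec (th *m (ss_frame j x)^T)) }.

(* Existence of a reduction to Spin0: after refining the cover (along r) and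
   changing the local sections (by t), the cocycle takes values in Spin0. *)
Definition reduces_to_Spin0 (Q : spin_structure) :=
  exists (K : Type) (V : K -> set M) (r : K -> ss_idx Q)
         (t : K -> M -> extform R),
  [/\ (forall k, open (V k)) /\ (forall x, exists k, V k x),
      forall k, V k `<=` ss_dom (r k),
      forall k I, smooth_fun (V k) (fun x => t k x I),
      forall k x, V k x -> Spin (t k x)
    & forall k m x, V k x -> V m x -> exists2 u, Spin0 u &
        cl_mul (ss_trans (r k) (r m) x) (t m x) = cl_mul (t k x) u].

Definition strongly_spin :=
  inhabited spin_structure /\ forall Q : spin_structure, reduces_to_Spin0 Q.

(** * Spinor bundles *)

(* An irreducible paired spinor bundle (S, Gamma, B) of type (R^8, gam).  The
   fibre S_x is identified with R^8 = 'cV_8 by means of an arbitrary basis, as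
   for T_x M above.  S is associated to the spin structure [sb_spin]: the
   trivialisations [sb_triv i x : S_x -> R^8], which define its smooth structure,
   change by gam (ss_trans i j), intertwine Gamma with gam (it suffices to say
   so on covectors, which generate the Clifford algebra), and carry the pairing
   to a fixed one. *)
Record paired_spinor_bundle (gam : extform R -> 'M[R]_8) := PairedSpinorBundle {
  sb_spin : spin_structure;
  sb_triv : ss_idx sb_spin -> M -> 'M[R]_8;
  sb_triv_unit : forall i x, ss_dom i x -> sb_triv i x \in unitmx;
  sb_triv_trans : forall i j x, ss_dom i x -> ss_dom j x ->
    sb_triv i x = gam (ss_trans i j x) *m sb_triv j x;
  sb_Gamma : M -> extform R -> 'M[R]_8;
  sb_Gamma_rep : forall x, cl_rep (sb_Gamma x);
  sb_Gamma_triv : forall i x, ss_dom i x -> forall th : 'rV[R]_7,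
    sb_triv i x *m sb_Gamma x (ext_covec th) =
    gam (ext_covec (th *m (ss_frame i x)^T)) *m sb_triv i x;
  sb_pair : M -> 'M[R]_8;
  sb_pair_sym : forall x, (sb_pair x)^T = sb_pair x;
  sb_pair_nondeg : forall x, sb_pair x \in unitmx;
  sb_pair_admissible : forall x al (e1 e2 : 'cV[R]_8),
    (sb_Gamma x al *m e1)^T *m sb_pair x *m e2 =
    e1^T *m sb_pair x *m (sb_Gamma x (pi_tau al) *m e2);
  sb_pair_triv : forall i, exists b : 'M[R]_8, forall x, ss_dom i x ->
    sb_pair x = (sb_triv i x)^T *m b *m sb_triv i x }.

Section Spinors.
Variables (gam : extform R -> 'M[R]_8) (S : paired_spinor_bundle gam).

Definition smooth_section (e : M -> 'cV[R]_8) :=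
  forall (i : ss_idx (sb_spin S)) (k : 'I_8),
    smooth_fun (ss_dom i) (fun x => (sb_triv i x *m e x) k ord0).

(* The lift of the Levi-Civita connection to S: in a trivialisation over the
   orthonormal frame (e_a),
     nabla_v = v + 1/4 \sum_(a,b) g(e_a, nabla_v e_b) gam (e^a <> e^b). *)
Definition nabla_spinor (v : 'rV[R]_7) (e : M -> 'cV[R]_8) (x : M) :
    'cV[R]_8 :=
  let i := ss_at (sb_spin S) x in
  let omega a b :=
    (row a (ss_frame i x) *m eta_mx
       *m (nabla_vf v (fun y => row b (ss_frame i y)) x)^T) ord0 ord0 in
  invmx (sb_triv i x) *m
    (\col_k dir v (fun y => (sb_triv i y *m e y) k ord0) x
     + 4^-1 *: \sum_(a < 7) \sum_(b < 7) omega a b *: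
         (gam (cl_mul (ext_basis (finset.set1 a)) (ext_basis (finset.set1 b)))
            *m (sb_triv i x *m e x))).

Definition Psi_low (l : R) (x : M) (al : extform R) : 'M[R]_8 :=
  sb_Gamma S x (2^-1 *: (al + l *: cl_mul ext_vol al)).

(* The matrix of mu e \otimes B(-, e) : s |-> mu B(s, e) e *)
Definition spinor_square (mu : R) (x : M) (e : 'cV[R]_8) : 'M[R]_8 :=
  mu *: (e *m (sb_pair S x *m e)^T).

(* [Psi_low l x] is a bijection from the forms of degree at most 3 to the
   endomorphisms of S_x; [E_map] is the preimage of the spinor square. *)
Definition E_map (l mu : R) (e : M -> 'cV[R]_8) (x : M) : extform R :=
  xget 0 [set al | ext_low al /\ Psi_low l x al = spinor_square mu x (e x)].

Definition in_image_E (l mu : R) (al : M -> extform R) :=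
  exists2 e, smooth_section e & forall x, al x = E_map l mu e x.

Definition parallel_spinor_on (l : R) (a : M -> 'rV[R]_7 -> extform R)
    (e : M -> 'cV[R]_8) :=
  smooth_section e /\
  forall v, smooth_vfield setT v -> forall x,
    nabla_spinor (v x) e x = Psi_low l x (a x (v x)) *m e x.

End Spinors.

Definition admits_parallel_spinor (l : R) (gam : extform R -> 'M[R]_8)
    (a : M -> 'rV[R]_7 -> extform R) :=
  exists (S : paired_spinor_bundle gam) (e : M -> 'cV[R]_8),
    parallel_spinor_on S l a e /\ forall x, e x != 0.

End Geometry.

(* Main.v *)
Require Import Defs.
From mathcomp Require Import all_boot all_order all_algebra all_fingroup.
From mathcomp Require Import all_classical all_reals all_analysis.
From mathcomp Require Import ring lra zify.
Import Order.TTheory GRing.Theory Num.Theory.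
Import numFieldNormedType.Exports.
Set Implicit Arguments.
Unset Strict Implicit.
Unset Printing Implicit Defensive.
Local Open Scope ring_scope.

(* The square alpha = f + phi of a spinor e is characterised by
   Gamma(alpha) = e (x) B(-, e), so that f = B(e, e) / 8 and
   phi(u, v, w) = - B(Gamma(u) Gamma(v) Gamma(w) e, e) / 8.  As Gamma and B are
   parallel,
     Gamma(nabla_v alpha) = nabla_v e (x) B(-, e) + e (x) B(-, nabla_v e).
   If nabla_v e = Gamma(a) e, the right-hand side is
   Gamma(a) Gamma(alpha) + Gamma(alpha) Gamma((pi o tau)(a)), and expanding these
   products in degrees at most 3, with Gamma(nu) = l, gives the two equations.
   Conversely, the equations say that eta = nabla_v e - Gamma(a) e satisfies
   eta (x) B(-, e) + e (x) B(-, eta) = 0, which forces eta = 0 where e <> 0.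
   The expansion is a bilinear identity, checked on basis elements by
   computation.  The orientation enters only through Gamma(nu) = l, which follows
   from tr (gam(th_1) ... gam(th_7)) = 8 l det(th_1, ..., th_7). *)

(** * Basis elements of the exterior algebra *)

(** Two obstacles shape the proof. The bases identifying T_x M and S_x with R^7 and R^8 are
    arbitrary at each point, so components in them cannot be differentiated; every derivative is
    taken in chart components and in one trivialisation of S, where the Clifford matrices and the
    matrix of B are constant and only e and the frame components of the arguments vary. Moreover
    [nabla_form] is defined by evaluation on vector fields, so the Leibniz rule is proved for the
    scalars B(e, e) and B(e, Gamma(w1) Gamma(w2) Gamma(w3) e), then carried back to forms by traces:
    the 64 elements e^I of degree at most 3 are orthogonal for the trace of products, and tr 1 = 8
    is the source of the factor 1/8. The square has degrees 0 and 3 only because it is symmetric for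
    B, while degrees 1 and 2 act by skew endomorphisms; the count is 1 + 35 = 36, the dimension of
    the symmetric ones. The identity on basis elements has integral coefficients, so it is decided
    on boolean encodings of the e^I, for both values of l; it holds only modulo nu = l. *)

Section LinearMaps.
Variables (R : pzRingType) (U V W : lmodType R).
Implicit Types (f : U -> V).

Lemma linear0' f : linear f -> f 0 = 0.
Proof.
move=> lf; have /eqP := lf 1 0 0.
by rewrite !scale1r addr0 -[X in X == _]addr0 (inj_eq (addrI _)) eq_sym => /eqP.
Qed.

Lemma linear_scale f c x : linear f -> f (c *: x) = c *: f x.
Proof. by move=> lf; rewrite -[c *: x]addr0 lf linear0' // addr0. Qed.

Lemma linear_sumf f (T : Type) (s : seq T) (F : T -> U) :
  linear f -> f (\sum_(t <- s) F t) = \sum_(t <- s) f (F t).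
Proof.
move=> lf; elim: s => [|t s IHs]; first by rewrite !big_nil linear0'.
by rewrite !big_cons -[F t]scale1r lf IHs !scale1r.
Qed.

Lemma lin_comp (f : V -> W) (g : U -> V) :
  linear f -> linear g -> linear (fun x => f (g x)).
Proof. by move=> lf lg c x y; rewrite lg lf. Qed.

End LinearMaps.

Lemma lin_add (R : comPzRingType) (U V : lmodType R) (f g : U -> V) :
  linear f -> linear g -> linear (fun x => f x + g x).
Proof. by move=> lf lg c x y; rewrite lf lg scalerDr addrACA. Qed.

Lemma lin_scale (R : comPzRingType) (U V : lmodType R) (f : U -> V) k :
  linear f -> linear (fun x => k *: f x).
Proof. by move=> lf c x y; rewrite lf scalerDr !scalerA mulrC. Qed.

Lemma lin_opp (R : comPzRingType) (U V : lmodType R) (f : U -> V) :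
  linear f -> linear (fun x => - f x).
Proof. by move=> lf c x y; rewrite lf opprD scalerN. Qed.

Section ExteriorAlgebra.
Variable R : realType.
Implicit Types (al be : extform R) (v th : 'rV[R]_7) (I J K : {set 'I_7}) (i : 'I_7).

Local Notation e := (@ext_basis R).

Lemma ext_basisE I J : e I J = (J == I)%:R.
Proof. by rewrite ffunE. Qed.

Lemma ext_sum al : al = \sum_I al I *: e I.
Proof.
apply/ffunP => K; rewrite sum_ffunE (bigD1 K) //= !ffunE eqxx big1 ?addr0 //.
  by rewrite /GRing.scale /= mulr1.
by move=> J /negPf nJK; rewrite !ffunE eq_sym nJK scaler0.
Qed.

Lemma wedge_linearl be : linear ((@wedge R)^~ be).
Proof.
move=> c al al'; apply/ffunP => K; rewrite !ffunE /GRing.scale /= mulr_sumr -big_split /=.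
apply: eq_bigr => I _; rewrite !ffunE /GRing.scale /=; ring.
Qed.

Lemma wedge_linearr al : linear (@wedge R al).
Proof.
move=> c be be'; apply/ffunP => K; rewrite !ffunE /GRing.scale /= mulr_sumr -big_split /=.
apply: eq_bigr => I _; rewrite !ffunE /GRing.scale /=; ring.
Qed.

Lemma int_prod_linearl al : linear ((@int_prod R)^~ al).
Proof.
move=> c v w; apply/ffunP => K; rewrite !ffunE /GRing.scale /= mulr_sumr -big_split /=.
apply: eq_bigr => I _; rewrite !mxE; ring.
Qed.

Lemma int_prod_linearr v : linear (int_prod v).
Proof.
move=> c be be'; apply/ffunP => K; rewrite !ffunE /GRing.scale /= mulr_sumr -big_split /=.
apply: eq_bigr => I _; rewrite !ffunE /GRing.scale /=; ring.
Qed.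

Lemma ext_covec_linear : linear (@ext_covec R).
Proof.
move=> c v w; rewrite /ext_covec scaler_sumr -big_split /=.
by apply: eq_bigr => i _; rewrite !mxE scalerDl scalerA.
Qed.

Lemma ext_covec_delta i : @ext_covec R (delta_mx ord0 i) = e (finset.set1 i).
Proof.
rewrite /ext_covec (bigD1 i) //= big1 ?addr0; last first.
  by move=> j nji; rewrite mxE (negPf nji) andbF scale0r.
by rewrite mxE !eqxx scale1r.
Qed.

Lemma cl_covec_linearr v : linear (cl_covec v).
Proof.
move=> c al be; rewrite /cl_covec wedge_linearr int_prod_linearr scalerDr addrACA //.
Qed.

Lemma foldr_linear (s : seq 'I_7) :
  linear (fun be : extform R => foldr (fun i => cl_covec (delta_mx ord0 i)) be s).
Proof.
by elim: s => [//|i s IHs] c al be /=; rewrite IHs cl_covec_linearr.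
Qed.

Lemma cl_mul_linearr al : linear (cl_mul al).
Proof.
move=> c be be'; rewrite /cl_mul scaler_sumr -big_split /=.
by apply: eq_bigr => I _; rewrite foldr_linear scalerDr !scalerA mulrC.
Qed.

Lemma cl_mul_linearl be : linear ((@cl_mul R)^~ be).
Proof.
move=> c al al'; rewrite /cl_mul scaler_sumr -big_split /=.
by apply: eq_bigr => I _; rewrite !ffunE scalerDl scalerA.
Qed.

Lemma hodge_linear : linear (@hodge R).
Proof.
move=> c al be; apply/ffunP => K; rewrite !ffunE /GRing.scale /=; ring.
Qed.

Lemma ext_part_linear k : linear (@ext_part R k).
Proof.
move=> c al be; apply/ffunP => K; rewrite !ffunE; case: ifP => // _.
by rewrite scaler0 addr0.
Qed.

Lemma pi_tau_linear : linear (@pi_tau R).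
Proof.
move=> c al be; apply/ffunP => K; rewrite !ffunE /GRing.scale /=; ring.
Qed.

Lemma triangle1_linearl be : linear ((@triangle1 R)^~ be).
Proof.
move=> c al al'; rewrite /triangle1 scaler_sumr -big_split /=; apply: eq_bigr => i _.
by rewrite int_prod_linearr wedge_linearl scalerDr !scalerA mulrC.
Qed.

Lemma triangle1_linearr al : linear (@triangle1 R al).
Proof.
move=> c be be'; rewrite /triangle1 scaler_sumr -big_split /=; apply: eq_bigr => i _.
by rewrite int_prod_linearr wedge_linearr scalerDr !scalerA mulrC.
Qed.

Lemma ext_inner_linearl be : linear ((@ext_inner R)^~ be : extform R -> R^o).
Proof.
move=> c al al'; rewrite /ext_inner scaler_sumr -big_split /=; apply: eq_bigr => i _.
by rewrite !ffunE /GRing.scale /=; ring.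
Qed.

Lemma ext_inner_linearr al : linear (@ext_inner R al : extform R -> R^o).
Proof.
move=> c be be'; rewrite /ext_inner scaler_sumr -big_split /=; apply: eq_bigr => i _.
by rewrite !ffunE /GRing.scale /=; ring.
Qed.

(** Only I contributes to the coefficient at K, and then K minus I must be J; with I inside K this
    says that I and J are disjoint with union K. *)
Lemma wedge_basis I J : wedge (e I) (e J) =
  if [disjoint I & J] then (-1) ^+ inversions I J *: e (I :|: J)%SET else 0.
Proof.
apply/ffunP => K; rewrite ffunE big_mkcond (bigD1 I) //= big1 ?addr0; last first.
  move=> I' /negPf nI; case: ifP => // _.
  by rewrite !ffunE nI mul0r mulr0.
rewrite !ffunE eqxx mul1r.
have -> : (if I \subset K then (-1) ^+ inversions I (K :\: I) * ((K :\: I)%SET == J)%:R else 0) =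
  (if (I \subset K) && ((K :\: I)%SET == J) then (-1) ^+ inversions I J else 0) :> R.
  case: (I \subset K) => //=; case: eqP => [->|_]; by rewrite ?mulr1 ?mulr0.
have -> : (I \subset K) && ((K :\: I)%SET == J) = [disjoint I & J] && (K == I :|: J)%SET.
  apply/andP/andP => [[sIK /eqP <-]|[dIJ /eqP ->]].
    rewrite -finset.setI_eq0 finset.setIDA (finset.setIC I) -finset.setIDA finset.setDv finset.setI0 eqxx.
    by rewrite -{1}(finset.setID K I) (finset.setIidPr sIK) eqxx.
  rewrite finset.subsetUl finset.setDUl finset.setDv finset.set0U; split => //.
  by apply/eqP/finset.setDidPl; rewrite disjoint_sym.
case: ifP => [/andP[-> /eqP ->]|]; first by rewrite !ffunE eqxx /GRing.scale /= mulr1.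
case: ifP => [_ /= ne|_ _]; last by rewrite ffunE.
by rewrite !ffunE ne /GRing.scale /= mulr0.
Qed.

Definition low_count K i := #|[set k in K | (k < i)%N]%SET|.

Lemma int_prod_basis i K : int_prod (delta_mx ord0 i) (e K) =
  if i \in K then (-1) ^+ low_count K i *: e (K :\ i)%SET else 0.
Proof.
apply/ffunP => L; rewrite ffunE.
rewrite big_mkcond (bigD1 i) //= big1 ?addr0; last first.
  by move=> j nji; case: ifP => // _; rewrite mxE (negPf nji) andbF mul0r.
rewrite mxE !eqxx mul1r.
have [iK|niK] := boolP (i \in K); last first.
  rewrite !ffunE; case: ifP => // _; case: eqP => [eK|]; last by rewrite mulr0.
  by move: niK; rewrite -eK finset.setU11.
rewrite !ffunE; have [iL|niL] := boolP (i \in L); rewrite /GRing.scale /=.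
  case: eqP => [eL|]; last by rewrite mulr0.
  by move: iL; rewrite eL finset.setD11.
have -> : (i |: L == K)%SET = (L == K :\ i)%SET.
  apply/eqP/eqP => [<-|->]; first by rewrite finset.setU1K.
  by rewrite finset.setD1K.
case: eqP => [->|_]; rewrite ?mulr0 // !mulr1 /low_count; congr (_ ^+ _).
apply: eq_card => k; rewrite !inE; case: eqP => [->|//]; by rewrite !ltnn ?andbF.
Qed.

Lemma eta_sq i : eta R i * eta R i = 1.
Proof. by rewrite /eta; case: ifP => _; rewrite ?mulr1 ?mulrNN ?mulr1. Qed.

Lemma delta_mul_eta i : delta_mx ord0 i *m eta_mx = eta R i *: delta_mx ord0 i :> 'rV[R]_7.
Proof.
apply/rowP => j; rewrite mul_mx_diag !mxE eqxx /=.
by case: eqP => [->|_]; rewrite ?mulr0 ?mul0r // mulrC.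
Qed.

(** The two summands never meet: the wedge survives for [i \notin K], the contraction for [i \in K].
    They carry the same sign, since the inversions of {i} against K are counted by
    [low_count K i]. *)
Lemma cl_covec_basis i K : cl_covec (delta_mx ord0 i) (e K) =
  (-1) ^+ low_count K i *: if i \in K then eta R i *: e (K :\ i)%SET else e (i |: K)%SET.
Proof.
rewrite /cl_covec ext_covec_delta wedge_basis.
rewrite delta_mul_eta -[eta R i *: delta_mx _ _]addr0 int_prod_linearl int_prod_basis.
have -> : int_prod 0 (e K) = 0.
  by apply/ffunP => L; rewrite !ffunE big1 // => j _; rewrite mxE mul0r.
have -> : inversions [set i]%SET K = low_count K i.
  rewrite /inversions /low_count -[RHS](card_imset _ (f := fun k => (i, k))); last first.
    by move=> ? ? [].
  apply: eq_card => -[p q]; rewrite !inE /=; apply/and3P/imsetP.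
    by move=> [/eqP -> qK lt]; exists q; rewrite // inE qK.
  by move=> [k /[!inE] /andP[kK lt] [-> ->]].
rewrite disjoints1; case: (i \in K) => /=.
  by rewrite add0r addr0 scalerA mulrC -scalerA.
by rewrite scaler0 !addr0.
Qed.

Lemma cl_mul_basis I be :
  cl_mul (e I) be = foldr (fun i => cl_covec (delta_mx ord0 i)) be (enum I).
Proof.
rewrite /cl_mul (bigD1 I) //= big1 => [|J nJ]; last by rewrite !ffunE (negPf nJ) scale0r.
by rewrite /= addr0 !ffunE eqxx scale1r.
Qed.

Lemma hodge_basis K : hodge (e K) =
  ((-1) ^+ inversions K (~: K)%SET * \prod_(i in K) eta R i) *: e (~: K)%SET.
Proof.
apply/ffunP => L; rewrite !ffunE /GRing.scale /=.
have -> : (L == ~: K)%SET = (~: L == K)%SET by rewrite -(inj_eq (@finset.setC_inj _)) finset.setCK.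
 case: eqP => [<-|]; last by rewrite !mulr0.
by rewrite finset.setCK !mulr1.
Qed.

Lemma ext_part_basis k K : ext_part k (e K) = if #|K| == k then e K else 0.
Proof.
apply/ffunP => L; rewrite ffunE; case: (eqVneq L K) => [->|nLK].
  by case: ifP => _; rewrite ?ffunE ?eqxx.
by do 2 case: ifP => _; rewrite ?ext_basisE ?ffunE // (negPf nLK).
Qed.

Lemma pi_tau_basis K : pi_tau (e K) = (-1) ^+ (#|K| + 'C(#|K|, 2)) *: e K.
Proof.
by apply/ffunP => L; rewrite !ffunE /GRing.scale /=; case: eqP => [->//|_]; rewrite !mulr0.
Qed.

Lemma ext_inner_basis I J : ext_inner (e I) (e J) =
  if I == J then \prod_(i in I) eta R i else 0.
Proof.
rewrite /ext_inner (bigD1 I) //= [X in _ + X]big1 ?addr0.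
  by rewrite !ffunE eqxx mul1r; case: ifP; rewrite ?mulr1 ?mulr0.
by move=> K nKI; rewrite !ffunE (negPf nKI) mul0r mulr0.
Qed.

End ExteriorAlgebra.

(** * Signed masks *)

Definition mset (m : seq bool) : {set 'I_7} := [set i : 'I_7 | nth false m i]%SET.
Definition mcard (m : seq bool) := count (nth false m) (iota 0 7).
Definition mlow (m : seq bool) i :=
  count (fun k => nth false m k && (k < i)%N) (iota 0 7).
Definition minv (m m' : seq bool) :=
  sumn [seq mlow m' i | i <- iota 0 7 & nth false m i].
Definition msign (m : seq bool) :=
  odd (count (fun k => nth false m k && (4 <= k)%N) (iota 0 7)).
Definition mdisj (m m' : seq bool) :=
  all (fun k => ~~ (nth false m k && nth false m' k)) (iota 0 7).
(** Rebuilding over [iota 0 7] keeps every mask of length 7, so that equal subsets have equal lists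
    and [perm_eq] can compare terms. *)
Definition mor (m m' : seq bool) :=
  [seq nth false m k || nth false m' k | k <- iota 0 7].
Definition mneg (m : seq bool) := [seq ~~ nth false m k | k <- iota 0 7].
Definition mflip i (m : seq bool) :=
  [seq if k == i then ~~ nth false m k else nth false m k | k <- iota 0 7].

Fixpoint masks n : seq (seq bool) :=
  if n is n'.+1 then [seq b :: m | b <- [:: true; false], m <- masks n'] else [:: [::]].

(* A signed mask [(s, m)] stands for (-1)^s e^I, where [m] is the indicator
   sequence of I; a list of those stands for their sum. *)
Definition tmul (t t' : bool * seq bool) :=
  foldr (fun i t => (t.1 (+) odd (mlow t.2 i) (+) (nth false t.2 i && (4 <= i)%N), mflip i t.2))
    (t.1 (+) t'.1, t'.2) [seq i <- iota 0 7 | nth false t.2 i].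
Definition twedge (t t' : bool * seq bool) :=
  if mdisj t.2 t'.2 then [:: (t.1 (+) t'.1 (+) odd (minv t.2 t'.2), mor t.2 t'.2)] else [::].
Definition tint i (t : bool * seq bool) :=
  if nth false t.2 i then [:: (t.1 (+) odd (mlow t.2 i), mflip i t.2)] else [::].
Definition tneg (b : bool) (t : bool * seq bool) := (b (+) t.1, t.2).

Definition cmul a b := [seq tmul t t' | t <- a, t' <- b].
Definition cwedge a b := flatten [seq twedge t t' | t <- a, t' <- b].
Definition cint i a := flatten [seq tint i t | t <- a].
Definition chodge (a : seq (bool * seq bool)) :=
  [seq (t.1 (+) odd (minv t.2 (mneg t.2)) (+) msign t.2, mneg t.2) | t <- a].
Definition cneg b a := [seq tneg b t | t <- a].
Definition ctri a b :=
  flatten [seq cneg (4 <= i)%N (cwedge (cint i a) (cint i b)) | i <- iota 0 7].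
Definition cpart (k : nat) (a : seq (bool * seq bool)) := [seq t <- a | mcard t.2 == k].
Definition cpi (a : seq (bool * seq bool)) :=
  [seq (t.1 (+) odd (mcard t.2 + 'C(mcard t.2, 2)), t.2) | t <- a].
(** A formal sum which is a permutation of its own negative vanishes, so cancellation is tested
    without normal forms. An equality x = y is tested on x followed by the negation of y. *)
Definition ceq0 (a : seq (bool * seq bool)) := perm_eq a (cneg true a).

Lemma mset_masks (I : {set 'I_7}) : exists2 m, m \in masks 7 & mset m = I.
Proof.
have masksP n m : (m \in masks n) = (size m == n).
  elim: n m => [|n IHn] [|b m] //=.
  - by rewrite cats0 mem_cat; apply/negP => /orP[] /mapP[].
  - rewrite cats0 mem_cat eqSS -IHn.
    have inj c : injective (cons c : seq bool -> _) by move=> ? ? [].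
    case: b; [rewrite (mem_map (inj true)) | rewrite (mem_map (inj false))].
      by case: (m \in _) => //=; apply/negP => /mapP[? _ []].
    by rewrite orbC; case: (m \in _) => //=; apply/negP => /mapP[? _ []].
exists [seq i \in I | i <- enum 'I_7]; first by rewrite masksP size_map size_enum_ord.
by apply/finset.setP => i; rewrite inE (nth_map i) ?size_enum_ord // nth_ord_enum.
Qed.

Lemma card_ordP (Q : pred nat) : #|[set k : 'I_7 | Q k]%SET| = count Q (iota 0 7).
Proof. by rewrite -val_enum_ord count_map cardsE cardE size_filter enumT. Qed.

Lemma big_ordP (T : Type) (idx : T) (op : Monoid.law idx) (Q : pred nat) (F : nat -> T) :
  \big[op/idx]_(i < 7 | Q i) F i = \big[op/idx]_(i <- [seq i <- iota 0 7 | Q i]) F i.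
Proof. by rewrite big_filter -(big_mkord Q F). Qed.

Lemma mset_card m : #|mset m| = mcard m.
Proof. exact: card_ordP. Qed.

Lemma mset_low m (i : 'I_7) : low_count (mset m) i = mlow m i.
Proof.
rewrite /mlow -card_ordP; apply: eq_card => k; by rewrite !inE.
Qed.

Lemma inversionsE (I J : {set 'I_7}) : inversions I J = \sum_(i in I) low_count J i.
Proof.
rewrite /inversions -sum1_card.
rewrite (eq_bigl (fun p => (p.1 \in I) && ((p.2 \in J) && (p.2 < p.1)%N))); last first.
  by move=> p; rewrite inE.
rewrite -(pair_big_dep (fun i => i \in I) (fun i k => (k \in J) && (k < i)%N) (fun _ _ => 1%N)) /=.
by apply: eq_bigr => i _; rewrite sum1_card /low_count cardsE.
Qed.

Lemma mset_inv m m' : inversions (mset m) (mset m') = minv m m'.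
Proof.
rewrite inversionsE /minv sumnE big_map.
rewrite (eq_bigr (fun i : 'I_7 => mlow m' i)); last by move=> i _; rewrite mset_low.
by rewrite (eq_bigl (fun i : 'I_7 => nth false m i)) ?big_ordP // => i; rewrite inE.
Qed.

Lemma mset_neg m : (~: mset m)%SET = mset (mneg m).
Proof.
apply/finset.setP => i; rewrite !inE (nth_map 0%N) ?size_iota ?ltn_ord //.
by rewrite nth_iota.
Qed.

Lemma mset_or m m' : (mset m :|: mset m')%SET = mset (mor m m').
Proof.
apply/finset.setP => i; rewrite !inE (nth_map 0%N) ?size_iota ?ltn_ord //.
by rewrite nth_iota.
Qed.

Lemma nth_mflip i k m : (k < 7)%N -> nth false (mflip i m) k = (k == i) (+) nth false m k.
Proof.
move=> k7; rewrite (nth_map 0%N) ?size_iota ?ltn_ord // nth_iota // add0n.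
by case: eqP.
Qed.

Lemma mset_flipin m (i : 'I_7) : nth false m i -> (mset m :\ i)%SET = mset (mflip i m).
Proof.
move=> im; apply/finset.setP => k; rewrite !inE nth_mflip //.
by case: (eqVneq k i) => [->|]; rewrite ?eqxx ?im //= -val_eqE /= => /negPf ->.
Qed.

Lemma mset_flipout m (i : 'I_7) : ~~ nth false m i -> (i |: mset m)%SET = mset (mflip i m).
Proof.
move=> im; apply/finset.setP => k; rewrite !inE nth_mflip //.
by case: (eqVneq k i) => [->|]; rewrite ?eqxx ?(negPf im) //= -val_eqE /= => /negPf ->.
Qed.

Lemma mset_disj m m' : [disjoint mset m & mset m']%bool = mdisj m m'.
Proof.
rewrite disjoint_subset; apply/fintype.subsetP/allP => [H k|H i].
  rewrite mem_iota => /andP[_ k7]; have := H (Ordinal k7); rewrite !inE /=.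
  by case: (nth _ m k) => // ->.
by rewrite !inE => im; have := H i; rewrite mem_iota im ltn_ord => ->.
Qed.

Lemma enum_mset m : map val (enum (mset m)) = [seq i <- iota 0 7 | nth false m i].
Proof.
rewrite -val_enum_ord filter_map; congr map; rewrite enumT {1}/enum_mem.
by apply: eq_filter => i; rewrite -[LHS]/(i \in mset m) inE.
Qed.

Lemma mset_full : mset (nseq 7 true) = finset.setT.
Proof. by apply/finset.setP => i; rewrite !inE nth_nseq ltn_ord. Qed.

Lemma mset_empty : mset (nseq 7 false) = finset.set0.
Proof. by apply/finset.setP => i; rewrite !inE nth_nseq ltn_ord. Qed.

(** * Signed masks as exterior forms *)

Section Denotation.
Variable R : realType.
Local Notation e := (@ext_basis R).

Definition tden (t : bool * seq bool) : extform R := (-1) ^+ t.1 *: e (mset t.2).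
Definition cden (a : seq (bool * seq bool)) : extform R := \sum_(t <- a) tden t.

Lemma cden1 t : cden [:: t] = tden t.
Proof. by rewrite /cden big_seq1. Qed.

Lemma cden_cat a b : cden (a ++ b) = cden a + cden b.
Proof. by rewrite /cden big_cat. Qed.

Lemma cden_flatten (s : seq (seq (bool * seq bool))) : cden (flatten s) = \sum_(a <- s) cden a.
Proof.
elim: s => [|a s IHs]; first by rewrite /cden !big_nil.
by rewrite /= cden_cat big_cons IHs.
Qed.

Lemma cden_neg b a : cden (cneg b a) = (-1) ^+ b *: cden a.
Proof.
rewrite /cden big_map scaler_sumr; apply: eq_bigr => t _.
by rewrite /tden /= signr_addb scalerA.
Qed.

Lemma cden_linear (f : extform R -> extform R) g :
  linear f -> (forall t, cden (g t) = f (tden t)) ->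
  forall a, cden (flatten (map g a)) = f (cden a).
Proof.
move=> lf fg a; rewrite cden_flatten big_map /cden linear_sumf //.
by apply: eq_bigr => t _; rewrite -fg.
Qed.

(** Bilinearity reduces the correctness of a product of lists to single terms, where the formulas on
    basis elements apply. *)
Lemma cden_bilinear (f : extform R -> extform R -> extform R) g :
  (forall be, linear (f^~ be)) -> (forall al, linear (f al)) ->
  (forall t t', cden (g t t') = f (tden t) (tden t')) ->
  forall a b, cden (flatten [seq g t t' | t <- a, t' <- b]) = f (cden a) (cden b).
Proof.
move=> lfl lfr fg a b; rewrite cden_flatten big_allpairs_dep /cden /=.
rewrite (linear_sumf _ _ (lfl _)); apply: eq_bigr => t _.
by rewrite linear_sumf //; apply: eq_bigr => t' _; rewrite -fg.
Qed.

Lemma map_flatten1 (T U : Type) (f : T -> U) s : map f s = flatten [seq [:: f x] | x <- s].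
Proof. by elim: s => //= x s ->. Qed.

Lemma allpairs_flatten1 (T U V : Type) (f : T -> U -> V) s s' :
  [seq f x y | x <- s, y <- s'] = flatten [seq [:: f x y] | x <- s, y <- s'].
Proof.
by elim: s => //= x s ->; rewrite flatten_cat -map_flatten1.
Qed.

Lemma prod_eta m : \prod_(i in mset m) eta R i = (-1) ^+ msign m.
Proof.
rewrite /msign signr_odd -card_ordP -prodr_const [LHS]big_mkcond [RHS]big_mkcond /=.
apply: eq_bigr => i _; rewrite !inE /eta; case: (nth _ _ _) => //=.
by rewrite (leqNgt 4); case: (_ < 4)%N.
Qed.

(** Clifford multiplication by e^I is an iterated [cl_covec] along [enum I], and [tmul] is the same
    fold on masks; the two are compared one generator at a time. *)
Lemma cden_mul a b : cden (cmul a b) = cl_mul (cden a) (cden b).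
Proof.
rewrite /cmul allpairs_flatten1; apply: cden_bilinear => [be|al|t t'].
- exact: cl_mul_linearl.
- exact: cl_mul_linearr.
rewrite cden1 (linear_scale (f := (@cl_mul R)^~ _)); last exact: cl_mul_linearl.
(* Indices become natural numbers, as in [tmul]; [inord] is faithful on them because all are below
   7. *)
rewrite (_ : cl_mul _ _ = foldr (fun k => cl_covec (delta_mx ord0 (inord k)))
  (tden t') [seq i <- iota 0 7 | nth false t.2 i]); last first.
  rewrite cl_mul_basis -enum_mset.
  by rewrite foldr_map; elim: (enum _) => //= i s ->; rewrite inord_val.
rewrite /tmul; set s := [seq _ <- _ | _].
have: {in s, forall k, (k < 7)%N} by move=> k; rewrite mem_filter mem_iota => /and3P[].
elim: s => [|k s IHs] sP /=.
  by rewrite /tden /= signr_addb scalerA.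
have k7 : (k < 7)%N by apply: sP; rewrite inE eqxx.
rewrite -(linear_scale _ _ (cl_covec_linearr _)) -IHs; last first.
  by move=> j js; apply: sP; rewrite inE js orbT.
move: (foldr _ _ _) => {IHs sP} u.
rewrite [RHS](linear_scale _ _ (cl_covec_linearr _)) cl_covec_basis /tden /=.
have ik : (inord k : 'I_7) = k :> nat by rewrite inordK.
rewrite inE ik mset_low ik; case: ifP => ku.
  rewrite -{1}ik mset_flipin ?ik // !signr_addb signr_odd !scalerA /=.
  by rewrite /eta ik (leqNgt 4); case: (_ < 4)%N; rewrite /= ?mulr1.
by rewrite -{1}ik mset_flipout ?ik ?ku //= !signr_addb signr_odd !scalerA /= mulr1.
Qed.

Lemma cden_wedge a b : cden (cwedge a b) = wedge (cden a) (cden b).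
Proof.
apply: cden_bilinear => [be|al|t t']; [exact: wedge_linearl|exact: wedge_linearr|].
rewrite (linear_scale (f := (@wedge R)^~ _)); last exact: wedge_linearl.
rewrite (linear_scale _ _ (wedge_linearr _)) wedge_basis mset_disj /twedge.
case: ifP => _; last by rewrite /cden big_nil !scaler0.
rewrite cden1 /tden /= !signr_addb signr_odd !scalerA mset_inv mset_or //.
Qed.

Lemma cden_int (i : 'I_7) a : cden (cint i a) = int_prod (delta_mx ord0 i) (cden a).
Proof.
apply: cden_linear => [|t]; first exact: int_prod_linearr.
rewrite (linear_scale _ _ (int_prod_linearr _)) int_prod_basis mset_low inE /tint.
case: ifP => it; last by rewrite /cden big_nil scaler0.
by rewrite cden1 /tden /= !signr_addb signr_odd scalerA mset_flipin.
Qed.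

Lemma cden_hodge a : cden (chodge a) = hodge (cden a).
Proof.
rewrite /chodge map_flatten1; apply: cden_linear => [|t]; first exact: hodge_linear.
rewrite (linear_scale _ _ (@hodge_linear _)) hodge_basis cden1 /tden /=.
by rewrite !signr_addb signr_odd scalerA mset_neg mset_inv prod_eta mulrA.
Qed.

Lemma cden_tri a b : cden (ctri a b) = triangle1 (cden a) (cden b).
Proof.
rewrite /ctri cden_flatten big_map /triangle1.
transitivity (\sum_(i < 7) cden (cneg (4 <= i)%N (cwedge (cint i a) (cint i b)))).
  by rewrite -(big_mkord xpredT (fun i => cden (cneg (4 <= i)%N (cwedge (cint i a) (cint i b))))).
apply: eq_bigr => i _; rewrite cden_neg cden_wedge !cden_int /eta.
by rewrite (leqNgt 4); case: (_ < 4)%N.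
Qed.

Lemma cden_part k a : cden (cpart k a) = ext_part k (cden a).
Proof.
rewrite /cpart /cden big_filter big_mkcond (linear_sumf _ _ (@ext_part_linear _ _)).
apply: eq_bigr => t _; rewrite (linear_scale _ _ (@ext_part_linear _ _)) ext_part_basis.
by rewrite mset_card; case: ifP; rewrite ?scaler0.
Qed.

Lemma cden_pi a : cden (cpi a) = pi_tau (cden a).
Proof.
rewrite /cpi map_flatten1; apply: cden_linear => [|t]; first exact: pi_tau_linear.
rewrite (linear_scale _ _ (@pi_tau_linear _)) pi_tau_basis cden1 /tden /=.
by rewrite !signr_addb signr_odd scalerA mset_card.
Qed.

Lemma cden_eq0 a : ceq0 a -> cden a = 0.
Proof.
move=> H; have: cden a = - cden a by rewrite -scaleN1r -(cden_neg true); apply: perm_big.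
by move/eqP; rewrite -addr_eq0 -mulr2n -scaler_nat scaler_eq0 pnatr_eq0 /= => /eqP.
Qed.

End Denotation.

(** * Clifford modules of dimension 8 *)

Definition mone i : seq bool := [seq k == i | k <- iota 0 7].
Definition mempty := nseq 7 false.
Definition mfull := nseq 7 true.
Definition cbase (m : seq bool) : seq (bool * seq bool) := [:: (false, m)].
Definition mlows := [seq m <- masks 7 | (mcard m <= 3)%N].
Definition meq (m m' : seq bool) := all (fun k => nth false m k == nth false m' k) (iota 0 7).
(** A scalar is encoded by multiples of the empty mask, so that the inner product joins the
    operations with values in forms. *)
Definition cinner (a b : seq (bool * seq bool)) :=
  flatten [seq (if meq t.2 t'.2 then [:: (t.1 (+) t'.1 (+) msign t.2, mempty)] else [::])
          | t <- a, t' <- b].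

Lemma mset_eq m m' : (mset m == mset m') = meq m m'.
Proof.
apply/eqP/allP => [/finset.setP E k|E].
  by rewrite mem_iota => k7; have := E (Ordinal k7); rewrite !inE => ->.
by apply/finset.setP => i; rewrite !inE; apply/eqP/E; rewrite mem_iota ltn_ord.
Qed.

Lemma mset_one (i : 'I_7) : mset (mone i) = finset.set1 i.
Proof.
by apply/finset.setP => j; rewrite !inE (nth_map 0%N) ?size_iota // nth_iota.
Qed.

(** The product of e^I and e^J is, up to sign, e^K with K the symmetric difference of I and J, which
    has between 1 and 6 elements when I and J are distinct of size at most 3. *)
Lemma mask_mul_low : all (fun m => all (fun m' => (m == m') ||
  all (fun t => ~~ meq t.2 mempty && ~~ meq t.2 mfull) (cmul (cbase m) (cbase m'))) mlows) mlows.
Proof. by vm_compute. Qed.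

(** Reversing k generators costs (-1)^C(k, 2), and each e^i e^i gives eta_i. The appended term is
    the negative of the resulting scalar. *)
Lemma mask_mul_self : all (fun m => ceq0 (cmul (cbase m) (cbase m) ++
  [:: (~~ (odd 'C(mcard m, 2) (+) msign m), mempty)])) (masks 7).
Proof. by vm_compute. Qed.

Lemma mask_meq : all (fun m => all (fun m' => meq m m' ==> (m == m')) (masks 7)) (masks 7).
Proof. by vm_compute. Qed.

Lemma mask_mul_one : all (fun i => ceq0 (cmul (cbase (mone i)) (cbase (mone i)) ++
  [:: ((i < 4)%N, mempty)])) (iota 0 7).
Proof. by vm_compute. Qed.

(** Moving e^i across e^I gives the sign (-1)^(|I| - [i in I]). It is -1 for i in I when |I| is even
    and for i outside I when |I| is odd; such an i is missing only for I empty or full. *)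
Lemma mask_anticomm : all (fun m => [|| m == mempty, m == mfull |
    has (fun i => ceq0 (cmul (cbase (mone i)) (cbase m) ++ cmul (cbase m) (cbase (mone i))))
      (iota 0 7)]) (masks 7).
Proof. by vm_compute. Qed.

Lemma mlows_uniq : all (fun k => all (fun j =>
  meq (nth [::] mlows k) (nth [::] mlows j) == (k == j)) (iota 0 64)) (iota 0 64).
Proof. by vm_compute. Qed.

(** * Traces and coefficients in an eight-dimensional representation *)

Section Representation.
Variable R : realType.
Local Notation e := (@ext_basis R).

Lemma cden_base m : cden R (cbase m) = e (mset m).
Proof. by rewrite cden1 /tden scale1r. Qed.

Lemma ext_scalarE (c : R) : ext_scalar c = c *: e finset.set0.
Proof. by []. Qed.

Lemma ext_scalar_inner_linearl be : linear (fun al => ext_scalar (@ext_inner R al be)).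
Proof.
by move=> c al al'; rewrite ext_inner_linearl /ext_scalar scalerDl scalerA.
Qed.

Lemma ext_scalar_inner_linearr al : linear (fun be => ext_scalar (@ext_inner R al be)).
Proof.
by move=> c be be'; rewrite ext_inner_linearr /ext_scalar scalerDl scalerA.
Qed.

Lemma cden_inner a b : cden R (cinner a b) = ext_scalar (ext_inner (cden R a) (cden R b)).
Proof.
apply: (cden_bilinear (f := fun al be => ext_scalar (ext_inner al be))) => [be|al|t t'].
- exact: ext_scalar_inner_linearl.
- exact: ext_scalar_inner_linearr.
rewrite (linear_scale _ _ (ext_scalar_inner_linearl _)).
rewrite (linear_scale _ _ (ext_scalar_inner_linearr _)) ext_inner_basis mset_eq.
case: ifP => _; last by rewrite /cden big_nil ext_scalarE scale0r !scaler0.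
by rewrite ext_scalarE -mset_empty cden1 /tden /= !signr_addb prod_eta !scalerA.
Qed.

(** The scalar (e^I)^2 of the Clifford algebra. *)
Definition ext_sq (I : {set 'I_7}) : R := (-1) ^+ 'C(#|I|, 2) * \prod_(i in I) eta R i.

Lemma ext_sq_sq I : ext_sq I * ext_sq I = 1.
Proof.
have [m _ <-] := mset_masks I; rewrite /ext_sq prod_eta -signr_odd -signr_addb.
by rewrite -expr2 sqrr_sign.
Qed.

Variable rho : extform R -> 'M[R]_8.
Hypothesis rhoP : cl_rep rho.

Let rho_lin : linear rho. Proof. by case: rhoP. Qed.
Let rho1 : rho (e finset.set0) = 1%:M.
Proof. by case: rhoP => _ <- _; rewrite ext_scalarE scale1r. Qed.
Let rhoM al be : rho (cl_mul al be) = rho al *m rho be. Proof. by case: rhoP. Qed.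

Lemma rep_cmul a b : rho (cden R (cmul a b)) = rho (cden R a) *m rho (cden R b).
Proof. by rewrite cden_mul rhoM. Qed.

Lemma rep_one_sq (i : 'I_7) : rho (e (finset.set1 i)) *m rho (e (finset.set1 i)) = (eta R i)%:M.
Proof.
have i7 : (i : nat) \in iota 0 7 by rewrite mem_iota ltn_ord.
have := @cden_eq0 R _ (allP mask_mul_one _ i7); rewrite cden_cat cden1 /tden /= mset_empty => /eqP; rewrite addr_eq0 => /eqP E.
rewrite -mset_one -cden_base -rep_cmul E -scaleN1r scalerA (linear_scale _ _ rho_lin) rho1.
by rewrite scalemx1 /eta; case: ltnP => _; rewrite ?mulrNN ?mulr1 ?mulN1r.
Qed.

(** Some Y = [rho (e [set i])] anticommutes with X = [rho (e I)], and Y^2 = eta_i is invertible;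
    cyclicity gives tr(Y Y X) = - tr(Y X Y) = - tr(Y Y X). *)
Lemma tr_rep_basis (I : {set 'I_7}) : I != finset.set0 -> I != finset.setT -> \tr (rho (e I)) = 0.
Proof.
have [m /(allP mask_anticomm) /or3P[/eqP ->|/eqP ->|]] := mset_masks I.
- by rewrite mset_empty => ->; rewrite eqxx.
- by rewrite mset_full => -> _; rewrite eqxx.
move=> /hasP[i]; rewrite mem_iota => /andP[_ i7]; set i' := Ordinal i7.
move=> /(@cden_eq0 R); rewrite cden_cat => /eqP; rewrite addr_eq0 => /eqP E mI _ _.
have {E} E : rho (e (finset.set1 i')) *m rho (e I) = - (rho (e I) *m rho (e (finset.set1 i'))).
  rewrite -(mset_one i') -mI -!cden_base -!rep_cmul E -scaleN1r.
  by rewrite (linear_scale _ _ rho_lin) scaleN1r.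
have: \tr (rho (e I)) = - \tr (rho (e I)).
  have := rep_one_sq i'; set Y := rho (e (finset.set1 i')) => YY.
  have -> : \tr (rho (e I)) = eta R i' * \tr (Y *m Y *m rho (e I)).
    by rewrite YY mul_scalar_mx mxtraceZ mulrA eta_sq mul1r.
  rewrite -{1}mulmxA E mulmxN linearN /= mulrN; congr (- (_ * _)).
  by rewrite mulmxA mxtrace_mulC mulmxA.
by move/eqP; rewrite -addr_eq0 -mulr2n -mulr_natl mulf_eq0 pnatr_eq0 /= => /eqP.
Qed.

(** The bound on the degrees keeps the volume form, whose trace need not vanish, out of the product
    of distinct basis elements; every term is then traceless. *)
Lemma tr_rep_low (I J : {set 'I_7}) : (#|I| <= 3)%N -> (#|J| <= 3)%N ->
  \tr (rho (e I) *m rho (e J)) = if I == J then 8 * ext_sq I else 0.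
Proof.
have [m mP <-] := mset_masks I; have [m' m'P <-] := mset_masks J.
rewrite !mset_card => mlow m'low; rewrite -!cden_base -rep_cmul.
have [<-|nmm'] := eqVneq m m'.
  rewrite eqxx; have := allP mask_mul_self m mP; move=> /(@cden_eq0 R).
  rewrite cden_cat cden1 /tden /= mset_empty => /eqP; rewrite addr_eq0 => /eqP ->.
  rewrite -scaleN1r scalerA (linear_scale _ _ rho_lin) rho1 mxtraceZ mxtrace1.
  rewrite signrN mulN1r opprK signr_addb signr_odd /ext_sq mset_card prod_eta.
  by rewrite [RHS]mulrC.
have : all (fun t => ~~ meq t.2 mempty && ~~ meq t.2 mfull) (cmul (cbase m) (cbase m')).
  have := allP mask_mul_low m; rewrite mem_filter mlow => /(_ mP) /allP /(_ m').
  by rewrite mem_filter m'low (negPf nmm') => /(_ m'P).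
have : mset m != mset m'.
  apply: contraNneq nmm' => /eqP; rewrite mset_eq.
  by have := allP (allP mask_meq m mP) m' m'P => /implyP.
move=> /negPf ->; elim: (cmul _ _) => [_|t s IHs].
  by rewrite /cden big_nil linear0' // mxtrace0.
rewrite [all _ _]/= => /andP[/andP[t0 t1] /IHs sP].
rewrite -cat1s cden_cat -[cden R [:: t]]scale1r rho_lin scale1r mxtraceD sP addr0 cden1.
rewrite (linear_scale _ _ rho_lin) mxtraceZ tr_rep_basis ?mulr0 //.
  by rewrite -mset_empty mset_eq.
by rewrite -mset_full mset_eq.
Qed.

Lemma rep_sum al : rho al = \sum_I al I *: rho (e I).
Proof.
rewrite {1}(ext_sum al) linear_sumf //; apply: eq_bigr => I _.
by rewrite (linear_scale _ _ rho_lin).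
Qed.

Lemma tr_rep_coef al (I : {set 'I_7}) : ext_low al -> (#|I| <= 3)%N ->
  \tr (rho (e I) *m rho al) = 8 * ext_sq I * al I.
Proof.
move=> al_low I3; rewrite (rep_sum al) mulmx_sumr linear_sum /= (bigD1 I) //= big1 ?addr0.
  by rewrite -scalemxAr mxtraceZ tr_rep_low // eqxx mulrC.
move=> J nJI; rewrite -scalemxAr mxtraceZ.
have [J3|J3] := leqP #|J| 3; first by rewrite tr_rep_low // eq_sym (negPf nJI) mulr0.
by rewrite al_low // mul0r.
Qed.

(** The trace pairing isolates one coefficient, up to the factor [8 * ext_sq I]; [ext_sq I] is a
    sign, hence its own inverse. *)
Lemma rep_coef al (I : {set 'I_7}) : ext_low al -> (#|I| <= 3)%N ->
  al I = 8^-1 * ext_sq I * \tr (rho (e I) *m rho al).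
Proof.
move=> al_low I3; rewrite tr_rep_coef //.
have F (x y : R) : 8^-1 * y * (8 * y * x) = y * y * x by field.
by rewrite F ext_sq_sq mul1r.
Qed.

Lemma rep_low_inj al be : ext_low al -> ext_low be -> rho al = rho be -> al = be.
Proof.
move=> al_low be_low E; apply/ffunP => I.
have [I3|I3] := leqP #|I| 3; last by rewrite al_low // be_low.
by rewrite (rep_coef al_low I3) E -(rep_coef be_low I3).
Qed.

(* The e^I with |I| <= 3 act by 64 matrices which are orthogonal for the trace. *)
Lemma rep_low_surj (X : 'M[R]_8) : exists2 al, ext_low al & rho al = X.
Proof.
(* There are 1 + 7 + 21 + 35 = 64 of them, as many as the entries of X, so linear independence
   suffices. *)
pose b (k : 'I_64) : extform R := e (mset (nth [::] mlows k)).
have b_low (k : 'I_64) : (#|mset (nth [::] mlows k)| <= 3)%N.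
  rewrite mset_card; have : nth [::] mlows k \in mlows by apply: mem_nth.
  by rewrite mem_filter => /andP[].
have comb_low (u : 'rV[R]_64) : ext_low (\sum_k u ord0 k *: b k).
  move=> I I3; rewrite sum_ffunE big1 // => k _; rewrite !ffunE.
  case: eqP => [Ik|_]; last by rewrite /GRing.scale /= mulr0.
  by move: (b_low k); rewrite -Ik leqNgt I3.
pose A : 'M[R]_(64, 8 * 8) := \matrix_(k < 64) mxvec (rho (b k)).
have uA (u : 'rV[R]_64) : u *m A = mxvec (rho (\sum_k u ord0 k *: b k)).
  rewrite mulmx_sum_row linear_sumf // linear_sum; apply: eq_bigr => k _.
  by rewrite rowK (linear_scale _ _ rho_lin) linearZ.
have Afree : row_free A.
  rewrite -kermx_eq0; apply/rowV0P => u /sub_kermxP uA0.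
  have /eqP E : rho (\sum_k u ord0 k *: b k) == 0 by rewrite -mxvec_eq0 -uA uA0.
  have {E} E : \sum_k u ord0 k *: b k = 0.
    apply: rep_low_inj; [exact: comb_low | by move=> I _; rewrite ffunE | by rewrite E linear0'].
  apply/rowP => k; have := congr1 (fun al : extform R => al (mset (nth [::] mlows k))) E.
  rewrite sum_ffunE ffunE (bigD1 k) //= big1 ?addr0 => [|j njk].
    by rewrite !ffunE eqxx mxE /GRing.scale /= mulr1.
  rewrite !ffunE mset_eq.
  have -> : meq (nth [::] mlows k) (nth [::] mlows j) = (k == j).
    have kI (i : 'I_64) : (i : nat) \in iota 0 64 by rewrite mem_iota ltn_ord.
    exact/eqP/(allP (allP mlows_uniq _ (kI k)) _ (kI j)).
  by rewrite eq_sym (negPf njk) scaler0.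
have Afull : row_full A by rewrite /row_full (eqP Afree).
have /submxP[u uP] : (mxvec X <= A)%MS by rewrite submx_full.
by exists (\sum_k u ord0 k *: b k) => //; apply/(can_inj mxvecK); rewrite -uA uP.
Qed.

End Representation.

(* With l = (-1)^b, replaces e^I for |I| > 3 by l nu <> e^I, which acts in the
   same way. *)
Definition cfold (b : bool) (x : seq (bool * seq bool)) :=
  [seq if (mcard t.2 <= 3)%N then t else tneg b (tmul (false, mfull) t) | t <- x].

(** The right-hand sides of both equations of the theorem, added into one form. The scalar part of
    [al] enters through Clifford multiplication, and [d ++ d] is the common factor 2. *)
Definition cderiv b a al :=
  let al0 := cpart 0 al in let al3 := cpart 3 al in
  let d := cmul al0 (cpart 0 a) ++ cmul al0 (cpart 3 a) ++ cmul (cpart 0 a) al3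
    ++ cneg true (cinner (cpart 3 a) al3) ++ cneg true (ctri (cpart 2 a) al3)
    ++ cneg b (chodge (cwedge (cpart 1 a) al3) ++ chodge (ctri (cpart 3 a) al3)) in
  d ++ d.

(** The bilinear identity on 64 basis elements for [a] and 1 + 35 for [al], for both signs. Without
    [cfold] it fails: the left-hand side has terms of degree above 3, which the Hodge stars
    represent by their complements. *)
Lemma mask_deriv : all (fun b => all (fun m => all (fun m' =>
  (mcard m' == 0) || (mcard m' == 3) ==>
  ceq0 (cfold b (cmul (cbase m) (cbase m') ++ cmul (cbase m') (cpi (cbase m))
    ++ cneg true (cderiv b (cbase m) (cbase m'))))) mlows) mlows) [:: true; false].
Proof. by vm_compute. Qed.

(** * The symmetrised Clifford product in degrees at most 3 *)

Section Derivation.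
Variable R : realType.
Implicit Types (a al : extform R).
Local Notation e := (@ext_basis R).

Definition ext_deriv (l : R) a al : extform R :=
  let al0 := ext_part 0 al in let al3 := ext_part 3 al in
  2 *: (cl_mul al0 (ext_part 0 a) + (cl_mul al0 (ext_part 3 a)
    + (cl_mul (ext_part 0 a) al3
    + (- ext_scalar (ext_inner (ext_part 3 a) al3)
    + (- triangle1 (ext_part 2 a) al3
    + l *: (hodge (wedge (ext_part 1 a) al3) + hodge (triangle1 (ext_part 3 a) al3))))))).

Lemma cden_deriv b (a al : seq (bool * seq bool)) :
  cden R (cderiv b a al) = ext_deriv ((-1) ^+ b) (cden R a) (cden R al).
Proof.
rewrite /cderiv /ext_deriv cden_cat -mulr2n -scaler_nat; congr (_ *: _).
rewrite !cden_cat !cden_neg !cden_mul !cden_tri cden_cat !cden_inner !cden_hodge !cden_tri !cden_wedge.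
by rewrite !cden_part expr1 !scaleN1r.
Qed.

Lemma ext_deriv_linearl l al : linear ((@ext_deriv l)^~ al).
Proof.
rewrite /ext_deriv; apply: lin_scale.
repeat apply: lin_add; try apply: lin_opp; try apply: lin_scale; try apply: lin_add.
- apply: lin_comp; [exact: cl_mul_linearr|exact: ext_part_linear].
- apply: lin_comp; [exact: cl_mul_linearr|exact: ext_part_linear].
- apply: (lin_comp (f := (@cl_mul R)^~ _)); [exact: cl_mul_linearl|exact: ext_part_linear].
- apply: (lin_comp (f := fun x => ext_scalar (ext_inner x _))).
    exact: ext_scalar_inner_linearl.
  exact: ext_part_linear.
- apply: (lin_comp (f := (@triangle1 R)^~ _)); [exact: triangle1_linearl|exact: ext_part_linear].
- apply: lin_comp; first exact: hodge_linear.
  apply: (lin_comp (f := (@wedge R)^~ _)); [exact: wedge_linearl|exact: ext_part_linear].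
- apply: lin_comp; first exact: hodge_linear.
  apply: (lin_comp (f := (@triangle1 R)^~ _)); [exact: triangle1_linearl|exact: ext_part_linear].
Qed.

Lemma ext_deriv_linearr l a : linear (@ext_deriv l a).
Proof.
rewrite /ext_deriv; apply: lin_scale.
repeat apply: lin_add; try apply: lin_opp; try apply: lin_scale; try apply: lin_add.
- apply: (lin_comp (f := (@cl_mul R)^~ _)); [exact: cl_mul_linearl|exact: ext_part_linear].
- apply: (lin_comp (f := (@cl_mul R)^~ _)); [exact: cl_mul_linearl|exact: ext_part_linear].
- apply: lin_comp; [exact: cl_mul_linearr|exact: ext_part_linear].
- apply: (lin_comp (f := fun x => ext_scalar (ext_inner _ x))).
    exact: ext_scalar_inner_linearr.
  exact: ext_part_linear.
- apply: lin_comp; [exact: triangle1_linearr|exact: ext_part_linear].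
- apply: lin_comp; first exact: hodge_linear.
  apply: lin_comp; [exact: wedge_linearr|exact: ext_part_linear].
- apply: lin_comp; first exact: hodge_linear.
  apply: lin_comp; [exact: triangle1_linearr|exact: ext_part_linear].
Qed.

Variables (l : R) (rho : extform R -> 'M[R]_8).
Hypotheses (l_pm1 : l = -1 \/ l = 1) (rhoP : cl_rep rho) (rho_vol : rho ext_vol = l%:M).

Let rho_lin : linear rho. Proof. by case: rhoP. Qed.
Let rhoM al be : rho (cl_mul al be) = rho al *m rho be. Proof. by case: rhoP. Qed.

Lemma rep_cfold (b : bool) x : l = (-1) ^+ b -> rho (cden R (cfold b x)) = rho (cden R x).
Proof.
move=> lb; rewrite /cfold /cden big_map !linear_sumf //; apply: eq_bigr => t _.
case: ifP => // _; rewrite -2!cden1.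
rewrite -[[:: tneg _ _]]/(cneg b (cmul (cbase mfull) [:: t])) cden_neg (linear_scale _ _ rho_lin).
rewrite cden_mul rhoM cden_base mset_full rho_vol mul_scalar_mx scalerA lb.
by rewrite -expr2 sqrr_sign scale1r.
Qed.

Lemma rep_deriv a al : ext_low a -> (forall I : {set 'I_7}, #|I| != 0 -> #|I| != 3 -> al I = 0) ->
  rho a *m rho al + rho al *m rho (pi_tau a) = rho (ext_deriv l a al).
Proof.
have [b lb] : exists b : bool, l = (-1) ^+ b.
  by case: l_pm1 => ->; [exists true; rewrite expr1 | exists false; rewrite expr0].
move=> a_low al03; apply/eqP; rewrite -subr_eq0; apply/eqP.
pose B a al := rho (cl_mul a al + cl_mul al (pi_tau a) - ext_deriv l a al).
have Bl al' : linear (B^~ al').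
  apply: lin_comp => //; apply: lin_add; last exact: lin_opp (ext_deriv_linearl _ _).
  apply: lin_add; first exact: cl_mul_linearl.
  by apply: lin_comp; [exact: cl_mul_linearr | exact: pi_tau_linear].
have Br a' : linear (B a').
  apply: lin_comp => //; apply: lin_add; last exact: lin_opp (ext_deriv_linearr _ _).
  by apply: lin_add; [exact: cl_mul_linearr | exact: cl_mul_linearl].
have Bbasis (I J : {set 'I_7}) : (#|I| <= 3)%N -> (#|J| == 0)%N || (#|J| == 3)%N ->
    B (e I) (e J) = 0.
  have [m mP <-] := mset_masks I; have [m' m'P <-] := mset_masks J.
  rewrite !mset_card => m3 m'03.
  have ml : m \in mlows by rewrite mem_filter m3.
  have m'l : m' \in mlows by rewrite mem_filter m'P andbT; case/orP: m'03 => /eqP ->.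
  have bP : b \in [:: true; false] by case: b {lb}.
  have := implyP (allP (allP (allP mask_deriv b bP) m ml) m' m'l) m'03.
  move=> /(@cden_eq0 R) /(congr1 rho); rewrite linear0' // => E.
  rewrite -[RHS]E rep_cfold // cden_cat cden_mul cden_cat cden_mul cden_neg cden_pi cden_deriv -lb !cden_base.
  by rewrite expr1 scaleN1r addrA.
suff : B a al = 0.
  have rhoD x y : rho (x + y) = rho x + rho y by rewrite -[x in LHS]scale1r rho_lin scale1r.
  have rhoN x : rho (- x) = - rho x by rewrite -scaleN1r (linear_scale _ _ rho_lin) scaleN1r.
  by move=> <-; rewrite /B rhoD rhoN rhoD !rhoM.
rewrite (ext_sum a). rewrite [LHS](linear_sumf _ _ (Bl al)) big1 // => I _.
rewrite (linear_scale _ _ (Bl al)).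
have [I3|I3] := leqP #|I| 3; last by rewrite a_low // scale0r.
rewrite (ext_sum al) [X in _ *: X](linear_sumf _ _ (Br _)) big1 ?scaler0 // => J _.
rewrite (linear_scale _ _ (Br _)).
have [J03|] := boolP ((#|J| == 0)%N || (#|J| == 3)%N); first by rewrite Bbasis ?scaler0.
by rewrite negb_or => /andP[J0 J3]; rewrite al03 // scale0r.
Qed.

End Derivation.

(** * Evaluation of forms on vectors *)

Definition ceval (a : seq (bool * seq bool)) (s : seq nat) :=
  cpart 0 (foldl (fun b i => cint i b) a s).

(** A product of three generators with e^I has degree at most 6, so the volume form does not occur
    and the trace sees the scalar part alone. A repeated index leaves a covector, whose product with
    e^I of degree 0 or 3 has no scalar part, in agreement with antisymmetry. *)
Lemma mask_eval3 : all (fun m => (mcard m == 0) || (mcard m == 3) ==>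
  all (fun i => all (fun j => all (fun k =>
    let z := cmul (cmul (cbase (mone i)) (cbase (mone j))) (cmul (cbase (mone k)) (cbase m)) in
    all (fun t => ~~ meq t.2 mfull) z &&
    ceq0 (ceval (cbase m) [:: i; j; k] ++
      cneg ((4 <= i)%N (+) (4 <= j)%N (+) (4 <= k)%N) (cpart 0 z)))
   (iota 0 7)) (iota 0 7)) (iota 0 7)) (masks 7).
Proof. by vm_compute. Qed.

Lemma mask_eval : all (fun m => (mcard m == 3) ==> all (fun m' =>
   ceq0 (ceval (cbase m') [seq i <- iota 0 7 | nth false m i] ++
      if m == m' then [:: (true, mempty)] else [::])) (masks 7)) (masks 7).
Proof. by vm_compute. Qed.

Section Evaluation.
Variable R : realType.
Implicit Types (al be : extform R) (v w : 'rV[R]_7).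
Local Notation e := (@ext_basis R).
Local Notation delta i := (delta_mx ord0 i : 'rV[R]_7).

Lemma row_linear_ext (V : lmodType R) (f g : 'rV[R]_7 -> V) :
  linear f -> linear g -> (forall i, f (delta i) = g (delta i)) -> f =1 g.
Proof.
move=> lf lg E w; rewrite (row_sum_delta w) !linear_sumf //; apply: eq_bigr => i _.
by rewrite !linear_scale ?E.
Qed.

Lemma ext_eval_linear ws : linear ((@ext_eval R)^~ ws : extform R -> R^o).
Proof.
move=> c al be; rewrite /ext_eval; elim: ws al be => [|w ws IHs] al be /=.
  by rewrite !ffunE.
by rewrite int_prod_linearr IHs.
Qed.

Lemma ext_eval_linear_nth al (ws ws' : seq 'rV[R]_7) :
  linear ((fun w => ext_eval al (ws ++ w :: ws')) : 'rV[R]_7 -> R^o).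
Proof.
move=> c v w; rewrite /ext_eval !foldl_cat /= int_prod_linearl.
exact: (ext_eval_linear ws').
Qed.

Lemma ext_homog_int_prod k v al : ext_homog k.+1 al -> ext_homog k (int_prod v al).
Proof.
move=> alk I nIk; rewrite ffunE big1 // => i iI.
by rewrite alk ?mulr0 // cardsU1 iI.
Qed.

Lemma ext_homog0_int_prod v al : ext_homog 0 al -> int_prod v al = 0.
Proof.
move=> al0; apply/ffunP => I; rewrite !ffunE big1 // => i iI.
by rewrite al0 ?mulr0 // cardsU1 iI.
Qed.

(** Too few vectors leave a form of positive degree, without coefficient at the empty set; too many
    contract a scalar. It serves to discard the lists of wrong length allowed by [smooth_form] and
    [nabla_form_eval]. *)
Lemma ext_eval_homog k al ws : ext_homog k al -> size ws != k -> ext_eval al ws = 0.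
Proof.
elim: ws k al => [|w ws IHs] k al alk /=; first by move=> k0; rewrite /ext_eval /= alk // cards0.
case: k alk => [|k] alk nk; last by apply: IHs nk; apply: ext_homog_int_prod.
rewrite -[LHS]/(ext_eval (int_prod w al) ws) ext_homog0_int_prod //.
exact: (linear0' (ext_eval_linear ws)).
Qed.

Lemma cden_foldl_int (a : seq (bool * seq bool)) (s : seq 'I_7) :
  cden R (ceval a (map val s)) finset.set0 = ext_eval (cden R a) [seq delta i | i <- s].
Proof.
rewrite /ceval cden_part ffunE cards0 eqxx.
by elim: s a => //= i s IHs a; rewrite IHs cden_int.
Qed.

Lemma ext_eval_enum al (I : {set 'I_7}) : #|I| = 3%N ->
  ext_eval al [seq delta i | i <- enum I] = al I.
Proof.
have evalE (K J : {set 'I_7}) : #|K| = 3%N ->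
    ext_eval (e J) [seq delta i | i <- enum K] = (K == J)%:R.
  have [m mP <-] := mset_masks K => /eqP; rewrite mset_card => m3.
  have [m' m'P <-] := mset_masks J; rewrite -cden_base -cden_foldl_int enum_mset mset_eq.
  have -> : meq m m' = (m == m').
    apply/idP/eqP => [mm'|->]; first exact/eqP/(implyP (allP (allP mask_meq m mP) m' m'P)).
    by apply/allP => k.
  have /(@cden_eq0 R) := allP (implyP (allP mask_eval m mP) m3) m' m'P.
  rewrite cden_cat => /eqP; rewrite addr_eq0 => /eqP ->; rewrite ffunE.
  case: eqP => _; last by rewrite /cden big_nil ffunE oppr0.
  by rewrite cden1 /tden /= expr1 scaleN1r ffunE opprK mset_empty ext_basisE eqxx.
move=> I3; rewrite {1}(ext_sum al) [LHS](linear_sumf _ _ (ext_eval_linear _)).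
rewrite (bigD1 I) //= big1 => [|J nJI]; rewrite (linear_scale _ _ (ext_eval_linear _)) evalE //.
  by rewrite eqxx addr0 /GRing.scale /= mulr1.
by rewrite eq_sym (negPf nJI) scaler0.
Qed.

(** * Values of forms as traces *)

Section EvaluationByTrace.
Variable rho : extform R -> 'M[R]_8.
Hypothesis rhoP : cl_rep rho.

Let rho_lin : linear rho. Proof. by case: rhoP. Qed.
Let rhoM al be : rho (cl_mul al be) = rho al *m rho be. Proof. by case: rhoP. Qed.

Lemma tr_rep al : al finset.setT = 0 -> \tr (rho al) = 8 * al finset.set0.
Proof.
move=> alT; rewrite (rep_sum rhoP) linear_sum /= (bigD1 finset.set0) //= big1 ?addr0.
  case: rhoP => _ r1 _; rewrite mxtraceZ -[e _]scale1r -[1 *: _]/(ext_scalar 1) r1.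
  by rewrite mxtrace1 mulrC.
move=> I I0; rewrite mxtraceZ; have [->|IT] := eqVneq I finset.setT; first by rewrite alT mul0r.
by rewrite tr_rep_basis ?mulr0.
Qed.

(** The factor [eta_mx] lowers the index: [w *m eta_mx] is the covector g(w, -) in the dual
    basis. *)
Definition cov3 w1 w2 w3 : 'M[R]_8 := rho (ext_covec (w1 *m eta_mx)) *m
  rho (ext_covec (w2 *m eta_mx)) *m rho (ext_covec (w3 *m eta_mx)).

(* The factor is 1 / tr 1 times the sign of (e^i e^j e^k)^2 = - eta_i eta_j eta_k.
   No antisymmetrisation in the w_i is needed as [al] has no part of degree 1. *)
Lemma ext_eval3 al w1 w2 w3 : (forall I : {set 'I_7}, #|I| != 0 -> #|I| != 3 -> al I = 0) ->
  ext_eval al [:: w1; w2; w3] = - (8^-1 * \tr (cov3 w1 w2 w3 *m rho al)).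
Proof.
move=> al03.
have cov_lin : linear (fun w => rho (ext_covec (w *m eta_mx))).
  apply: lin_comp => //; apply: lin_comp; first exact: ext_covec_linear.
  by move=> c u v; rewrite mulmxDl scalemxAl.
have tr_lin : linear (fun X : 'M[R]_8 => - (8^-1 * \tr X) : R^o).
  by move=> c X Y; rewrite mxtraceD mxtraceZ /GRing.scale /=; ring.
have mull (X : 'M[R]_8) : linear (fun Y : 'M[R]_8 => X *m Y).
  by move=> c Y Z; rewrite mulmxDr scalemxAr.
have mulr (X : 'M[R]_8) : linear (fun Y : 'M[R]_8 => Y *m X).
  by move=> c Y Z; rewrite mulmxDl scalemxAl.
(* Both sides are linear in each vector and in [al]; the vectors are made basis vectors in turn,
   then [al] is expanded. *)
move: w1; apply: (row_linear_ext (V := R^o)).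
- exact: (ext_eval_linear_nth al [::]).
- apply: (lin_comp tr_lin); apply: (lin_comp (mulr (rho al))).
  apply: (lin_comp (mulr _)); exact: (lin_comp (mulr _)).
move=> i; move: w2; apply: (row_linear_ext (V := R^o)).
- exact: (ext_eval_linear_nth al [:: _]).
- apply: (lin_comp tr_lin); apply: (lin_comp (mulr (rho al))).
  apply: (lin_comp (mulr _)); exact: (lin_comp (mull _)).
move=> j; move: w3; apply: (row_linear_ext (V := R^o)).
- exact: (ext_eval_linear_nth al [:: _; _]).
- apply: (lin_comp tr_lin); apply: (lin_comp (mulr (rho al))).
  exact: (lin_comp (mull _)).
move=> k.
have alin : linear (fun al => - (8^-1 * \tr (cov3 (delta i) (delta j) (delta k) *m rho al)) : R^o).
  by apply: (lin_comp tr_lin); apply: (lin_comp (mull _)).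
rewrite (ext_sum al) [LHS](linear_sumf _ _ (ext_eval_linear _)) [RHS](linear_sumf _ _ alin).
apply: eq_bigr => I _.
rewrite (linear_scale _ _ (ext_eval_linear _)) (linear_scale _ _ alin).
have [I03|] := boolP ((#|I| == 0)%N || (#|I| == 3)%N); last first.
  by rewrite negb_or => /andP[I0 I3]; rewrite al03 // !scale0r.
congr (_ *: _); move: I03.
have [m mP <-] := mset_masks I; rewrite mset_card => m03.
have n7 (n : 'I_7) : (n : nat) \in iota 0 7 by rewrite mem_iota ltn_ord.
have := allP (allP (allP (implyP (allP mask_eval3 m mP) m03) i (n7 i)) j (n7 j)) k (n7 k).
set z := cmul _ _; move=> /andP[zT zE].
have etaE (n : 'I_7) : eta R n = (-1) ^+ (4 <= n)%N.
  by rewrite /eta (leqNgt 4); case: (_ < 4)%N.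
have deltaE (n : 'I_7) : rho (ext_covec (delta n *m eta_mx)) = (-1) ^+ (4 <= n)%N *: rho (cden R (cbase (mone n))).
  rewrite cden_base mset_one -(linear_scale _ _ rho_lin) -etaE -ext_covec_delta.
  by rewrite -(linear_scale _ _ (@ext_covec_linear R)) delta_mul_eta.
rewrite /cov3 !deltaE -!scalemxAl -!scalemxAr -!scalemxAl !scalerA -!mulmxA -cden_base.
rewrite mulmxA -!(rep_cmul rhoP) -/z mxtraceZ tr_rep; last first.
  rewrite /cden sum_ffunE big_seq big1 // => t tz; rewrite ffunE ext_basisE -mset_full eq_sym mset_eq.
  by rewrite (negPf (allP zT t tz)) scaler0.
move/(@cden_eq0 R): zE => /(congr1 (fun al : extform R => al finset.set0)).
rewrite cden_cat ffunE (cden_foldl_int _ [:: i; j; k]) cden_neg cden_part.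
rewrite !ffunE cards0 eqxx => /eqP; rewrite addr_eq0 => /eqP -> /=.
rewrite !signr_addb /GRing.scale /=.
have F (x y t c : R) : - (x * y * t * c) = - (8^-1 * (x * t * y * (8 * c))) by field.
exact: F.
Qed.

End EvaluationByTrace.
End Evaluation.

(** * The volume form and determinants *)

Section Anticommuting.
Variables (A : pzRingType) (T : finType) (G : T -> A).
Hypothesis anti : forall i j, i != j -> G i * G j = - (G j * G i).

Lemma anticomm_prod a s : a \notin s ->
  G a * \prod_(i <- s) G i = (-1) ^+ size s * (\prod_(i <- s) G i * G a).
Proof.
elim: s => [_|b s IHs]; first by rewrite big_nil mulr1 !mul1r.
rewrite inE negb_or => /andP[nab /IHs {}IHs].
rewrite big_cons mulrA anti // mulNr -mulrA IHs [size _]/= exprS mulN1r mulNr.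
by rewrite !mulrA (commr_sign (G b)).
Qed.

(** On either side the first of the two exchanged factors is moved across q, with the same sign
    (-1)^|q|; the one remaining anticommutation of [G x] and [G y] gives -1. *)
Lemma anticomm_swap_seq x y p q r : uniq (p ++ x :: q ++ y :: r) ->
  \prod_(i <- p ++ x :: q ++ y :: r) G (tperm x y i) = - \prod_(i <- p ++ x :: q ++ y :: r) G i.
Proof.
move=> U.
have xny : x != y.
  apply: contraTneq U => ->; rewrite cat_uniq /= mem_cat inE eqxx orbT /=.
  by rewrite !andbF.
have fixG s : {subset s <= p ++ q ++ r} -> \prod_(i <- s) G (tperm x y i) = \prod_(i <- s) G i.
  move=> sP; apply: eq_big_seq => i /sP si.
  have U' : uniq (x :: y :: p ++ q ++ r).
    rewrite -(perm_uniq (s1 := p ++ x :: q ++ y :: r)) //.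
    by apply/seq.permP => P /=; rewrite !count_cat /= !count_cat /=; lia.
  move: U'; rewrite /= !inE negb_or => /and3P[/andP[_ xP] yP _].
  by rewrite tpermD //; [apply: contraNneq xP => -> | apply: contraNneq yP => ->].
rewrite !(big_cat, big_cons) /= tpermL tpermR.
rewrite !fixG; try by move=> i ip; rewrite !mem_cat ip ?orbT.
have Q z : z \notin q -> G z * \prod_(i <- q) G i = (-1) ^+ size q * (\prod_(i <- q) G i * G z).
  exact: anticomm_prod.
move: U; rewrite cat_uniq /= mem_cat inE !negb_or cat_uniq /= !negb_or.
move=> /and5P[_ _ /and3P[xq _ _] _ /and3P[/andP[yq _] _ _]].
rewrite -mulrN; congr (_ * _); rewrite !mulrA !Q // -mulNr; congr (_ * _).
by rewrite -!mulrA (anti xny) !mulrN opprK.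
Qed.

Lemma anticomm_swap s x y : uniq s -> x \in s -> y \in s -> x != y ->
  \prod_(i <- s) G (tperm x y i) = - \prod_(i <- s) G i.
Proof.
move=> + xs; case/splitPr: xs => p q U; rewrite mem_cat inE orbCA => /orP[/eqP ->|]; first by rewrite eqxx.
case/orP => [|] /splitPr yin; case: _ / yin U => u w U xy; last exact: anticomm_swap_seq.
rewrite tpermC -catA /=; apply: anticomm_swap_seq.
by move: U; rewrite -catA.
Qed.

End Anticommuting.

(** Induction on a decomposition into transpositions. The swap is applied to the family G o s of the
    remaining product s, which still anticommutes because s is injective. *)
Lemma anticomm_perm (A : pzRingType) (T : finType) (G : T -> A) (s : {perm T}) :
  (forall i j, i != j -> G i * G j = - (G j * G i)) ->
  \prod_i G (s i) = (-1) ^+ s * \prod_i G i.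
Proof.
move=> anti; have [ts -> {s} tsP] := prod_tpermP s.
elim: ts tsP => [_|[x y] ts IHs /andP[/= xy /IHs {}IHs]].
  by rewrite big_nil odd_perm1 mul1r; apply: eq_bigr => i _; rewrite perm1.
rewrite big_cons odd_permM odd_tperm xy signr_addb expr1 -mulrA -IHs mulN1r.
set s := (\prod_(t <- ts) _)%g.
have antis i j : i != j -> G (s i) * G (s j) = - (G (s j) * G (s i)).
  by move=> ij; apply: anti; rewrite (inj_eq perm_inj).
rewrite -(anticomm_swap antis _ _ _ xy) ?index_enum_uniq ?mem_index_enum //.
by apply: eq_bigr => i _; rewrite permM.
Qed.

(** The Leibniz expansion of the determinant. It needs the trace: products with repeated factors do
    not vanish in a Clifford algebra, where generators square to non-zero scalars, but their traces
    may. *)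
Lemma tr_prod_det (K : comNzRingType) m n (G : 'I_n -> 'M[K]_m.+1) (F : 'M[K]_n) :
  (forall i j, i != j -> G i * G j = - (G j * G i)) ->
  (forall f : {ffun 'I_n -> 'I_n}, ~~ injectiveb f -> \tr (\prod_i G (f i)) = 0) ->
  \tr (\prod_i \sum_j F i j *: G j) = \det F * \tr (\prod_i G i).
Proof.
move=> anti tr0.
rewrite (bigA_distr_bigA (fun i j => F i j *: G j)) /= linear_sum /=.
rewrite (bigID (fun f : {ffun 'I_n -> 'I_n} => injectiveb f)) /= addrC big1 ?add0r; last first.
  by move=> f nf; rewrite scaler_prod mxtraceZ tr0 // mulr0.
rewrite (reindex (@pval _)) /=; last first.
  (* Inverse of [pval] on the injective functions; the default [1%g] only concerns the others. *)
  pose in_Sn := insubd (1%g : {perm 'I_n}).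
  by exists in_Sn => /= f Uf; first apply: val_inj; apply: insubdK.
rewrite /determinant mulr_suml; apply: eq_big => [s|s _]; first by rewrite (valP s).
rewrite scaler_prod mxtraceZ (eq_bigr (fun i => G (s i))); last by move=> i _; rewrite pvalE.
rewrite anticomm_perm // -mulrA mulrCA.
have -> : (\prod_i F i ((pval s) i)) = \prod_i F i (s i) by apply: eq_bigr => i _; rewrite pvalE.
by congr (_ * _); rewrite !mulr_sign; case: ifP => _; rewrite ?linearN.
Qed.

(** The product of e^I with nu is, up to sign, the basis element of the complement of I. *)
Lemma mask_mul_vol : all (fun m => (m == mempty) || all (fun t => ~~ meq t.2 mempty && ~~ meq t.2 mfull)
  (cmul (cbase m) (cbase mfull))) mlows.
Proof. by vm_compute. Qed.

Lemma mask_anticomm_one : all (fun i => all (fun j => (i == j) ||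
  ceq0 (cmul (cbase (mone i)) (cbase (mone j)) ++ cmul (cbase (mone j)) (cbase (mone i))))
  (iota 0 7)) (iota 0 7).
Proof. by vm_compute. Qed.

(** * Traces of products of seven covectors *)

Section Volume.
Variable R : realType.
Local Notation e := (@ext_basis R).
Local Notation delta i := (delta_mx ord0 i : 'rV[R]_7).

Section VolumeTrace.
Variable rho : extform R -> 'M[R]_8.
Hypothesis rhoP : cl_rep rho.

Let rho_lin : linear rho. Proof. by case: rhoP. Qed.
Let rhoM al be : rho (cl_mul al be) = rho al *m rho be. Proof. by case: rhoP. Qed.

Lemma rep_cl_covec i be :
  rho (cl_covec (delta i) be) = rho (e (finset.set1 i)) *m rho be.
Proof. by rewrite -rhoM cl_mul_basis enum_set1. Qed.

Lemma rep_basis_prod (I : {set 'I_7}) : rho (e I) = \prod_(i <- enum I) rho (e (finset.set1 i)).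
Proof.
have [_ r1 _] := rhoP.
rewrite -[LHS]mulmx1 -r1 -rhoM cl_mul_basis.
elim: (enum I) => [|i s IHs]; first by rewrite big_nil r1.
by rewrite big_cons /= rep_cl_covec IHs.
Qed.

Lemma rep_one_anticomm i j : i != j ->
  rho (e (finset.set1 i)) * rho (e (finset.set1 j)) =
  - (rho (e (finset.set1 j)) * rho (e (finset.set1 i))).
Proof.
move=> ij; have n7 (n : 'I_7) : (n : nat) \in iota 0 7 by rewrite mem_iota ltn_ord.
have /orP[|E] := allP (allP mask_anticomm_one i (n7 i)) j (n7 j); first by rewrite val_eqE (negPf ij).
have := @cden_eq0 R _ E; rewrite cden_cat => /eqP; rewrite addr_eq0 => /eqP {}E.
rewrite -(mset_one i) -(mset_one j) -!cden_base -!mulmxE -!(rep_cmul rhoP) E.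
by rewrite -scaleN1r (linear_scale _ _ rho_lin) scaleN1r.
Qed.

(** Each generator inserts or removes one index, so |K| keeps the parity of the length. For seven
    factors this will exclude the empty set, and a repetition will exclude the full one. *)
Lemma rep_one_prod (s : seq 'I_7) : exists (c : R) (K : {set 'I_7}),
  [/\ \prod_(i <- s) rho (e (finset.set1 i)) = c *: rho (e K), K \subset s & odd #|K| = odd (size s)].
Proof.
elim: s => [|i s [c [K [IH Ks Kodd]]]].
  exists 1, finset.set0; have [_ r1 _] := rhoP.
  rewrite big_nil cards0; split=> //; last by apply/fintype.subsetP => j; rewrite inE.
  by rewrite -[RHS](linear_scale _ _ rho_lin) -[1 *: _]/(ext_scalar 1) r1.
rewrite big_cons IH.
exists (c * (-1) ^+ low_count K i * if i \in K then eta R i else 1),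
  (if i \in K then K :\ i else i |: K)%SET.
have E : rho (e (finset.set1 i)) * (c *: rho (e K)) = c *: rho (cl_covec (delta i) (e K)).
  by rewrite -scalerAr rep_cl_covec.
have Kis : K \subset i :: s by apply/fintype.subsetP => j /(fintype.subsetP Ks) js; rewrite inE js orbT.
rewrite E cl_covec_basis; case: ifP => iK; split.
- by rewrite -!(linear_scale _ _ rho_lin) !scalerA.
- exact: fintype.subset_trans (finset.subD1set _ _) Kis.
- by move: Kodd; rewrite /= (cardsD1 i K) iK /= => <-; rewrite negbK.
- by rewrite -!(linear_scale _ _ rho_lin) !scalerA mulr1.
- by apply/fintype.subsetP => j; rewrite !inE => /orP[->//|/(fintype.subsetP Ks) ->]; rewrite orbT.
- by rewrite cardsU1 iK /= Kodd.
Qed.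

(** It compares the volume forms of two representations known to correspond on covectors only. *)
Lemma tr_rep_frame (F : 'M[R]_7) :
  \tr (\prod_i rho (ext_covec (row i F))) = \det F * \tr (rho ext_vol).
Proof.
have -> : rho ext_vol = \prod_i rho (e (finset.set1 i)).
  rewrite /ext_vol rep_basis_prod [index_enum _]unlock -enumT.
  by have -> : enum [set: 'I_7]%SET = enum 'I_7 by apply: eq_enum => i; rewrite !inE.
rewrite -tr_prod_det.
- congr (\tr _); apply: eq_bigr => i _; rewrite {1}(row_sum_delta (row i F)).
  rewrite (linear_sumf _ _ (@ext_covec_linear R)) (linear_sumf _ _ rho_lin); apply: eq_bigr => j _.
  by rewrite (linear_scale _ _ (@ext_covec_linear R)) (linear_scale _ _ rho_lin) ext_covec_delta mxE.
- exact: rep_one_anticomm.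
move=> f nf; have [c [K [E Ks Kodd]]] := rep_one_prod [seq f i | i <- index_enum 'I_7].
rewrite -(big_map f xpredT (fun j => rho (e (finset.set1 j)))) E mxtraceZ.
rewrite (tr_rep_basis rhoP) ?mulr0 //.
  (* K is not empty since 7 is odd. *)
  by apply: contra_eqN Kodd => /eqP ->; rewrite cards0 size_map [index_enum _]unlock -enumT size_enum_ord.
(* If K were full, the seven values of f would cover ['I_7], so f would be injective. *)
apply: contraNneq nf => KT; rewrite /injectiveb /dinjectiveb.
apply: (leq_size_uniq (enum_uniq 'I_7)); last by rewrite size_map.
move=> j _; have /(fintype.subsetP Ks) : j \in K by rewrite KT inE.
by move=> /mapP[i _ ->]; apply: map_f; rewrite mem_enum.
Qed.

Lemma ext_sq0 : ext_sq R finset.set0 = 1.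
Proof. by rewrite /ext_sq cards0 big_set0 expr0 mulr1. Qed.

(** The matrix [rho ext_vol] is also the image of a form of degree at most 3, whose coefficients are
    traces of e^I nu. These vanish for I non-empty, so the matrix is scalar and its trace determines
    it. *)
Lemma rep_vol (l : R) : \tr (rho ext_vol) = 8 * l -> rho ext_vol = l%:M.
Proof.
move=> trl; have [al al_low alE] := rep_low_surj rhoP (rho ext_vol).
have -> : rho ext_vol = rho (al finset.set0 *: e finset.set0).
  rewrite -alE {1}(ext_sum al) (bigD1 finset.set0) //= big1 ?addr0 // => I I0.
  have [I3|I3] := leqP #|I| 3; last by rewrite al_low // scale0r.
  rewrite (rep_coef rhoP al_low I3) alE -rhoM.
  have [m mP mI] := mset_masks I; have ml : m \in mlows by rewrite mem_filter mP -mset_card mI I3.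
  have /orP[/eqP m0|zP] := allP mask_mul_vol m ml.
    by move: I0; rewrite -mI m0 mset_empty eqxx.
  have zK K : all (fun t => ~~ meq t.2 K) (cmul (cbase m) (cbase mfull)) ->
      cden R (cmul (cbase m) (cbase mfull)) (mset K) = 0.
    move=> zK; rewrite /cden sum_ffunE big_seq big1 // => t tz.
    by rewrite ffunE ext_basisE eq_sym mset_eq (negPf (allP zK t tz)) scaler0.
  rewrite /ext_vol -mset_full -mI -!cden_base -cden_mul tr_rep //.
    rewrite -mset_empty zK ?mulr0 ?scale0r //.
    by apply: sub_all zP => t /andP[].
  by rewrite -mset_full zK //; apply: sub_all zP => t /andP[].
have [_ r1 _] := rhoP; rewrite ext_scalarE scale1r in r1.
rewrite (linear_scale _ _ rho_lin) r1 scalemx1 (rep_coef rhoP al_low) ?cards0 // alE r1 mul1mx trl.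
by rewrite ext_sq0; congr (_%:M); field.
Qed.

End VolumeTrace.
End Volume.

(** * Smooth functions and directional derivatives *)

Local Open Scope classical_set_scope.
Local Open Scope ring_scope.

Section SmoothRn.
Variables (R : realType) (n : nat).
Implicit Types (A B : set 'rV[R]_n) (f g : 'rV[R]_n -> R) (k : nat).

(** Each condition in [Ck] is imposed point by point, with limits in the whole of R^n; this is why
    arbitrary sets B suffice. *)
Lemma Ck_local k A f :
  (forall x, A x -> exists2 B, B x & Ck k B f) -> Ck k A f.
Proof.
elim: k A f => [|k IHk] A f H /=; first by move=> x /H[B Bx /(_ x Bx)].
split=> [x /H[B Bx [fB _]]|i]; first exact: fB.
split=> [x /H[B Bx [_ /(_ i)[dfB _]]]|]; first exact: dfB.
by apply: IHk => x /H[B Bx [_ /(_ i)[_ Ckf]]]; exists B.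
Qed.

Lemma Ck_eq k A f g : open A -> (forall x, A x -> f x = g x) -> Ck k A f -> Ck k A g.
Proof.
move=> oA; elim: k f g => [|k IHk] f g fg /= => [fc x Ax|[fc fd]].
  have xA : \near x, f x = g x by near=> y; apply: fg; near: y; exact: open_nbhs_nbhs.
  change (g @ x --> g x); rewrite -(fg x Ax); apply: cvg_trans (fc x Ax).
  exact: (near_eq_cvg xA).
have nfg x : A x -> \near x, f x = g x.
  by move=> Ax; near=> y; apply: fg; near: y; exact: open_nbhs_nbhs.
split=> [x Ax|i].
  change (g @ x --> g x); rewrite -(fg x Ax); apply: cvg_trans (fc x Ax).
  exact: (near_eq_cvg (nfg x Ax)).
have [df dCk] := fd i; split=> [x Ax|].
  by apply: near_eq_derivable (df x Ax); exact: nfg.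
apply: IHk dCk => x Ax; exact/near_eq_derive/nfg.
Unshelve. all: by end_near. Qed.

Lemma Ck_pred k A f : Ck k.+1 A f -> Ck k A f.
Proof.
elim: k f => [|k IHk] f /= [fc fd]; first exact: fc.
split=> // i; have [df dC] := fd i; split=> //.
exact: (IHk (fun x => 'D_(delta_mx ord0 i) f x)).
Qed.

Lemma Ck_cst k A c : Ck k A (fun=> c).
Proof.
elim: k A c => [|k IHk] A c; first by move=> x _; exact: cst_continuous.
split=> [x _|i]; first exact: cst_continuous.
split=> [x _|]; first exact: derivable_cst.
have -> : (fun x : 'rV[R]_n => 'D_(delta_mx ord0 i) (fun=> c) x) = (fun=> 0).
  by apply/funext => x; rewrite derive_cst.
exact: IHk.
Qed.

Lemma CkD k A f g : open A -> Ck k A f -> Ck k A g -> Ck k A (fun x => f x + g x).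
Proof.
move=> oA; elim: k f g => [|k IHk] f g.
  by move=> fc gc x Ax; exact: (cvgD (fc x Ax) (gc x Ax)).
move=> [fc fd] [gc gd]; split=> [x Ax|i].
  exact: (cvgD (fc x Ax) (gc x Ax)).
have [[df fC] [dg gC]] := (fd i, gd i); split=> [x Ax|].
  exact: (derivableD (df x Ax) (dg x Ax)).
apply: (Ck_eq oA) (IHk _ _ fC gC) => x Ax.
by rewrite [RHS](deriveD (df x Ax) (dg x Ax)).
Qed.

Lemma CkM k A f g : open A -> Ck k A f -> Ck k A g -> Ck k A (fun x => f x * g x).
Proof.
move=> oA; elim: k f g => [|k IHk] f g.
  by move=> fc gc x Ax; exact: (cvgM (fc x Ax) (gc x Ax)).
move=> Ckf Ckg; have [[fc fd] [gc gd]] := (Ckf, Ckg); split=> [x Ax|i].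
  exact: (cvgM (fc x Ax) (gc x Ax)).
have [[df fC] [dg gC]] := (fd i, gd i); split=> [x Ax|].
  exact: (derivableM (df x Ax) (dg x Ax)).
(* The Leibniz rule multiplies the derivatives, of class C^k, by f and g themselves, which must be
   brought down to that class. *)
have fC' := Ck_pred Ckf; have gC' := Ck_pred Ckg.
apply: (Ck_eq oA) (CkD oA (IHk _ _ fC' gC) (IHk _ _ gC' fC)) => x Ax.
by rewrite [RHS](deriveM (df x Ax) (dg x Ax)).
Qed.

End SmoothRn.

(** * Smooth functions and matrices on a manifold *)

Section SmoothFun.
Variables (R : realType) (n : nat) (M : manifold R n).
Implicit Types (U V : set M) (f g : M -> R) (c : chart M) (x : M).

(** Continuity of [coord_inv c] is given relative to the chart image; that image is open, so it is
    continuity in R^n there. *)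
Lemma near_coord_inv c U x : open U -> U x -> chart_dom c x ->
  \forall y \near Defs.coord c x, U (coord_inv c y).
Proof.
move=> oU Ux cx; have := @coord_inv_continuous _ _ M c.
rewrite continuous_open_subspace; last exact: chart_img_open.
move=> /(_ (Defs.coord c x)); rewrite inE => /(_ (ex_intro2 _ _ x cx erefl)).
apply; rewrite coordK //; exact: open_nbhs_nbhs.
Qed.

Lemma coord_invK c y : (Defs.coord c @` chart_dom c) y -> Defs.coord c (coord_inv c y) = y.
Proof. by move=> [x cx <-]; rewrite coordK. Qed.

Lemma coord_open c U : open U -> open (Defs.coord c @` (U `&` chart_dom c)).
Proof.
move=> oU; rewrite openE => _ [x [Ux cx] <-].
have Uy := near_coord_inv oU Ux cx.
have cy := near_coord_inv (@chart_dom_open _ _ _ c) cx cx.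
have iy : \forall y \near Defs.coord c x, (Defs.coord c @` chart_dom c) y.
  by apply: open_nbhs_nbhs; split; [exact: chart_img_open | exists x].
rewrite /interior /=; near=> y; exists (coord_inv c y).
  by split; near: y.
by rewrite coord_invK //; near: y.
Unshelve. all: by end_near. Qed.

Lemma smooth_fun_local U f :
  (forall x, U x -> exists2 V, V x & smooth_fun V f) -> smooth_fun U f.
Proof.
move=> H c k; apply: Ck_local => _ [x [Ux cx] <-]; have [V Vx Vf] := H x Ux.
by exists (Defs.coord c @` (V `&` chart_dom c)); [exists x | exact: Vf].
Qed.

Lemma smooth_fun_subset U V f : U `<=` V -> smooth_fun V f -> smooth_fun U f.
Proof. by move=> UV Vf; apply: smooth_fun_local => x /UV Vx; exists V. Qed.

Lemma smooth_fun_eq U f g : open U -> (forall x, U x -> f x = g x) ->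
  smooth_fun U f -> smooth_fun U g.
Proof.
move=> oU fg Uf c k; apply: (Ck_eq (coord_open oU)) (Uf c k) => _ [x [Ux cx] <-].
by rewrite coordK // fg.
Qed.

Lemma smooth_fun_cst U (a : R) : smooth_fun U (fun=> a).
Proof. by move=> c k; exact: Ck_cst. Qed.

Lemma smooth_funD U f g : open U -> smooth_fun U f -> smooth_fun U g ->
  smooth_fun U (fun x => f x + g x).
Proof. by move=> oU Uf Ug c k; apply: CkD (coord_open oU) (Uf c k) (Ug c k). Qed.

Lemma smooth_funM U f g : open U -> smooth_fun U f -> smooth_fun U g ->
  smooth_fun U (fun x => f x * g x).
Proof. by move=> oU Uf Ug c k; apply: CkM (coord_open oU) (Uf c k) (Ug c k). Qed.

Lemma smooth_fun_sum U (I : Type) (r : seq I) (F : I -> M -> R) : open U ->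
  (forall i, smooth_fun U (F i)) -> smooth_fun U (fun x => \sum_(i <- r) F i x).
Proof.
move=> oU UF; elim: r => [|i r IHr].
  by apply: (smooth_fun_eq oU _ (smooth_fun_cst U 0)) => x _; rewrite big_nil.
by apply: (smooth_fun_eq oU _ (smooth_funD oU (UF i) IHr)) => x _; rewrite big_cons.
Qed.

Definition smooth_mx m p U (A : M -> 'M[R]_(m, p)) :=
  forall i j, smooth_fun U (fun x => A x i j).

Lemma smooth_mx_subset m p U V (A : M -> 'M[R]_(m, p)) : U `<=` V -> smooth_mx V A -> smooth_mx U A.
Proof. by move=> UV VA i j; exact: smooth_fun_subset (VA i j). Qed.

Lemma smooth_mx_eq m p U (A B : M -> 'M[R]_(m, p)) : open U -> (forall x, U x -> A x = B x) ->
  smooth_mx U A -> smooth_mx U B.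
Proof.
by move=> oU AB UA i j; apply: (smooth_fun_eq oU _ (UA i j)) => x Ux; rewrite AB.
Qed.

Lemma smooth_mx_cst m p U (A : 'M[R]_(m, p)) : smooth_mx U (fun=> A).
Proof. by move=> i j; exact: smooth_fun_cst. Qed.

Lemma smooth_mxM m p q U (A : M -> 'M[R]_(m, p)) (B : M -> 'M[R]_(p, q)) : open U ->
  smooth_mx U A -> smooth_mx U B -> smooth_mx U (fun x => A x *m B x).
Proof.
move=> oU UA UB i j.
have H : smooth_fun U (fun x => \sum_k A x i k * B x k j).
  by apply: smooth_fun_sum => // k; apply: smooth_funM.
by apply: (smooth_fun_eq oU _ H) => x Ux; rewrite mxE.
Qed.

Lemma smooth_mx_tr m p U (A : M -> 'M[R]_(m, p)) : open U ->
  smooth_mx U A -> smooth_mx U (fun x => (A x)^T).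
Proof.
by move=> oU UA i j; apply: (smooth_fun_eq oU _ (UA j i)) => x Ux; rewrite mxE.
Qed.

Lemma smooth_mx_linear m p q U (h : 'rV[R]_m -> 'M[R]_(p, q)) (A : M -> 'rV[R]_m) :
  linear h -> open U -> smooth_mx U A -> smooth_mx U (fun x => h (A x)).
Proof.
move=> lh oU UA i j.
have H : smooth_fun U (fun x => \sum_k A x ord0 k * h (delta_mx ord0 k) i j).
  by apply: smooth_fun_sum => // k; apply: smooth_funM => //; exact: smooth_fun_cst.
apply: (smooth_fun_eq oU _ H) => x Ux; rewrite {2}(row_sum_delta (A x)).
rewrite (linear_sumf _ _ lh) summxE; apply: eq_bigr => k _.
by rewrite (linear_scale _ _ lh) mxE.
Qed.

End SmoothFun.

(** * Product rules for directional derivatives *)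

Section Dir.
Variables (R : realType) (M : pseudoRiemannian R) (x : M) (v : 'rV[R]_7).
Let c := chart_at x.

(** Exactly the partial derivatives that [dir] evaluates at x, in the chart chosen there. *)
Definition derivable_at (f : M -> R) := forall k,
  derivable (fun y => f (coord_inv c y)) (Defs.coord c x) (delta_mx ord0 k).

Lemma smooth_derivable_at U f : smooth_fun U f -> U x -> derivable_at f.
Proof.
move=> Uf Ux k; have [_ /(_ k)[df _]] := Uf c 1%N.
by apply: df; exists x => //; split=> //; exact: chart_atP.
Qed.

Lemma near_chart U (f g : M -> R) : open U -> U x -> (forall y, U y -> f y = g y) ->
  \forall y \near Defs.coord c x, f (coord_inv c y) = g (coord_inv c y).
Proof.
move=> oU Ux fg; have H := near_coord_inv oU Ux (chart_atP x).
by near=> y; apply: fg; near: y.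
Unshelve. all: by end_near. Qed.

Lemma derivable_at_eq U (f g : M -> R) : open U -> U x -> (forall y, U y -> f y = g y) ->
  derivable_at f -> derivable_at g.
Proof.
by move=> oU Ux fg df k; apply: near_eq_derivable (df k); exact: near_chart fg.
Qed.

Lemma dir_eq U (f g : M -> R) : open U -> U x -> (forall y, U y -> f y = g y) ->
  dir v f x = dir v g x.
Proof.
move=> oU Ux fg; apply: eq_bigr => k _; congr (_ * _); apply: near_eq_derive.
exact: near_chart fg.
Qed.

Lemma derivable_at_cst (a : R) : derivable_at (fun=> a).
Proof. by move=> k; exact: derivable_cst. Qed.

Lemma dir_cst (a : R) : dir v (fun=> a) x = 0.
Proof. by rewrite /dir big1 // => k _; rewrite /partial derive_cst mulr0. Qed.

Lemma derivable_atD f g : derivable_at f -> derivable_at g -> derivable_at (fun y => f y + g y).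
Proof. by move=> df dg k; exact: (derivableD (df k) (dg k)). Qed.

Lemma dirD f g : derivable_at f -> derivable_at g ->
  dir v (fun y => f y + g y) x = dir v f x + dir v g x.
Proof.
move=> df dg; rewrite /dir -big_split; apply: eq_bigr => k _ /=.
by rewrite -mulrDr; congr (_ * _); exact: (deriveD (df k) (dg k)).
Qed.

Lemma derivable_atM f g : derivable_at f -> derivable_at g -> derivable_at (fun y => f y * g y).
Proof. by move=> df dg k; exact: (derivableM (df k) (dg k)). Qed.

Lemma dirM f g : derivable_at f -> derivable_at g ->
  dir v (fun y => f y * g y) x = dir v f x * g x + f x * dir v g x.
Proof.
move=> df dg; rewrite /dir mulr_suml mulr_sumr -big_split; apply: eq_bigr => k _ /=.
have -> : partial c k (fun y => f y * g y) x = f x * partial c k g x + g x * partial c k f x.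
  rewrite /partial [LHS](deriveM (df k) (dg k)) coordK //; exact: chart_atP.
ring.
Qed.

Lemma derivable_at_sum (I : Type) (r : seq I) (F : I -> M -> R) :
  (forall i, derivable_at (F i)) -> derivable_at (fun y => \sum_(i <- r) F i y).
Proof.
move=> dF; elim: r => [|i r IHr].
  by apply: (derivable_at_eq openT _ _ (@derivable_at_cst 0)) => // y _; rewrite big_nil.
by apply: (derivable_at_eq openT _ _ (derivable_atD (dF i) IHr)) => // y _; rewrite big_cons.
Qed.

Lemma dir_sum (I : Type) (r : seq I) (F : I -> M -> R) :
  (forall i, derivable_at (F i)) ->
  dir v (fun y => \sum_(i <- r) F i y) x = \sum_(i <- r) dir v (F i) x.
Proof.
move=> dF; elim: r => [|i r IHr].
  by rewrite big_nil -[RHS](dir_cst 0); apply: (dir_eq openT) => // y _; rewrite big_nil.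
rewrite big_cons -IHr -dirD //; last exact: derivable_at_sum.
by apply: (dir_eq openT) => // y _; rewrite big_cons.
Qed.

Definition mx_derivable_at m n (A : M -> 'M[R]_(m, n)) :=
  forall i j, derivable_at (fun y => A y i j).

Definition mx_dir m n (A : M -> 'M[R]_(m, n)) : 'M[R]_(m, n) :=
  \matrix_(i, j) dir v (fun y => A y i j) x.

Lemma smooth_mx_derivable_at m n U (A : M -> 'M[R]_(m, n)) :
  smooth_mx U A -> U x -> mx_derivable_at A.
Proof. by move=> UA Ux i j; exact: smooth_derivable_at (UA i j) Ux. Qed.

Lemma mx_dir_eq m n U (A B : M -> 'M[R]_(m, n)) : open U -> U x ->
  (forall y, U y -> A y = B y) -> mx_dir A = mx_dir B.
Proof.
move=> oU Ux AB; apply/matrixP => i j; rewrite !mxE.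
by apply: (dir_eq oU Ux) => y Uy; rewrite AB.
Qed.

Lemma mx_dir_cst m n (A : 'M[R]_(m, n)) : mx_dir (fun=> A) = 0.
Proof. by apply/matrixP => i j; rewrite !mxE dir_cst. Qed.

Lemma mx_derivable_at_cst m n (A : 'M[R]_(m, n)) : mx_derivable_at (fun=> A).
Proof. by move=> i j; exact: derivable_at_cst. Qed.

Lemma mx_derivable_at_eq m n U (A B : M -> 'M[R]_(m, n)) : open U -> U x ->
  (forall y, U y -> A y = B y) -> mx_derivable_at A -> mx_derivable_at B.
Proof.
by move=> oU Ux AB dA i j; apply: (derivable_at_eq oU Ux _ (dA i j)) => y /AB ->.
Qed.

Lemma mx_derivable_at_tr m n (A : M -> 'M[R]_(m, n)) :
  mx_derivable_at A -> mx_derivable_at (fun y => (A y)^T).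
Proof.
move=> dA i j; apply: (derivable_at_eq openT _ _ (dA j i)) => // y _; by rewrite mxE.
Qed.

Lemma mx_dir_tr m n (A : M -> 'M[R]_(m, n)) : mx_dir (fun y => (A y)^T) = (mx_dir A)^T.
Proof.
apply/matrixP => i j; rewrite !mxE; apply: (dir_eq openT) => // y _; by rewrite mxE.
Qed.

Lemma mx_derivable_atM m n p (A : M -> 'M[R]_(m, n)) (B : M -> 'M[R]_(n, p)) :
  mx_derivable_at A -> mx_derivable_at B -> mx_derivable_at (fun y => A y *m B y).
Proof.
move=> dA dB i j.
have H : derivable_at (fun y => \sum_k A y i k * B y k j).
  by apply: derivable_at_sum => k; apply: derivable_atM.
by apply: (derivable_at_eq openT _ _ H) => // y _; rewrite mxE.
Qed.

Lemma mx_dirM m n p (A : M -> 'M[R]_(m, n)) (B : M -> 'M[R]_(n, p)) :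
  mx_derivable_at A -> mx_derivable_at B ->
  mx_dir (fun y => A y *m B y) = mx_dir A *m B x + A x *m mx_dir B.
Proof.
move=> dA dB; apply/matrixP => i j; rewrite !mxE.
rewrite (dir_eq (g := fun y => \sum_k A y i k * B y k j) openT) //; last first.
  by move=> y _; rewrite mxE.
rewrite dir_sum => [|k]; last exact: derivable_atM.
rewrite -big_split; apply: eq_bigr => k _ /=; rewrite !mxE; exact: dirM.
Qed.

Lemma mx_derivable_at_linear m p q (h : 'rV[R]_m -> 'M[R]_(p, q)) (A : M -> 'rV[R]_m) :
  linear h -> mx_derivable_at A -> mx_derivable_at (fun x => h (A x)).
Proof.
move=> lh dA i j.
have H : derivable_at (fun x => \sum_k A x ord0 k * h (delta_mx ord0 k) i j).
  by apply: derivable_at_sum => k; apply: derivable_atM => //; exact: derivable_at_cst.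
apply: (derivable_at_eq openT _ _ H) => // y _; rewrite {2}(row_sum_delta (A y)).
rewrite (linear_sumf _ _ lh) summxE; apply: eq_bigr => k _.
by rewrite (linear_scale _ _ lh) mxE.
Qed.

Lemma mx_dir_linear m p q (h : 'rV[R]_m -> 'M[R]_(p, q)) (A : M -> 'rV[R]_m) :
  linear h -> mx_derivable_at A -> mx_dir (fun x => h (A x)) = h (mx_dir A).
Proof.
move=> lh dA; apply/matrixP => i j; rewrite mxE.
rewrite (dir_eq (g := fun x => \sum_k A x ord0 k * h (delta_mx ord0 k) i j) openT) //; last first.
  move=> y _; rewrite {1}(row_sum_delta (A y)) (linear_sumf _ _ lh) summxE.
  by apply: eq_bigr => k _; rewrite (linear_scale _ _ lh) mxE.
rewrite dir_sum => [|k]; last by apply: derivable_atM => //; exact: derivable_at_cst.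
rewrite {1}(row_sum_delta (mx_dir A)) (linear_sumf _ _ lh) summxE; apply: eq_bigr => k _.
rewrite dirM; [|exact: dA|exact: derivable_at_cst].
by rewrite dir_cst mulr0 addr0 (linear_scale _ _ lh) !mxE.
Qed.

End Dir.

(** * The Levi-Civita connection in a chart *)

Section Geometry.
Variables (R : realType) (M : pseudoRiemannian R).
Implicit Types (c : chart M) (x y : M).
Local Notation eta7 := (@eta_mx R).

Lemma eta_mx_sq : eta7 *m eta7 = 1%:M.
Proof.
apply/matrixP => i j; rewrite mul_mx_diag !mxE; case: eqP => [->|_]; rewrite ?mulr1n ?mulr0n ?mul0r //.
exact: eta_sq.
Qed.

Lemma eta_mx_tr : eta7^T = eta7.
Proof. exact: tr_diag_mx. Qed.

(** An oriented orthonormal basis exists in the chart at x, so [xget] returns one; the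
    transformation law of the metric carries the relation to the chart c. *)
Lemma onb_metric c x : chart_dom c x -> onb c x *m metric c x *m (onb c x)^T = eta7.
Proof.
move=> cx; rewrite /onb; set A := [set P | _].
have [P0 P0A] : exists P, A P.
  have [P Pu PE] := metric_signature (chart_atP x).
  case: (ltrgtP 0 (\det P)) => [P0|P0|P0]; last 1 first.
  - by move: Pu; rewrite unitmxE -P0 unitr0.
  - by exists P.
  (* Reversing the first vector changes the orientation and keeps the basis orthonormal. *)
  pose D : 'M[R]_7 := diag_mx (\row_i if i == ord0 then -1 else 1).
  exists (D *m P); split; last first.
    rewrite det_mulmx det_diag (bigD1 ord0) //= big1 ?mulr1 => [|i /negPf i0]; rewrite mxE ?i0 //.
    by rewrite eqxx mulN1r oppr_gt0.
  rewrite trmx_mul !mulmxA -(mulmxA D) -(mulmxA D) PE tr_diag_mx.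
  apply/matrixP => i j; rewrite mul_mx_diag mul_diag_mx !mxE.
  case: (eqVneq i j) => [<-|_]; last by rewrite !mulr0n mulr0 mul0r.
  by case: (i == ord0); rewrite ?mul1r ?mulr1 // mulN1r mulrN1 opprK.
have [PE _] := xgetPex 1%:M (ex_intro A _ P0A).
move: PE; rewrite -/A; move: (xget _ A) => Q PE.
by rewrite -[RHS]PE (metric_tensor (chart_atP x) cx) trmx_mul !mulmxA.
Qed.

Lemma onb_inv c x : chart_dom c x ->
  onb c x *m (metric c x *m (onb c x)^T *m eta7) = 1%:M.
Proof. by move=> cx; rewrite !mulmxA onb_metric // eta_mx_sq. Qed.

Lemma onb_unit c x : chart_dom c x -> onb c x \in unitmx.
Proof. by move=> /onb_inv /mulmx1_unit[]. Qed.

Lemma invmx_onb c x : chart_dom c x ->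
  invmx (onb c x) = metric c x *m (onb c x)^T *m eta7.
Proof.
move=> cx; rewrite -[LHS]mulmx1 -(onb_inv cx) (mulKmx (onb_unit cx)) //.
Qed.

Lemma smooth_vfieldP U (w : M -> 'rV[R]_7) c : smooth_vfield U w ->
  smooth_mx (U `&` chart_dom c) (fun y => w y *m onb c y).
Proof. by move=> Uw i k; rewrite (ord1 i); exact: Uw. Qed.

Lemma metric_smooth_mx c : smooth_mx (chart_dom c) (metric c).
Proof. by move=> i j; exact: metric_smooth. Qed.

Section AtPoint.
Variables (x : M) (v : 'rV[R]_7).
Let c := chart_at x.
Local Notation D := (mx_dir x v).

Let cx : chart_dom c x. Proof. exact: chart_atP. Qed.
Let oc : open (chart_dom c). Proof. exact: chart_dom_open. Qed.

(** The connection form in the chart at x, contracted with v: with components as rows, nabla_v w is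
    D w + w C. *)
Definition conn_mx : 'M[R]_7 :=
  \matrix_(j, k) \sum_(i < 7) christoffel c x k i j * (v *m onb c x) ord0 i.

Lemma nabla_vfE w : nabla_vf v w x =
  (D (fun y => w y *m onb c y) + w x *m onb c x *m conn_mx) *m invmx (onb c x).
Proof.
rewrite /nabla_vf -/c; congr (_ *m _); apply/rowP => k; rewrite [LHS]mxE [RHS]mxE; congr (_ + _).
  by rewrite mxE.
rewrite [RHS]mxE exchange_big; apply: eq_bigr => j _ /=; rewrite [conn_mx _ _]mxE mulr_sumr.
by apply: eq_bigr => i _; rewrite mulrC.
Qed.

Lemma partial_metric_sym k i j :
  partial c k (fun y => metric c y i j) x = partial c k (fun y => metric c y j i) x.
Proof.
apply: near_eq_derive.
apply: (near_chart (f := fun y => metric c y i j) (g := fun y => metric c y j i) oc cx) => y cy.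
by rewrite -[in LHS]Defs.metric_sym // mxE.
Qed.

(** Christoffel symbols of the first kind: contraction with the metric cancels its inverse. *)
Lemma christoffel_lower i j m : \sum_k christoffel c x k i j * metric c x k m =
  2^-1 * (partial c i (fun y => metric c y j m) x + partial c j (fun y => metric c y i m) x
    - partial c m (fun y => metric c y i j) x).
Proof.
under eq_bigr do rewrite /christoffel -mulrA mulr_suml.
rewrite -mulr_sumr exchange_big /=; congr (_ * _).
have Gu : metric c x \in unitmx.
  have [P Pu PE] := metric_signature cx.
  have : P *m metric c x *m P^T *m eta7 = 1%:M by rewrite PE eta_mx_sq.
  by rewrite -!mulmxA => /mulmx1_unit[_]; rewrite unitmx_mul => /andP[].
have GV p : \sum_k invmx (metric c x) k p * metric c x k m = (p == m)%:R.
  have : (invmx (metric c x))^T *m metric c x = 1%:M.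
    by rewrite -[X in _ *m X](Defs.metric_sym cx) -trmx_mul mulmxV // trmx1.
  move=> /matrixP /(_ p m); rewrite !mxE => <-.
  by apply: eq_bigr => k _; rewrite mxE.
pose P p := partial c i (fun y => metric c y j p) x + partial c j (fun y => metric c y i p) x
  - partial c p (fun y => metric c y i j) x.
rewrite -/(P m) (eq_bigr (fun p => P p * (p == m)%:R)) => [|p _]; last first.
  by rewrite -GV mulr_sumr; apply: eq_bigr => k _; rewrite -/(P p) mulrAC mulrC.
by rewrite (bigD1 m) // eqxx mulr1 big1 /= ?addr0 // => p /negPf ->; rewrite mulr0.
Qed.

(** This is nabla g = 0. Adding the symbols of the first kind with j and m exchanged cancels all
    derivatives but that of g_jm along v. *)
Lemma metric_compat : D (metric c) = conn_mx *m metric c x + metric c x *m conn_mx^T.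
Proof.
have CG : conn_mx *m metric c x = \matrix_(j, m) \sum_i (v *m onb c x) ord0 i *
    (2^-1 * (partial c i (fun y => metric c y j m) x + partial c j (fun y => metric c y i m) x
    - partial c m (fun y => metric c y i j) x)).
  apply/matrixP => j m; rewrite !mxE.
  under eq_bigr do rewrite mxE mulr_suml.
  rewrite exchange_big; apply: eq_bigr => i _ /=; rewrite -christoffel_lower mulr_sumr.
  by apply: eq_bigr => k _; rewrite mulrAC mulrC.
have -> : metric c x *m conn_mx^T = (conn_mx *m metric c x)^T by rewrite trmx_mul Defs.metric_sym.
rewrite CG; apply/matrixP => j m; rewrite !mxE -big_split; apply: eq_bigr => i _ /=.
rewrite (partial_metric_sym i m j) (partial_metric_sym j i m) (partial_metric_sym m i j).
rewrite (partial_metric_sym m j i) -/c.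
by field.
Qed.

End AtPoint.
End Geometry.

(** * The connection in a spin frame *)

Section Frame.
Variables (R : realType) (M : pseudoRiemannian R) (Q : spin_structure M) (i : ss_idx Q).
Local Notation eta7 := (@eta_mx R).
Local Notation F := (ss_frame i).

(* Components, in the coframe dual to [ss_frame i], of the covector g(w, -). *)
Definition coframe (w : M -> 'rV[R]_7) (y : M) : 'rV[R]_7 := w y *m eta7 *m (F y)^T.

(** The arbitrary bases [onb] are absorbed into the chart components of w and of the frame, which
    can be differentiated. *)
Lemma coframe_coord w (c : chart M) y : chart_dom c y ->
  coframe w y = w y *m onb c y *m metric c y *m (F y *m onb c y)^T.
Proof. by move=> cy; rewrite /coframe -(onb_metric cy) (trmx_mul (F y)) !mulmxA. Qed.

Lemma frame_coord_orthonormal (c : chart M) y : chart_dom c y -> ss_dom i y ->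
  (F y *m onb c y) *m metric c y *m (F y *m onb c y)^T = eta7.
Proof.
move=> cy iy; rewrite -(ss_frame_orthonormal iy) -{1}(onb_metric cy) (trmx_mul (F y)).
by rewrite !mulmxA.
Qed.

Lemma frame_coord_smooth (c : chart M) :
  smooth_mx (ss_dom i `&` chart_dom c) (fun y => F y *m onb c y).
Proof.
move=> a k; have /(_ c k) := @ss_frame_smooth _ _ Q i a.
apply: smooth_fun_eq; first by apply: openI; [exact: ss_dom_open | exact: chart_dom_open].
by move=> y _; rewrite -row_mul mxE.
Qed.

Lemma coframe_smooth U w : open U -> smooth_vfield U w ->
  smooth_mx (U `&` ss_dom i) (coframe w).
Proof.
move=> oU Uw a k; apply: smooth_fun_local => x [Ux ix].
pose c := chart_at x; pose V := U `&` ss_dom i `&` chart_dom c.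
have oV : open V.
  by apply: openI; [apply: openI => //; exact: ss_dom_open | exact: chart_dom_open].
exists V; first by split=> //; exact: chart_atP.
have H : smooth_mx V (fun y => w y *m onb c y *m metric c y *m (F y *m onb c y)^T).
  apply: smooth_mxM => //; first apply: smooth_mxM => //.
  - by apply: smooth_mx_subset (smooth_vfieldP c Uw) => y [[]].
  - by apply: smooth_mx_subset (metric_smooth_mx c) => y [].
  - apply: smooth_mx_tr => //.
    by apply: smooth_mx_subset (frame_coord_smooth c) => y [[]].
apply: (smooth_mx_eq (A := fun y => w y *m onb c y *m metric c y *m (F y *m onb c y)^T) oV _ H a k).
by move=> y [_ cy]; rewrite (coframe_coord w cy).
Qed.

Section AtPoint.
Variables (x : M) (v : 'rV[R]_7).
Hypothesis ix : ss_dom i x.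
Let c := chart_at x.
Local Notation D := (mx_dir x v).
Local Notation C := (conn_mx x v).
Let L y := F y *m onb c y.
Let G := metric c.
Let U := ss_dom i `&` chart_dom c.

Let cx : chart_dom c x. Proof. exact: chart_atP. Qed.
Let Ux : U x. Proof. by []. Qed.
Let oU : open U. Proof. by apply: openI; [exact: ss_dom_open | exact: chart_dom_open]. Qed.
Let dL : mx_derivable_at x L.
Proof. exact: smooth_mx_derivable_at (frame_coord_smooth c) Ux. Qed.
Let dG : mx_derivable_at x G.
Proof. exact: smooth_mx_derivable_at (@metric_smooth_mx _ _ c) cx. Qed.

Definition spin_conn : 'M[R]_7 := \matrix_(a, b)
  (row a (F x) *m eta7 *m (nabla_vf v (fun y => row b (F y)) x)^T) ord0 ord0.

Lemma spin_connE : spin_conn = L x *m G x *m (D L + L x *m C)^T.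
Proof.
have E b : nabla_vf v (fun y => row b (F y)) x = row b ((D L + L x *m C) *m invmx (onb c x)).
  rewrite nabla_vfE row_mul; congr (_ *m _); rewrite linearD /= row_mul; congr (_ + _).
    apply/rowP => k; rewrite !mxE; apply: (dir_eq v openT) => // y _.
    by rewrite -row_mul mxE.
  by rewrite /L !row_mul.
have -> : spin_conn = F x *m eta7 *m ((D L + L x *m C) *m invmx (onb c x))^T.
  apply/matrixP => a b; rewrite mxE E [LHS]mxE [RHS]mxE; apply: eq_bigr => k _.
  by rewrite -row_mul !mxE.
have alg (P N H X : 'M[R]_7) : H^T = H ->
    P *m eta7 *m (X *m (H *m N^T *m eta7))^T = P *m N *m H *m X^T.
  move=> HT; rewrite !trmx_mul trmxK eta_mx_tr HT !mulmxA; congr (_ *m _ *m _ *m _).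
  by rewrite -mulmxA eta_mx_sq mulmx1.
by rewrite (invmx_onb cx) alg ?Defs.metric_sym.
Qed.

(** Differentiate the orthonormality relation L G L^T = eta of the frame and use nabla g = 0. *)
Lemma spin_conn_anti : spin_conn^T = - spin_conn.
Proof.
apply/eqP; rewrite -addr_eq0; apply/eqP.
have : D (fun y => L y *m G y *m (L y)^T) = 0.
  rewrite -(mx_dir_cst x v eta7); apply: (mx_dir_eq v oU Ux) => y [iy cy].
  exact: frame_coord_orthonormal.
have -> : D (fun y => L y *m G y *m (L y)^T) =
    (D L *m G x + L x *m (C *m G x + G x *m C^T)) *m (L x)^T + L x *m G x *m (D L)^T.
  rewrite mx_dirM; [|exact: mx_derivable_atM|exact: mx_derivable_at_tr].
  by rewrite mx_dirM // mx_dir_tr metric_compat.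
have alg (Y Z H K : 'M[R]_7) : H^T = H ->
    (Z *m H *m (Y + Z *m K)^T)^T + Z *m H *m (Y + Z *m K)^T =
    (Y *m H + Z *m (K *m H + H *m K^T)) *m Z^T + Z *m H *m Y^T.
  move=> HT; rewrite trmx_mul trmxK (trmx_mul Z) HT linearD /= (trmx_mul Z K).
  by rewrite !(mulmxDl, mulmxDr) !mulmxA -!addrA; congr (_ + (_ + _)); rewrite addrC.
by move=> <-; rewrite spin_connE alg // Defs.metric_sym.
Qed.

Lemma coframe_derivable w : mx_derivable_at x (fun y => w y *m onb c y) ->
  mx_derivable_at x (coframe w).
Proof.
move=> dw; pose A y := w y *m onb c y.
have H : mx_derivable_at x (fun y => A y *m G y *m (L y)^T).
  by apply: mx_derivable_atM; [exact: mx_derivable_atM | exact: mx_derivable_at_tr].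
apply: (mx_derivable_at_eq oU Ux _ H) => y [iy cy]; by rewrite (coframe_coord w cy).
Qed.

(** The derivative of g(w, e_b) is g(nabla_v w, e_b) + g(w, nabla_v e_b), and the second term is
    expanded in the frame as the sum over a of eta_a g(w, e_a) g(e_a, nabla_v e_b). *)
Lemma coframe_dir w : mx_derivable_at x (fun y => w y *m onb c y) ->
  D (coframe w) = coframe (fun=> nabla_vf v w x) x + coframe w x *m eta7 *m spin_conn.
Proof.
move=> dw.
have alg (b db : 'rV[R]_7) (Y Z H K : 'M[R]_7) : Z *m H *m Z^T = eta7 ->
    db *m H *m Z^T + b *m (K *m H + H *m K^T) *m Z^T + b *m H *m Y^T =
    (db + b *m K) *m H *m Z^T + b *m H *m Z^T *m eta7 *m (Z *m H *m (Y + Z *m K)^T).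
  move=> E; have HZ : H *m Z^T *m eta7 *m Z = 1%:M.
    by apply: mulmx1C; rewrite !mulmxA E eta_mx_sq.
  have -> : b *m H *m Z^T *m eta7 *m (Z *m H *m (Y + Z *m K)^T) = b *m H *m (Y + Z *m K)^T.
    by rewrite -[in RHS](mulmx1 b) -HZ !mulmxA.
  have -> : (Y + Z *m K)^T = Y^T + K^T *m Z^T by rewrite linearD /= trmx_mul.
  rewrite !(mulmxDl, mulmxDr) !mulmxA -!addrA; congr (_ + (_ + _)).
  by rewrite addrC.
pose A y := w y *m onb c y.
have E : D (fun y => A y *m G y *m (L y)^T) =
    D A *m G x *m (L x)^T + A x *m (C *m G x + G x *m C^T) *m (L x)^T + A x *m G x *m (D L)^T.
  rewrite mx_dirM; [|exact: mx_derivable_atM|exact: mx_derivable_at_tr].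
  by rewrite mx_dirM // mx_dir_tr metric_compat mulmxDl.
have -> : D (coframe w) = D (fun y => A y *m G y *m (L y)^T).
  by apply: (mx_dir_eq v oU Ux) => y [iy cy]; rewrite (coframe_coord w cy).
rewrite E (alg _ _ _ _ _ _ (frame_coord_orthonormal cx ix)) spin_connE (coframe_coord w cx).
by rewrite (coframe_coord _ cx) nabla_vfE (mulmxKV (onb_unit cx)).
Qed.

End AtPoint.
End Frame.

(** * Spinor bundles *)

Section SpinorBundle.
Variables (R : realType) (M : pseudoRiemannian R) (l : R) (gam : extform R -> 'M[R]_8).
Hypotheses (l_pm1 : l = -1 \/ l = 1) (gamP : is_gamma l gam).
Variable S : paired_spinor_bundle M gam.
Local Notation eta7 := (@eta_mx R).
Local Notation Q := (sb_spin S).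
Local Notation e_ := (@ext_basis R).

Let gamR : cl_rep gam. Proof. by case: gamP. Qed.
Let gam_lin : linear gam. Proof. by case: gamR. Qed.

Lemma sb_Gamma_conj (i : ss_idx Q) y (iy : ss_dom i y) th : sb_Gamma S y (ext_covec th) =
  invmx (sb_triv i y) *m (gam (ext_covec (th *m (ss_frame i y)^T)) *m sb_triv i y).
Proof. by rewrite -sb_Gamma_triv // mulKmx // sb_triv_unit. Qed.

(** In a trivialisation the standard covectors act through [gam] on the columns of the frame matrix,
    whose determinant is 1; the trace of nu is thus the same for both representations. *)
Lemma sb_Gamma_vol y : sb_Gamma S y ext_vol = l%:M.
Proof.
apply: (rep_vol (sb_Gamma_rep S y)).
pose i := ss_at Q y; have iy : ss_dom i y := ss_atP Q y.
pose T := sb_triv i y; have Tu : T \in unitmx := sb_triv_unit iy.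
have := tr_rep_frame (sb_Gamma_rep S y) 1%:M; rewrite det1 mul1r => <-.
have -> : \prod_j sb_Gamma S y (ext_covec (row j 1%:M)) =
    invmx T *m (\prod_j gam (ext_covec (row j (ss_frame i y)^T)) *m T).
  elim: (index_enum _) => [|j s IHs]; first by rewrite !big_nil mul1mx mulVmx.
  rewrite !big_cons IHs (sb_Gamma_conj iy) -row_mul mul1mx -!mulmxE -/T.
  by rewrite !mulmxA (mulmxK Tu).
rewrite mxtrace_mulC (mulmxK Tu) (tr_rep_frame gamR) det_tr ss_frame_oriented // mul1r.
by case: gamP => _ _ ->; rewrite mxtrace_scalar mulr_natl.
Qed.

(** Since nu acts as l and l^2 = 1, the two halves in [Psi_low] coincide. *)
Lemma Psi_lowE y al : Psi_low S l y al = sb_Gamma S y al.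
Proof.
have [G_lin _ GM] := sb_Gamma_rep S y.
rewrite /Psi_low (linear_scale _ _ G_lin) -[al in X in _ *: X]scale1r G_lin scale1r.
rewrite (linear_scale _ _ G_lin) scale1r GM sb_Gamma_vol mul_scalar_mx scalerA.
have -> : l * l = 1 by case: l_pm1 => ->; rewrite ?mulrNN mulr1.
by rewrite scale1r -mulr2n -(scaler_nat 2 (sb_Gamma S y al)) scalerA mulVf ?scale1r // pnatr_eq0.
Qed.

Lemma bilinear_form_eq n (A B : 'M[R]_n) :
  (forall u w : 'cV[R]_n, u^T *m A *m w = u^T *m B *m w) -> A = B.
Proof.
move=> E; apply/matrixP => i j.
have := E (delta_mx i ord0) (delta_mx j ord0); rewrite trmx_delta -!rowE -!colE.
by move=> /matrixP /(_ ord0 ord0); rewrite !mxE.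
Qed.

Lemma sb_Gamma_adjoint y al :
  (sb_Gamma S y al)^T *m sb_pair S y = sb_pair S y *m sb_Gamma S y (pi_tau al).
Proof.
apply: bilinear_form_eq => u w; have := sb_pair_admissible S y al u w.
by rewrite trmx_mul !mulmxA.
Qed.

Lemma pi_tau_covec th : pi_tau (ext_covec th) = - ext_covec th :> extform R.
Proof.
rewrite /ext_covec (linear_sumf _ _ (@pi_tau_linear R)) -sumrN; apply: eq_bigr => i _.
by rewrite (linear_scale _ _ (@pi_tau_linear R)) pi_tau_basis cards1 /= expr1 scaleN1r scalerN.
Qed.

Lemma sb_Gamma_covec_adjoint y th :
  (sb_Gamma S y (ext_covec th))^T *m sb_pair S y = - (sb_pair S y *m sb_Gamma S y (ext_covec th)).
Proof.
have [G_lin _ _] := sb_Gamma_rep S y.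
by rewrite sb_Gamma_adjoint pi_tau_covec -scaleN1r (linear_scale _ _ G_lin) -scalemxAr scaleN1r.
Qed.

(* Forms of degree 1 and 2 act by endomorphisms which are skew for the
   pairing. *)
Lemma sym_square_deg y (u w : 'cV[R]_8) be : ext_low be ->
  sb_Gamma S y be = u *m (sb_pair S y *m w)^T + w *m (sb_pair S y *m u)^T ->
  forall I : {set 'I_7}, #|I| != 0%N -> #|I| != 3%N -> be I = 0.
Proof.
move=> be_low E I I0 I3'.
have [I3|I3] := leqP #|I| 3; last exact: be_low.
have [G_lin _ _] := sb_Gamma_rep S y.
rewrite (rep_coef (sb_Gamma_rep S y) be_low I3) E.
set X := sb_Gamma S y (e_ I); set P := sb_pair S y.
have skew : X^T *m P = - (P *m X).
  rewrite sb_Gamma_adjoint pi_tau_basis (linear_scale _ _ G_lin) -scalemxAr -/X.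
  (* The exponent k + C(k, 2) of pi o tau is 1 for k = 1 and 3 for k = 2. *)
  move: I0 I3' I3; case: #|I| => [|[|[|[|n]]]] // _ _ _; rewrite /= -signr_odd /= expr1 scaleN1r //.
rewrite mulmxDr !mulmxA mxtraceD mxtrace_mulC [X in _ + X]mxtrace_mulC.
(* B(p, X q) is antisymmetric in p and q, so the two terms of the trace cancel. *)
have E1 (p q : 'cV[R]_8) : \tr ((P *m p)^T *m (X *m q)) = - \tr ((P *m q)^T *m (X *m p)).
  rewrite -[LHS]mxtrace_tr !trmx_mul trmxK sb_pair_sym -/P mulmxA -(mulmxA _ _ P) skew.
  by rewrite trmxK mulmxN mulNmx linearN /= !mulmxA.
by rewrite E1 addNr mulr0.
Qed.

Section Triv.
Variable i : ss_idx Q.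
Local Notation T := (sb_triv i).

(** The properties of the constant matrix b are read off at a point of the domain, where every
    covector is a combination of the coframe; over an empty domain b is arbitrary, hence the
    guard. *)
Lemma sb_pair_local : exists2 b : 'M[R]_8, forall y, ss_dom i y -> sb_pair S y = (T y)^T *m b *m T y
  & forall y, ss_dom i y -> b^T = b /\ forall th, (gam (ext_covec th))^T *m b = - (b *m gam (ext_covec th)).
Proof.
have [b bE] := sb_pair_triv i; exists b => // y iy.
have Tu : T y \in unitmx := sb_triv_unit iy.
have bE' : b = (invmx (T y))^T *m sb_pair S y *m invmx (T y).
  rewrite bE // !mulmxA -trmx_mul mulmxV // trmx1 mul1mx mulmxK //.
split; first by rewrite bE' !trmx_mul trmxK sb_pair_sym mulmxA.
move=> th; pose th' := th *m invmx (ss_frame i y)^T.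
have thE : th = th' *m (ss_frame i y)^T.
  by rewrite mulmxKV // unitmx_tr unitmxE ss_frame_oriented // unitr1.
have gE : gam (ext_covec th) = T y *m sb_Gamma S y (ext_covec th') *m invmx (T y).
  by rewrite thE sb_Gamma_triv // mulmxK.
have skew := sb_Gamma_covec_adjoint y th'.
have bE2 : (T y)^T *m b = sb_pair S y *m invmx (T y).
  by rewrite bE // mulmxK.
have alg (A B K : 'M[R]_8) : (A *m B *m K)^T *m b = K^T *m (B^T *m (A^T *m b)).
  by rewrite !trmx_mul !mulmxA.
rewrite gE alg bE2 (mulmxA _ (sb_pair S y)) skew mulNmx mulmxN !mulmxA; congr (- (_ *m _ *m _)).
by rewrite bE' mulmxKV.
Qed.

Lemma gam_anticomm a b : gam (e_ (finset.set1 a)) *m gam (e_ (finset.set1 b)) +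
  gam (e_ (finset.set1 b)) *m gam (e_ (finset.set1 a)) = ((a == b)%:R * 2 * eta R a)%:M.
Proof.
have [<-|nab] := eqVneq a b.
  by rewrite (rep_one_sq gamR) mul1r mulr_natl mulr2n -raddfD.
by rewrite !mulmxE (rep_one_anticomm gamR nab) addNr !mul0r raddf0.
Qed.

(** * The lifted connection and the Leibniz rules *)

Section AtPoint.
Variables (x : M) (v : 'rV[R]_7).
Hypothesis ix : ss_dom i x.

Definition spin_conn_action : 'M[R]_8 := 4^-1 *: \sum_(a < 7) \sum_(b < 7)
  spin_conn i x v a b *: (gam (e_ (finset.set1 a)) *m gam (e_ (finset.set1 b))).
Local Notation Om := spin_conn_action.

(** [Om] lifts the element omega of so(4,3) to the Clifford algebra, and its commutator with
    covectors is the vector action. This makes Gamma parallel. *)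
Lemma spin_conn_comm th : Om *m gam (ext_covec th) - gam (ext_covec th) *m Om =
  - gam (ext_covec (th *m eta7 *m spin_conn i x v)).
Proof.
pose g a := gam (e_ (finset.set1 a)).
pose om := spin_conn i x v.
have omA a b : om a b = - om b a.
  by have /matrixP/(_ b a) := spin_conn_anti v ix; rewrite !mxE.
have mull (X : 'M[R]_8) : linear (fun Y : 'M[R]_8 => X *m Y).
  by move=> c Y Z; rewrite mulmxDr scalemxAr.
have mulr (X : 'M[R]_8) : linear (fun Y : 'M[R]_8 => Y *m X).
  by move=> c Y Z; rewrite mulmxDl scalemxAl.
have glin : linear (fun th => gam (ext_covec th)).
  by apply: lin_comp => //; exact: ext_covec_linear.
move: th; apply: row_linear_ext.
- by apply: lin_add; [apply: (lin_comp (mull _)) | apply: lin_opp; apply: (lin_comp (mulr _))].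
- apply: lin_opp; apply: (lin_comp glin) => k u w.
  by rewrite !mulmxDl -!scalemxAl.
move=> c; rewrite ext_covec_delta -/(g c).
have -> : Om *m g c - g c *m Om =
    4^-1 *: \sum_(a < 7) \sum_(b < 7) om a b *: (g a *m g b *m g c - g c *m g a *m g b).
  rewrite -scalemxAl -scalemxAr -scalerBr; congr (_ *: _).
  rewrite mulmx_suml mulmx_sumr -sumrB; apply: eq_bigr => a _.
  rewrite mulmx_suml mulmx_sumr -sumrB; apply: eq_bigr => b _.
  by rewrite -scalemxAl -scalemxAr -scalerBr !mulmxA.
(* The left-hand side is g_a {g_b, g_c} - {g_a, g_c} g_b, and the anticommutators are scalars. *)
have comm a b : g a *m g b *m g c - g c *m g a *m g b =
    ((b == c)%:R * 2 * eta R b) *: g a - ((a == c)%:R * 2 * eta R a) *: g b.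
  rewrite -mul_mx_scalar -mul_scalar_mx -!gam_anticomm -/(g a) -/(g b) -/(g c).
  by rewrite mulmxDr mulmxDl !mulmxA opprD addrA addrK.
(* By antisymmetry of [om] both terms contribute 2 to the same sum; this is the 4 cancelled by
   [4^-1]. *)
have -> : \sum_(a < 7) \sum_(b < 7) om a b *: (g a *m g b *m g c - g c *m g a *m g b) =
    4 *: \sum_(a < 7) (eta R c * om a c) *: g a.
  under eq_bigr => a _ do under eq_bigr => b _ do rewrite comm scalerBr !scalerA.
  under eq_bigr => a _ do rewrite sumrB.
  rewrite sumrB [X in _ - X]exchange_big /=.
  rewrite scaler_sumr -sumrB; apply: eq_bigr => a _.
  rewrite (bigD1 c) //= big1 => [|b /negPf ->]; last by rewrite !mul0r mulr0 scale0r.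
  rewrite [X in _ - X](bigD1 c) //= [X in _ - (_ + X)]big1 => [|b /negPf ->]; last first.
    by rewrite !mul0r mulr0 scale0r.
  rewrite eqxx !addr0 -scalerBl scalerA (omA c a); congr (_ *: _).
  by rewrite -[true%:R]/(1 : R); ring.
rewrite scalerA mulVf ?pnatr_eq0 // scale1r.
rewrite delta_mul_eta -scalemxAl -rowE (row_sum_delta (_ *: _)) (linear_sumf _ _ glin).
rewrite -sumrN; apply: eq_bigr => a _.
have -> : (eta R c *: row c om) ord0 a = eta R c * om c a by rewrite mxE [row _ _ _ _]mxE.
by rewrite (linear_scale _ _ glin) ext_covec_delta -scaleNr -mulrN -omA.
Qed.

(** Covectors are skew for b, so the adjoint of g_a g_b is g_b g_a, and omega changes sign under the
    exchange. This makes B parallel. *)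
Lemma spin_conn_skew (b : 'M[R]_8) :
  (forall th, (gam (ext_covec th))^T *m b = - (b *m gam (ext_covec th))) -> Om^T *m b = - (b *m Om).
Proof.
move=> skew; have gskew a : (gam (e_ (finset.set1 a)))^T *m b = - (b *m gam (e_ (finset.set1 a))).
  by rewrite -ext_covec_delta.
rewrite /Om linearZ /= -scalemxAl -scalemxAr -scalerN; congr (_ *: _).
rewrite linear_sum /= mulmx_suml mulmx_sumr -sumrN.
have -> : \sum_a (\sum_b0 spin_conn i x v a b0 *: (gam (e_ (finset.set1 a)) *m gam (e_ (finset.set1 b0))))^T *m b =
   \sum_a \sum_c spin_conn i x v c a *: (b *m (gam (e_ (finset.set1 a)) *m gam (e_ (finset.set1 c)))).
  rewrite [RHS]exchange_big /=; apply: eq_bigr => a _.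
  rewrite linear_sum mulmx_suml; apply: eq_bigr => c _ /=.
  rewrite linearZ /= -scalemxAl; congr (_ *: _).
  have alg (A B : 'M[R]_8) : (A *m B)^T *m b = B^T *m (A^T *m b) by rewrite trmx_mul mulmxA.
  by rewrite alg gskew mulmxN (mulmxA _ b) gskew mulNmx opprK mulmxA.
apply: eq_bigr => a _; rewrite mulmx_sumr -sumrN; apply: eq_bigr => c _.
have -> : spin_conn i x v c a = - spin_conn i x v a c.
  by have /matrixP/(_ a c) := spin_conn_anti v ix; rewrite [LHS]mxE => ->; rewrite [LHS]mxE.
by rewrite scaleNr -scalemxAr.
Qed.

Lemma nabla_spinorE e : i = ss_at Q x -> nabla_spinor S v e x =
  invmx (T x) *m (mx_dir x v (fun y => T y *m e y) + Om *m (T x *m e x)).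
Proof.
move=> iE; rewrite /nabla_spinor -iE; congr (_ *m (_ + _)).
  by apply/colP => k; rewrite [LHS]mxE [RHS]mxE.
rewrite /Om -scalemxAl; congr (_ *: _); rewrite mulmx_suml; apply: eq_bigr => a _.
rewrite mulmx_suml; apply: eq_bigr => b _.
have [_ _ gM] := gamR.
by rewrite -scalemxAl gM [spin_conn _ _ _ _ _]mxE.
Qed.

Lemma cov3_conj y (iy : ss_dom i y) w1 w2 w3 :
  cov3 (sb_Gamma S y) w1 w2 w3 = invmx (T y) *m
    (gam (ext_covec (w1 *m eta7 *m (ss_frame i y)^T)) *m
     gam (ext_covec (w2 *m eta7 *m (ss_frame i y)^T)) *m
     gam (ext_covec (w3 *m eta7 *m (ss_frame i y)^T))) *m T y.
Proof.
have Tu : T y \in unitmx := sb_triv_unit iy.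
have alg (X1 X2 X3 : 'M[R]_8) : invmx (T y) *m (X1 *m T y) *m (invmx (T y) *m (X2 *m T y)) *m
    (invmx (T y) *m (X3 *m T y)) = invmx (T y) *m (X1 *m X2 *m X3) *m T y.
  by rewrite !mulmxA !(mulmxK Tu).
by rewrite /cov3 !(sb_Gamma_conj iy) alg.
Qed.

(** In the trivialisation only the spinor components and the coframe components of the z_j depend on
    y, so the pairing can be differentiated. *)
Lemma pairing3_conj (b : 'M[R]_8) :
  (forall y, ss_dom i y -> sb_pair S y = (T y)^T *m b *m T y) ->
  forall y (iy : ss_dom i y) (u u' : 'cV[R]_8) z1 z2 z3,
  (sb_pair S y *m u)^T *m cov3 (sb_Gamma S y) z1 z2 z3 *m u' =
  (b *m (T y *m u))^T *m (gam (ext_covec (z1 *m eta7 *m (ss_frame i y)^T)) *m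
    gam (ext_covec (z2 *m eta7 *m (ss_frame i y)^T)) *m
    gam (ext_covec (z3 *m eta7 *m (ss_frame i y)^T))) *m (T y *m u').
Proof.
move=> bE y iy u u' z1 z2 z3; have Tu : T y \in unitmx := sb_triv_unit iy.
rewrite (cov3_conj iy) bE //; move: (_ *m _ *m gam _) => X.
have -> : (T y)^T *m b *m T y *m u = (T y)^T *m (b *m (T y *m u)) by rewrite !mulmxA.
by rewrite (trmx_mul (T y)^T) trmxK !mulmxA (mulmxK Tu).
Qed.

Lemma pairing_conj (b : 'M[R]_8) :
  (forall y, ss_dom i y -> sb_pair S y = (T y)^T *m b *m T y) ->
  forall y (iy : ss_dom i y) (u u' : 'cV[R]_8),
  (sb_pair S y *m u)^T *m u' = (b *m (T y *m u))^T *m (T y *m u').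
Proof.
move=> bE y iy u u'; rewrite bE //.
have -> : (T y)^T *m b *m T y *m u = (T y)^T *m (b *m (T y *m u)) by rewrite !mulmxA.
by rewrite (trmx_mul (T y)^T) trmxK -mulmxA.
Qed.

(* The terms in the connection A cancel: A is skew for the pairing b, and enters
   the derivatives of the factors X_i through commutators. *)
Lemma leibniz_alg (b A X1 X2 X3 Y1 Y2 Y3 : 'M[R]_8) (p u : 'cV[R]_8) :
  A^T *m b = - (b *m A) -> b^T = b ->
  (b *m (u - A *m p))^T *m (X1 *m X2 *m X3) *m p +
  (b *m p)^T *m ((Y1 - (A *m X1 - X1 *m A)) *m X2 *m X3 + X1 *m (Y2 - (A *m X2 - X2 *m A)) *m X3
    + X1 *m X2 *m (Y3 - (A *m X3 - X3 *m A))) *m p +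
  (b *m p)^T *m (X1 *m X2 *m X3) *m (u - A *m p) =
  (b *m u)^T *m (X1 *m X2 *m X3) *m p + (b *m p)^T *m (X1 *m X2 *m X3) *m u
  + ((b *m p)^T *m (Y1 *m X2 *m X3) *m p + (b *m p)^T *m (X1 *m Y2 *m X3) *m p
    + (b *m p)^T *m (X1 *m X2 *m Y3) *m p).
Proof.
move=> skew bT; have -> : (b *m (u - A *m p))^T = (b *m u)^T + (b *m p)^T *m A.
  rewrite !trmx_mul bT linearB /= trmx_mul mulmxBl -(mulmxA p^T) skew mulmxN opprK.
  by rewrite !mulmxA.
move: (b *m u)^T (b *m p)^T => q r.
have mxD (m n : nat) (Z W : 'M[R]_(m, n)) k j : (Z + W) k j = Z k j + W k j by rewrite mxE.
have mxN (m n : nat) (Z : 'M[R]_(m, n)) k j : (- Z) k j = - Z k j by rewrite mxE.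
apply/matrixP => k j.
rewrite !(mulmxDl, mulmxDr, mulmxN, mulNmx, opprD, opprK) !mulmxA.
rewrite !(mxD, mxN).
ring.
Qed.

(** The derivatives of the coframe components bring commutators with [Om] by [spin_conn_comm]; these
    cancel the [Om] terms of the spinor derivatives, leaving covariant derivatives only. The index i
    is the one used by [nabla_spinor] at x. *)
Lemma dir_pairing3 e w1 w2 w3 : i = ss_at Q x ->
  mx_derivable_at x (fun y => T y *m e y) ->
  mx_derivable_at x (fun y => w1 y *m onb (chart_at x) y) ->
  mx_derivable_at x (fun y => w2 y *m onb (chart_at x) y) ->
  mx_derivable_at x (fun y => w3 y *m onb (chart_at x) y) ->
  let q u u' z1 z2 z3 := (sb_pair S x *m u)^T *m cov3 (sb_Gamma S x) z1 z2 z3 *m u' in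
  let de := nabla_spinor S v e x in
  mx_dir x v (fun y => (sb_pair S y *m e y)^T *m cov3 (sb_Gamma S y) (w1 y) (w2 y) (w3 y) *m e y) =
  q de (e x) (w1 x) (w2 x) (w3 x) + q (e x) de (w1 x) (w2 x) (w3 x)
  + (q (e x) (e x) (nabla_vf v w1 x) (w2 x) (w3 x) + q (e x) (e x) (w1 x) (nabla_vf v w2 x) (w3 x)
    + q (e x) (e x) (w1 x) (w2 x) (nabla_vf v w3 x)).
Proof.
move=> iE dpsi dw1 dw2 dw3 q de.
have [b bE bP] := sb_pair_local; have [bT bskew] := bP x ix.
pose psi y := T y *m e y.
pose g th := gam (ext_covec th).
have glin : linear g by apply: lin_comp => //; exact: ext_covec_linear.
have qE y (u u' : 'cV[R]_8) z1 z2 z3 (iy : ss_dom i y) := pairing3_conj bE iy u u' z1 z2 z3.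
have -> : mx_dir x v (fun y => (sb_pair S y *m e y)^T *m cov3 (sb_Gamma S y) (w1 y) (w2 y) (w3 y) *m e y) =
  mx_dir x v (fun y => (b *m psi y)^T *m (g (coframe i w1 y) *m g (coframe i w2 y) *m g (coframe i w3 y)) *m psi y).
  by apply: (mx_dir_eq v (ss_dom_open i) ix) => y iy; exact: qE.
have dg w : mx_derivable_at x (fun y => w y *m onb (chart_at x) y) ->
    mx_derivable_at x (fun y => g (coframe i w y)).
  by move=> dw; apply: mx_derivable_at_linear => //; exact: coframe_derivable.
have dgE w : mx_derivable_at x (fun y => w y *m onb (chart_at x) y) ->
    mx_dir x v (fun y => g (coframe i w y)) = g (coframe i (fun=> nabla_vf v w x) x)
      - (Om *m g (coframe i w x) - g (coframe i w x) *m Om).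
  move=> dw; rewrite (mx_dir_linear _ glin); last exact: coframe_derivable.
  rewrite (coframe_dir v ix dw) spin_conn_comm opprK -[X in g (X + _)]scale1r glin scale1r //.
have dpsiE : mx_dir x v psi = T x *m de - Om *m psi x.
  by rewrite /de (nabla_spinorE _ iE) mulKVmx ?sb_triv_unit // addrK.
have db : mx_derivable_at x (fun y => b *m psi y).
  by apply: mx_derivable_atM => //; exact: mx_derivable_at_cst.
have dbE : mx_dir x v (fun y => b *m psi y) = b *m mx_dir x v psi.
  rewrite mx_dirM //; last exact: mx_derivable_at_cst.
  by rewrite mx_dir_cst mul0mx add0r.
have dgg : mx_derivable_at x (fun y => g (coframe i w1 y) *m g (coframe i w2 y)).
  by apply: mx_derivable_atM; exact: dg.
have dggg : mx_derivable_at x (fun y => g (coframe i w1 y) *m g (coframe i w2 y) *m g (coframe i w3 y)).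
  by apply: mx_derivable_atM => //; exact: dg.
rewrite mx_dirM //; last by apply: mx_derivable_atM => //; exact: mx_derivable_at_tr.
rewrite mx_dirM //; last exact: mx_derivable_at_tr.
rewrite mx_dirM //; last exact: dg.
rewrite mx_dirM; [|exact: dg|exact: dg].
rewrite mx_dir_tr dbE dpsiE !dgE // /q !(qE _ _ _ _ _ _ ix).
rewrite -(leibniz_alg _ _ _ _ _ _ _ _ (spin_conn_skew bskew) bT).
by rewrite !mulmxDl !mulmxDr.
Qed.

Lemma dir_pairing e : i = ss_at Q x -> mx_derivable_at x (fun y => T y *m e y) ->
  let de := nabla_spinor S v e x in
  mx_dir x v (fun y => (sb_pair S y *m e y)^T *m e y) =
  (sb_pair S x *m de)^T *m e x + (sb_pair S x *m e x)^T *m de.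
Proof.
move=> iE dpsi de.
have [b bE bP] := sb_pair_local; have [bT bskew] := bP x ix.
pose psi y := T y *m e y.
have -> : mx_dir x v (fun y => (sb_pair S y *m e y)^T *m e y) =
    mx_dir x v (fun y => (b *m psi y)^T *m psi y).
  by apply: (mx_dir_eq v (ss_dom_open i) ix) => y iy; exact: pairing_conj.
have dpsiE : mx_dir x v psi = T x *m de - Om *m psi x.
  by rewrite /de (nabla_spinorE _ iE) mulKVmx ?sb_triv_unit // addrK.
have db : mx_derivable_at x (fun y => b *m psi y).
  by apply: mx_derivable_atM => //; exact: mx_derivable_at_cst.
have dbE : mx_dir x v (fun y => b *m psi y) = b *m mx_dir x v psi.
  rewrite mx_dirM //; last exact: mx_derivable_at_cst.
  by rewrite mx_dir_cst mul0mx add0r.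
rewrite mx_dirM //; last exact: mx_derivable_at_tr.
rewrite mx_dir_tr dbE dpsiE !(pairing_conj bE ix) -/(psi x).
have skew := spin_conn_skew bskew.
move: (T x *m de) (psi x) => u p.
have -> : (b *m (u - Om *m p))^T = (b *m u)^T + (b *m p)^T *m Om.
  rewrite !trmx_mul bT linearB /= trmx_mul mulmxBl -(mulmxA p^T) skew mulmxN opprK.
  by rewrite !mulmxA.
by rewrite mulmxDl mulmxBr !mulmxA -!addrA; congr (_ + _); rewrite addrCA subrr addr0.
Qed.

End AtPoint.
End Triv.
End SpinorBundle.

(** * The square of a spinor *)

Section Homogeneous.
Variable R : realType.
Implicit Types (al be : extform R).

Lemma ext_homogD k al be : ext_homog k al -> ext_homog k be -> ext_homog k (al + be).
Proof. by move=> ak bk I nI; rewrite ffunE ak // bk // addr0. Qed.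

Lemma ext_homogZ k c al : ext_homog k al -> ext_homog k (c *: al).
Proof. by move=> ak I nI; rewrite ffunE ak // scaler0. Qed.

Lemma ext_homogN k al : ext_homog k al -> ext_homog k (- al).
Proof. by move=> ak I nI; rewrite ffunE ak // oppr0. Qed.

Lemma ext_homog_part k al : ext_homog k (ext_part k al).
Proof. by move=> I /negPf nI; rewrite ffunE nI. Qed.

Lemma ext_homog_wedge k m al be : ext_homog k al -> ext_homog m be ->
  ext_homog (k + m) (wedge al be).
Proof.
move=> ak bm K nK; rewrite ffunE big1 // => I IK.
have [Ik|/ak ->] := eqVneq #|I| k; last by rewrite mul0r mulr0.
rewrite bm ?mulr0 //; apply: contra_neq nK => <-.
by rewrite -Ik -(cardsID I K) (finset.setIidPr IK).
Qed.

Lemma ext_homog_hodge k al : (k <= 7)%N -> ext_homog (7 - k) al -> ext_homog k (hodge al).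
Proof.
move=> k7 ak K nK; rewrite ffunE ak ?mulr0 //; apply: contra_neq nK.
have := cardsC K; rewrite card_ord.
by move=> + H; rewrite H => {}H; lia.
Qed.

Lemma ext_homog_triangle1 k m al be : ext_homog k.+1 al -> ext_homog m.+1 be ->
  ext_homog (k + m) (triangle1 al be).
Proof.
move=> ak bm I nI; rewrite /triangle1 sum_ffunE big1 // => i _; rewrite ffunE.
by rewrite (ext_homog_wedge (ext_homog_int_prod _ ak) (ext_homog_int_prod _ bm)) ?scaler0.
Qed.

Lemma ext_part_id k al : ext_homog k al -> ext_part k al = al.
Proof. by move=> ak; apply/ffunP => I; rewrite ffunE; case: eqP => // /eqP /ak ->. Qed.

Lemma ext_part_homog k m al : k != m -> ext_homog k al -> ext_part m al = 0.
Proof.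
move=> km ak; apply/ffunP => I; rewrite !ffunE; case: eqP => // Im.
by rewrite ak // Im eq_sym.
Qed.

Lemma ext_part0 al : ext_part 0 al = ext_scalar (al finset.set0).
Proof.
apply/ffunP => I; rewrite !ffunE /GRing.scale /= cards_eq0.
by case: eqP => [->|_]; rewrite ?mulr1 ?mulr0.
Qed.

Lemma ext_scalar_homog (c : R) : ext_homog 0 (ext_scalar c).
Proof. by move=> I; rewrite cards_eq0 => /negPf I0; rewrite !ffunE I0 scaler0. Qed.

Lemma ext_scalar0 (c : R) : ext_scalar c finset.set0 = c.
Proof. by rewrite !ffunE eqxx /GRing.scale /= mulr1. Qed.

Lemma cl_mul_scalar c al : cl_mul (ext_scalar c) al = c *: al.
Proof.
by rewrite (linear_scale _ _ (@cl_mul_linearl R al)) cl_mul_basis enum_set0.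
Qed.

Lemma ext_split03 al : (forall I : {set 'I_7}, #|I| != 0%N -> #|I| != 3%N -> al I = 0) ->
  al = ext_scalar (al finset.set0) + ext_part 3 al.
Proof.
move=> al03; apply/ffunP => I; rewrite ffunE -ext_part0 !ffunE.
have [I0|I0] := eqVneq #|I| 0%N; first by rewrite I0 addr0.
by have [I3|I3] := eqVneq #|I| 3%N; rewrite add0r // al03.
Qed.

Lemma ext_scalar_homog_inj (c c' : R) al be : ext_homog 3 al -> ext_homog 3 be ->
  ext_scalar c + al = ext_scalar c' + be -> c = c' /\ al = be.
Proof.
move=> a3 b3 E; have cc' : c = c'.
  move/ffunP: (E) => /(_ finset.set0); rewrite !ffunE !(a3, b3) ?cards0 // !addr0.
  by rewrite -/(ext_scalar c finset.set0) eqxx /GRing.scale /= !mulr1.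
by split=> //; move: E; rewrite cc' => /addrI.
Qed.

(** Kept in the shape of the second equation of the theorem, so that the two agree by conversion. *)
Definition ext_deriv3 (l f : R) (a phi : extform R) : extform R :=
  (2 * f) *: ext_part 3 a + (2 * ext_part 0 a finset.set0) *: phi
  + (2 * l) *: hodge (wedge (ext_part 1 a) phi)
  - 2 *: triangle1 (ext_part 2 a) phi
  + (2 * l) *: hodge (triangle1 (ext_part 3 a) phi).

Lemma ext_deriv3_homog l f a phi : ext_homog 3 phi -> ext_homog 3 (ext_deriv3 l f a phi).
Proof.
move=> phi3.
do ![apply: ext_homogD]; try apply: ext_homogN; try apply: ext_homogZ => //.
- exact: ext_homog_part.
- apply: ext_homog_hodge => //.
  by apply: (@ext_homog_wedge 1 3) => //; exact: ext_homog_part.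
- by apply: (@ext_homog_triangle1 1 2) => //; exact: ext_homog_part.
- apply: ext_homog_hodge => //.
  by apply: (@ext_homog_triangle1 2 2) => //; exact: ext_homog_part.
Qed.

Lemma ext_derivE l f a phi : ext_homog 3 phi -> ext_deriv l a (ext_scalar f + phi) =
  ext_scalar (2 * f * ext_part 0 a finset.set0 - 2 * ext_inner (ext_part 3 a) phi)
  + ext_deriv3 l f a phi.
Proof.
move=> phi3; rewrite /ext_deriv.
have pD k al be : ext_part k (al + be) = ext_part k al + ext_part k be.
  by rewrite -[al in LHS]scale1r ext_part_linear scale1r.
rewrite !pD (ext_part_id (@ext_scalar_homog f)) (ext_part_id phi3).
rewrite (ext_part_homog (k := 3) _ phi3) // (ext_part_homog (k := 0) _ (@ext_scalar_homog f)) //.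
rewrite add0r addr0 !cl_mul_scalar (ext_part0 a) cl_mul_scalar ext_scalar0 /ext_deriv3 ext_part0 ext_scalar0.
move: (ext_part 3 a) (ext_inner (ext_part 3 a) phi) (hodge (wedge (ext_part 1 a) phi))
  (hodge (triangle1 (ext_part 3 a) phi)) (triangle1 (ext_part 2 a) phi) => t c x y z.
by apply/ffunP => I; rewrite !ffunE /GRing.scale /=; ring.
Qed.

End Homogeneous.

Section Squares.
Variable R : realType.

(** Cancelling P leaves u e^T + e u^T = 0. For e_k non-zero, the diagonal entry 2 u_k e_k gives u_k
    = 0, and then column k gives u_i e_k = 0 for all i. *)
Lemma sym_outer_eq0 n (P : 'M[R]_n) (e u : 'cV[R]_n) : P \in unitmx -> e != 0 ->
  u *m (P *m e)^T + e *m (P *m u)^T = 0 -> u = 0.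
Proof.
move=> Pu e0; rewrite !trmx_mul !mulmxA -mulmxDl => /(congr1 (fun A => A *m invmx P^T)).
rewrite mulmxK ?unitmx_tr // mul0mx => E.
have ent i j : u i ord0 * e j ord0 + e i ord0 * u j ord0 = 0.
  by have /matrixP/(_ i j) := E; rewrite !mxE !big_ord1 !mxE.
have [k ek] : exists k, e k ord0 != 0.
  apply/existsP; rewrite -negb_forall; apply: contra e0 => /forallP H.
  by apply/eqP/colP => k; rewrite mxE; apply/eqP/H.
have uk : u k ord0 = 0.
  have /eqP := ent k k; rewrite [e _ _ * _]mulrC -mulr2n -mulr_natl mulf_eq0 pnatr_eq0 /=.
  by rewrite mulf_eq0 (negPf ek) orbF => /eqP.
apply/colP => i; rewrite mxE; have /eqP := ent i k.
by rewrite uk mulr0 addr0 mulf_eq0 (negPf ek) orbF => /eqP.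
Qed.

Lemma tr_outer n (X : 'M[R]_n) (p q : 'cV[R]_n) :
  \tr (X *m (p *m q^T)) = (q^T *m X *m p) ord0 ord0.
Proof. by rewrite mulmxA mxtrace_mulC mulmxA trace_mx11. Qed.

End Squares.

(** * The square of a spinor: components and smoothness *)

Section SpinorSquare.
Variables (R : realType) (M : pseudoRiemannian R) (l : R) (gam : extform R -> 'M[R]_8).
Hypotheses (l_pm1 : l = -1 \/ l = 1) (gamP : is_gamma l gam).
Variable S : paired_spinor_bundle M gam.
Local Notation Q := (sb_spin S).
Local Notation eta7 := (@eta_mx R).
Implicit Types (e : M -> 'cV[R]_8).

Let gamR : cl_rep gam. Proof. by case: gamP. Qed.
Let gam_lin : linear gam. Proof. by case: gamR. Qed.

(** Surjectivity of Gamma on degrees at most 3 makes the defining set non-empty, so [xget] does not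
    fall back on 0. *)
Lemma E_mapP e y : ext_low (E_map S l 1 e y) /\
  sb_Gamma S y (E_map S l 1 e y) = e y *m (sb_pair S y *m e y)^T.
Proof.
rewrite /E_map; set A := [set al | _].
have [al al_low alE] := rep_low_surj (sb_Gamma_rep S y) (spinor_square S 1 y (e y)).
have Aal : A al by split=> //; rewrite (Psi_lowE l_pm1 gamP).
have [A_low AE] := xgetPex 0 (ex_intro A _ Aal); split; first exact: A_low.
by rewrite -(Psi_lowE l_pm1 gamP) [LHS]AE /spinor_square scale1r.
Qed.

Lemma E_map_deg e y (I : {set 'I_7}) : #|I| != 0%N -> #|I| != 3%N -> E_map S l 1 e y I = 0.
Proof.
have [E_low EE] := E_mapP e y; move: I.
(* The square of e is the symmetrised product of e / 2 and e. *)
apply: (sym_square_deg (S := S) (y := y) (u := 2^-1 *: e y) (w := e y) E_low); rewrite EE.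
rewrite -scalemxAr -scalemxAl linearZ /= -scalemxAr -scalerDl.
by rewrite (_ : 2^-1 + 2^-1 = 1) ?scale1r //; field.
Qed.

Lemma E_map_scalar e y : E_map S l 1 e y finset.set0 =
  8^-1 * ((sb_pair S y *m e y)^T *m e y) ord0 ord0.
Proof.
have [E_low EE] := E_mapP e y.
rewrite (rep_coef (sb_Gamma_rep S y) E_low) ?cards0 // EE tr_outer.
have [_ G1 _] := sb_Gamma_rep S y; rewrite ext_scalarE scale1r in G1.
by rewrite G1 mulmx1 ext_sq0 mulr1.
Qed.

Lemma E_map_eval e y w1 w2 w3 : ext_eval (E_map S l 1 e y) [:: w1; w2; w3] =
  - (8^-1 * ((sb_pair S y *m e y)^T *m cov3 (sb_Gamma S y) w1 w2 w3 *m e y) ord0 ord0).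
Proof.
rewrite (ext_eval3 (sb_Gamma_rep S y)); last exact: E_map_deg.
by have [_ ->] := E_mapP e y; rewrite tr_outer.
Qed.

Section Smooth.
Variable e : M -> 'cV[R]_8.
Hypothesis e_smooth : smooth_section S e.

Lemma section_smooth_mx (i : ss_idx Q) : smooth_mx (ss_dom i) (fun y => sb_triv i y *m e y).
Proof. by move=> j k; rewrite (ord1 k); exact: e_smooth. Qed.

Lemma E_map_scalar_smooth : smooth_fun setT (fun y => E_map S l 1 e y finset.set0).
Proof.
apply: smooth_fun_local => x _; pose i := ss_at Q x.
exists (ss_dom i); first exact: ss_atP.
have oi : open (ss_dom i) by exact: ss_dom_open.
have [b bE _] := sb_pair_local i.
have H : smooth_mx (ss_dom i) (fun y => (b *m (sb_triv i y *m e y))^T *m (sb_triv i y *m e y)).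
  apply: smooth_mxM => //; last exact: section_smooth_mx.
  apply: smooth_mx_tr => //; apply: smooth_mxM => //; last exact: section_smooth_mx.
  exact: smooth_mx_cst.
apply: (smooth_fun_eq oi _ (smooth_funM oi (smooth_fun_cst _ 8^-1) (H ord0 ord0))) => y iy.
by rewrite E_map_scalar (pairing_conj bE iy).
Qed.

Lemma E_map_form_smooth : smooth_form setT (fun y => ext_part 3 (E_map S l 1 e y)).
Proof.
move=> V ws oV _ wsV.
(* [smooth_form] tests lists of any length; for a 3-form those of another length give 0. *)
have [w3|w3] := eqVneq (size ws) 3%N; last first.
  apply: (smooth_fun_eq oV _ (smooth_fun_cst V 0)) => x Vx.
  by rewrite (ext_eval_homog (@ext_homog_part _ 3 _)) // size_map.
case: ws w3 wsV => [|w1 [|w2 [|w3 []]]] // _ wsV.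
have V1 := wsV 0%N isT; have V2 := wsV 1%N isT; have V3 := wsV 2%N isT; rewrite /= in V1 V2 V3.
apply: smooth_fun_local => x Vx; pose i := ss_at Q x; pose U := V `&` ss_dom i.
exists U; first by split=> //; exact: ss_atP.
have oU : open U by apply: openI => //; exact: ss_dom_open.
have [b bE _] := sb_pair_local i.
have psiU : smooth_mx U (fun y => sb_triv i y *m e y).
  by apply: smooth_mx_subset (section_smooth_mx i) => y [].
have gU w : smooth_vfield V w -> smooth_mx U (fun y => gam (ext_covec (coframe i w y))).
  move=> Vw; apply: (smooth_mx_linear (h := fun th => gam (ext_covec th))) => //.
    by apply: lin_comp => //; exact: ext_covec_linear.
  exact: coframe_smooth.
have H : smooth_mx U (fun y => (b *m (sb_triv i y *m e y))^T *m
   (gam (ext_covec (coframe i w1 y)) *m gam (ext_covec (coframe i w2 y)) *m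
    gam (ext_covec (coframe i w3 y))) *m (sb_triv i y *m e y)).
  apply: smooth_mxM => //; apply: smooth_mxM => //; last first.
    by apply: smooth_mxM; [|apply: smooth_mxM; [|exact: gU|exact: gU]|exact: gU].
  apply: smooth_mx_tr => //; apply: smooth_mxM => //; exact: smooth_mx_cst.
apply: (smooth_fun_eq oU _ (smooth_funM oU (smooth_fun_cst _ (- 8^-1)) (H ord0 ord0))) => y [Vy iy].
rewrite /= -(pairing3_conj bE iy) mulNr -E_map_eval.
rewrite [in LHS](ext_split03 (@E_map_deg e y)) -[ext_scalar _]scale1r ext_eval_linear.
rewrite (ext_eval_homog (@ext_scalar_homog _ _)) // scaler0 add0r //.
Qed.

End Smooth.
End SpinorSquare.

Lemma nabla_form_eval_homog (R : realType) (M : pseudoRiemannian R) v k (phi : M -> extform R) ws x :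
  (forall y, ext_homog k (phi y)) -> size ws != k -> nabla_form_eval v phi ws x = 0.
Proof.
move=> phik wsk; rewrite /nabla_form_eval big1 ?subr0 => [|j _]; last first.
  apply: (ext_eval_homog (phik x)); rewrite size_set_nth size_map.
  by rewrite (maxn_idPr (ltn_ord j)).
rewrite -[RHS](dir_cst x v 0); apply: (dir_eq v openT) => // y _.
by rewrite (ext_eval_homog (phik y)) // size_map.
Qed.

Lemma const_ext_coord (R : realType) (M : pseudoRiemannian R) (x y : M) u : chart_dom (chart_at x) y ->
  const_ext x u y *m onb (chart_at x) y = u *m onb (chart_at x) x.
Proof. by move=> cy; rewrite /const_ext mulmxKV ?onb_unit. Qed.

Lemma const_ext_derivable (R : realType) (M : pseudoRiemannian R) (x : M) u :
  mx_derivable_at x (fun y => const_ext x u y *m onb (chart_at x) y).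
Proof.
apply: (mx_derivable_at_eq (chart_dom_open (chart_at x)) (chart_atP x) _
  (@mx_derivable_at_cst _ _ x _ _ (u *m onb (chart_at x) x))) => y cy.
by rewrite const_ext_coord.
Qed.

Lemma const_extE (R : realType) (M : pseudoRiemannian R) (x : M) u : const_ext x u x = u.
Proof. by rewrite /const_ext mulmxK // onb_unit //; exact: chart_atP. Qed.

(** * The covariant derivative of the square *)

Section SquareDerivative.
Variables (R : realType) (M : pseudoRiemannian R) (l : R) (gam : extform R -> 'M[R]_8).
Hypotheses (l_pm1 : l = -1 \/ l = 1) (gamP : is_gamma l gam).
Variable S : paired_spinor_bundle M gam.
Local Notation Q := (sb_spin S).

Section Derivative.
Variables (e : M -> 'cV[R]_8) (f : M -> R) (phi : M -> extform R).
Hypotheses (e_smooth : smooth_section S e) (phi3 : forall y, ext_homog 3 (phi y)).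
Hypothesis squareE : forall y, ext_scalar (f y) + phi y = E_map S l 1 e y.

Lemma square_scalarE y : f y = 8^-1 * ((sb_pair S y *m e y)^T *m e y) ord0 ord0.
Proof.
rewrite -(E_map_scalar l_pm1 gamP) -squareE ffunE ext_scalar0 phi3 ?addr0 //.
by rewrite cards0.
Qed.

Lemma square_formE y w1 w2 w3 : ext_eval (phi y) [:: w1; w2; w3] =
  - (8^-1 * ((sb_pair S y *m e y)^T *m cov3 (sb_Gamma S y) w1 w2 w3 *m e y) ord0 ord0).
Proof.
rewrite -(E_map_eval l_pm1 gamP) -squareE -[ext_scalar _]scale1r ext_eval_linear.
by rewrite (ext_eval_homog (@ext_scalar_homog _ _)) // scaler0 add0r.
Qed.

(** The right-hand side is Gamma of some form [be] of degree at most 3, with parts of degree 0 and 3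
    only by symmetry. Its coefficients are traces, that is, pairings of e with [de], and match the
    derivatives of f and phi by the Leibniz rules. *)
Lemma nabla_spinor_square v x : let de := nabla_spinor S v e x in
  sb_Gamma S x (ext_scalar (dir v f x) + nabla_form v phi x) =
  de *m (sb_pair S x *m e x)^T + e x *m (sb_pair S x *m de)^T.
Proof.
move=> de; pose i := ss_at Q x; have ix : ss_dom i x := ss_atP Q x.
have iE : i = ss_at Q x by [].
have dpsi : mx_derivable_at x (fun y => sb_triv i y *m e y).
  exact: smooth_mx_derivable_at (section_smooth_mx e_smooth i) ix.
have [be be_low beE] := rep_low_surj (sb_Gamma_rep S x)
  (de *m (sb_pair S x *m e x)^T + e x *m (sb_pair S x *m de)^T).
rewrite -beE; congr (sb_Gamma S x _).
have be03 := sym_square_deg be_low beE.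
rewrite (ext_split03 be03); congr (ext_scalar _ + _).
  rewrite (rep_coef (sb_Gamma_rep S x) be_low) ?cards0 // ext_sq0 mulr1 beE.
  have [_ G1 _] := sb_Gamma_rep S x; rewrite ext_scalarE scale1r in G1.
  rewrite G1 mul1mx mxtraceD -[X in \tr X]mul1mx tr_outer -[X in _ + \tr X]mul1mx tr_outer !mulmx1.
  transitivity (dir v (fun y => 8^-1 * ((sb_pair S y *m e y)^T *m e y) ord0 ord0) x).
    by apply: (dir_eq v openT) => // y _; rewrite square_scalarE.
  have dp : mx_derivable_at x (fun y => (sb_pair S y *m e y)^T *m e y).
    have [b bE _] := sb_pair_local i.
    have H : mx_derivable_at x (fun y => (b *m (sb_triv i y *m e y))^T *m (sb_triv i y *m e y)).
      apply: mx_derivable_atM => //; apply: mx_derivable_at_tr; apply: mx_derivable_atM => //.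
      exact: mx_derivable_at_cst.
    apply: (mx_derivable_at_eq (ss_dom_open i) ix _ H) => y iy.
    by rewrite (pairing_conj bE iy).
  rewrite dirM; [|exact: derivable_at_cst|exact: dp].
  rewrite dir_cst mul0r add0r; congr (_ * _).
  have := dir_pairing gamP v ix iE dpsi => /matrixP /(_ ord0 ord0).
  by rewrite mxE => ->; rewrite mxE addrC.
apply/ffunP => I; rewrite [LHS]ffunE [RHS]ffunE.
case: eqP => [I3|/eqP I3]; last first.
  by rewrite (nabla_form_eval_homog _ _ phi3) // size_map -cardE.
rewrite -(ext_eval_enum be I3).
have : size (enum I) = 3%N by rewrite -cardE.
case: (enum I) => [|j1 [|j2 [|j3 []]]] //= _.
rewrite (ext_eval3 (sb_Gamma_rep S x)) // beE mulmxDr mxtraceD !tr_outer.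
set w1 := const_ext x (delta_mx ord0 j1).
set w2 := const_ext x (delta_mx ord0 j2).
set w3 := const_ext x (delta_mx ord0 j3).
rewrite /nabla_form_eval /= !big_ord_recl big_ord0 /= !square_formE.
have [dw1 dw2 dw3] : [/\ mx_derivable_at x (fun y => w1 y *m onb (chart_at x) y),
    mx_derivable_at x (fun y => w2 y *m onb (chart_at x) y)
    & mx_derivable_at x (fun y => w3 y *m onb (chart_at x) y)].
  by split; exact: const_ext_derivable.
pose h y := (sb_pair S y *m e y)^T *m cov3 (sb_Gamma S y) (w1 y) (w2 y) (w3 y) *m e y.
have dh : mx_derivable_at x h.
  have [b bE _] := sb_pair_local i.
  have [gam_lin _ _] : cl_rep gam by case: gamP.
  have dg w : mx_derivable_at x (fun y => w y *m onb (chart_at x) y) ->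
      mx_derivable_at x (fun y => gam (ext_covec (coframe i w y))).
    move=> dw; apply: (mx_derivable_at_linear (h := fun th => gam (ext_covec th))).
      by apply: lin_comp => //; exact: ext_covec_linear.
    exact: coframe_derivable.
  have H : mx_derivable_at x (fun y => (b *m (sb_triv i y *m e y))^T *m
     (gam (ext_covec (coframe i w1 y)) *m gam (ext_covec (coframe i w2 y)) *m
      gam (ext_covec (coframe i w3 y))) *m (sb_triv i y *m e y)).
    apply: mx_derivable_atM => //; apply: mx_derivable_atM.
      apply: mx_derivable_at_tr; apply: mx_derivable_atM => //; exact: mx_derivable_at_cst.
    by apply: mx_derivable_atM; [apply: mx_derivable_atM; exact: dg | exact: dg].
  apply: (mx_derivable_at_eq (ss_dom_open i) ix _ H) => y iy.
  by rewrite -(pairing3_conj bE iy).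
have -> : dir v (fun y => ext_eval (phi y) [:: w1 y; w2 y; w3 y]) x = - 8^-1 * (mx_dir x v h) ord0 ord0.
  transitivity (dir v (fun y => - 8^-1 * h y ord0 ord0) x).
    by apply: (dir_eq v openT) => // y _; rewrite square_formE mulNr.
  rewrite dirM; [|exact: derivable_at_cst|exact: dh].
  by rewrite dir_cst mul0r add0r mxE.
(* The [nabla_vf] terms cancel against the corrections in [nabla_form_eval]; the two terms with [de]
   remain. *)
rewrite (dir_pairing3 gamP v ix iE dpsi dw1 dw2 dw3) -/de.
rewrite [w1 x]const_extE [w2 x]const_extE [w3 x]const_extE.
have mxD (m n : nat) (Z W : 'M[R]_(m, n)) k j : (Z + W) k j = Z k j + W k j by rewrite mxE.
by rewrite !mxD; ring.
Qed.

End Derivative.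

Lemma parallel_square x e a (phi : extform R) f : ext_low a -> ext_homog 3 phi ->
  ext_scalar f + phi = E_map S l 1 e x ->
  let Ae := Psi_low S l x a *m e x in
  Ae *m (sb_pair S x *m e x)^T + e x *m (sb_pair S x *m Ae)^T =
  sb_Gamma S x (ext_scalar (2 * f * ext_part 0 a finset.set0 - 2 * ext_inner (ext_part 3 a) phi)
    + ext_deriv3 l f a phi).
Proof.
move=> a_low phi3 E Ae; rewrite /Ae (Psi_lowE l_pm1 gamP).
rewrite -(ext_derivE l f a phi3) E.
have [E_low EE] := E_mapP l_pm1 gamP S e x.
rewrite -(rep_deriv l_pm1 (sb_Gamma_rep S x) (sb_Gamma_vol gamP S x) a_low); last exact: E_map_deg.
rewrite EE -!mulmxA; congr (_ + _ *m _).
rewrite !trmx_mul -!mulmxA; congr (_ *m _).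
by rewrite sb_pair_sym sb_Gamma_adjoint.
Qed.

(** A vanishing square is the case u = e of [sym_outer_eq0]. The condition of being nowhere zero
    thus passes between the spinor and its square. *)
Lemma E_map_eq0 e x : E_map S l 1 e x = 0 <-> e x = 0.
Proof.
have [E_low EE] := E_mapP l_pm1 gamP S e x.
have [G_lin _ _] := sb_Gamma_rep S x.
split=> [E0|e0]; last first.
  apply: (rep_low_inj (sb_Gamma_rep S x) E_low) => [I _|]; first by rewrite ffunE.
  by rewrite EE e0 mul0mx linear0'.
apply/eqP; apply: contraTT isT => e0; apply/negP => _.
move: EE; rewrite E0 linear0' // => EE.
have := sym_outer_eq0 (sb_pair_nondeg S x) e0 (u := e x); rewrite -EE addr0.
by move=> /(_ erefl) /eqP; rewrite (negPf e0).
Qed.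

End SquareDerivative.

(** * Parallel spinors and the equations for their squares *)

Theorem proposition2p6 (R : realType) (M : pseudoRiemannian R)
    (M_connected : connected [set: M]) (M_strongly_spin : strongly_spin M)
    (l : R) (l_pm1 : l = -1 \/ l = 1)
    (gam : extform R -> 'M[R]_8) (gamP : is_gamma l gam)
    (a : M -> 'rV[R]_7 -> extform R) (aP : smooth_one_form_low a) :
  admits_parallel_spinor l gam a
  <->
  exists (f : M -> R) (phi : M -> extform R),
    [/\ smooth_fun setT f,
        smooth_form setT phi /\ (forall x, ext_homog 3 (phi x)),
        forall x, ext_scalar (f x) + phi x != 0,
        exists S : paired_spinor_bundle M gam,
          in_image_E S l 1 (fun x => ext_scalar (f x) + phi x)
      & forall v, smooth_vfield setT v -> forall x,
        let a0 := ext_part 0 (a x (v x)) finset.set0 in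
        let a1 := ext_part 1 (a x (v x)) in
        let a2 := ext_part 2 (a x (v x)) in
        let a3 := ext_part 3 (a x (v x)) in
        dir (v x) f x = 2 * f x * a0 - 2 * ext_inner a3 (phi x)
        /\
        nabla_form (v x) phi x =
          (2 * f x) *: a3 + (2 * a0) *: phi x
          + (2 * l) *: hodge (wedge a1 (phi x))
          - 2 *: triangle1 a2 (phi x)
          + (2 * l) *: hodge (triangle1 a3 (phi x))].
Proof.
have [_ a_low _] := aP.
have nabla_homog v phi x : (forall y, ext_homog 3 (phi y)) -> ext_homog 3 (nabla_form v phi x).
  by move=> phi3 I I3; rewrite ffunE (nabla_form_eval_homog _ _ phi3) // size_map -cardE.
split=> [[S [e [[e_smooth e_par] e0]]]|[f [phi [_ [_ phi3] nz [S [e e_smooth squareE]] eqs]]]].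
  pose f y := E_map S l 1 e y finset.set0; pose phi y := ext_part 3 (E_map S l 1 e y).
  have phi3 y : ext_homog 3 (phi y) by exact: ext_homog_part.
  have squareE y : ext_scalar (f y) + phi y = E_map S l 1 e y.
    by rewrite /f /phi -ext_split03 //; exact: E_map_deg.
  exists f, phi; split.
  - exact: E_map_scalar_smooth.
  - by split=> //; exact: E_map_form_smooth.
  - move=> x; apply: contra (e0 x) => /eqP H; apply/eqP.
    by apply/(E_map_eq0 l_pm1 gamP S e x); rewrite -squareE.
  - by exists S, e.
  move=> v v_smooth x a0 a1 a2 a3.
  have K := nabla_spinor_square l_pm1 gamP e_smooth phi3 squareE (v x) x.
  have [G_lin _ _] := sb_Gamma_rep S x.
  cbv zeta in K; rewrite (e_par v v_smooth x) (parallel_square l_pm1 gamP (a_low x (v x)) (phi3 x) (squareE x)) in K.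
  (* Both sides of [K] come from forms of degree at most 3, where Gamma is injective; degrees 0 and
     3 then give the two equations. *)
  have low3 c be : ext_homog 3 be -> ext_low (ext_scalar c + be).
    move=> be3 I I3; rewrite ffunE be3 ?addr0; last by rewrite neq_ltn I3 orbT.
    by apply: ext_scalar_homog; rewrite -lt0n; apply: leq_trans I3.
  have n3 := nabla_homog _ _ (v x) phi x phi3.
  have d3 := ext_deriv3_homog l (f x) (a x (v x)) (phi3 x).
  have := rep_low_inj (sb_Gamma_rep S x) (low3 _ _ _ n3) (low3 _ _ _ d3) K.
  by move=> /(ext_scalar_homog_inj n3 d3).
have e0 x : e x != 0.
  by apply: contra (nz x) => /eqP /(E_map_eq0 l_pm1 gamP S e x) H; rewrite squareE H.
exists S, e; split=> //; split=> // v v_smooth x.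
have [Ef Ephi] := eqs v v_smooth x.
have := nabla_spinor_square l_pm1 gamP e_smooth phi3 squareE (v x) x; cbv zeta.
rewrite Ef Ephi -(parallel_square l_pm1 gamP (a_low x (v x)) (phi3 x) (squareE x)).
move: (nabla_spinor _ _ _ _) (Psi_low _ _ _ _ *m _) => u w E.
(* By [E] the difference of nabla_v e and its prescribed value has zero symmetrised product with
   e. *)
apply/eqP; rewrite -subr_eq0; apply/eqP.
apply: (sym_outer_eq0 (sb_pair_nondeg S x) (e0 x)).
rewrite mulmxBl mulmxBr linearB /= mulmxBr addrACA -opprD -E subrr //.
Qed.
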